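(* Let $r\ge 0$ and let ${\boldsymbol{k}}=(k_1,\dots,k_r)\in\mathbb{Z}^r$ be an arbitrary integer index. Then there exist finitely many positive indices ${\boldsymbol{l}}$ and rational polynomials $c_{{\boldsymbol{k}},{\boldsymbol{l}}}(x)\in\mathbb{Q}[x]$ such that simultaneously \[\zeta_{\widehat{\mathcal{A}}}({\boldsymbol{k}})=\sum_{{\boldsymbol{l}}}c_{{\boldsymbol{k}},{\boldsymbol{l}}}({\boldsymbol{p}})\,\zeta_{\widehat{\mathcal{A}}}({\boldsymbol{l}})\ \text{ in } \widehat{\mathcal{A}} \qquad\text{and}\qquad \zeta_{\widehat{\mathcal{S}}}({\boldsymbol{k}})=\sum_{{\boldsymbol{l}}}c_{{\boldsymbol{k}},{\boldsymbol{l}}}(t)\,\zeta_{\widehat{\mathcal{S}}}({\boldsymbol{l}})\ \text{ in } \overline{\mathcal{Z}}[[t]].\] Moreover, each positive index ${\boldsymbol{l}}$ occurring has depth at most the number of positive entries of ${\boldsymbol{k}}$, and weight at most the sum of the positive entries of ${\boldsymbol{k}}$.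
   Context: An index is a tuple ${\boldsymbol{k}}=(k_1,\dots,k_r)$ of integers, $r\ge0$ being its depth; it is positive if all $k_i>0$, and then its weight is $k_1+\cdots+k_r$. The empty index $\varnothing$ (depth 0) is positive of weight 0. $\widehat{\mathcal{A}}$-MZVs: Let $\widehat{\mathcal{A}}=\varprojlim_n\bigl[(\prod_{p}\mathbb{Z}/p^n\mathbb{Z})/(\bigoplus_p\mathbb{Z}/p^n\mathbb{Z})\bigr]$ ($p$ over primes), a $\mathbb{Q}$-algebra with $\mathbb{Q}$ diagonally embedded. For any index ${\boldsymbol{k}}$ and prime $p$ put $\zeta_p({\boldsymbol{k}})=\sum_{0<n_1<\cdots<n_r<p}n_1^{-k_1}\cdots n_r^{-k_r}\in\mathbb{Z}_{(p)}$ (empty sum conventions: $\zeta_p(\varnothing)=1$), and $\zeta_{\widehat{\mathcal{A}}}({\boldsymbol{k}})=\bigl((\zeta_p({\boldsymbol{k}})\bmod p^n)_p\bigr)_n\in\widehat{\mathcal{A}}$. Let ${\boldsymbol{p}}=((p\bmod p^n)_p)_n\in\widehat{\mathcal{A}}$. $\widehat{\mathcal{S}}$-MZVs: Let $\mathcal{Z}\subset\mathbb{R}$ be the $\mathbb{Q}$-algebra generated by all multiple zeta values $\zeta(k_1,\dots,k_r)=\sum_{0<n_1<\cdots<n_r}n_1^{-k_1}\cdots n_r^{-k_r}$ ($k_i\ge1$, $k_r\ge2$), and $\overline{\mathcal{Z}}=\mathcal{Z}/\pi^2\mathcal{Z}\cong\mathcal{Z}[\pi i]/\pi i\mathcal{Z}[\pi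 i]$. For $t\in\mathbb{C}\setminus[1,\infty)$ let $\zeta(s_1,\dots,s_r;t)=\sum_{0<n_1<\cdots<n_r}\prod_{j}(n_j-t)^{-s_j}$ (principal branch of $\log(n-t)$; $\zeta(\varnothing;t)=1$), absolutely convergent when $\Re(s_j)+\cdots+\Re(s_r)>r+1-j$ for all $j$, and meromorphically continued to $\mathbb{C}^r$. For $t_+\in\mathbb{C}\setminus(-\infty,-1]$, $t_-\in\mathbb{C}\setminus[1,\infty)$ define $\zeta_{\widehat{\mathcal{U}}}(s_1,\dots,s_r;t_+,t_-)=\sum_{i=0}^r e^{\pi i(s_{i+1}+\cdots+s_r)}\zeta(s_1,\dots,s_i;-t_+)\,\zeta(s_r,\dots,s_{i+1};t_-)$; it is known (Komori) that this extends holomorphically in $(s_1,\dots,s_r,t_+,t_-)$, in particular entire in ${\boldsymbol{s}}$ for fixed $t_\pm$. For an integer index ${\boldsymbol{k}}$, $\zeta_{\widehat{\mathcal{S}}}({\boldsymbol{k}})$ is the Taylor expansion at $t=0$ of $t\mapsto\zeta_{\widehat{\mathcal{U}}}({\boldsymbol{k}};0,t)$, whose coefficients lie in $\mathcal{Z}[\pi i]$, taken modulo $\pi i\mathcal{Z}[\pi i][[t]]$; thus $\zeta_{\widehat{\mathcal{S}}}({\boldsymbol{k}})\in\mathcal{Z}[\pi i][[t]]/\pi i\mathcal{Z}[\pi i][[t]]\cong\overline{\mathcal{Z}}[[t]]$. Conventions: $\zeta_{\widehat{\mathcal{A}}}(\varnothing)=\zeta_{\widehat{\mathcal{S}}}(\varnothing)=1$.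 *)

(* Defs.v *)
From Stdlib Require Import Reals ZArith QArith Qpower Znumtheory List.
From Coquelicot Require Import Coquelicot.
Import ListNotations.

Definition positive_index (l : list Z) : Prop := List.Forall (fun x => Z.lt 0 x) l.
Definition weight (l : list Z) : Z := fold_right Z.add 0%Z l.
Definition depth (l : list Z) : nat := length l.
Definition npos (k : list Z) : nat := length (filter (fun x => Z.ltb 0 x) k).
Definition spos (k : list Z) : Z := fold_right Z.add 0%Z (filter (fun x => Z.ltb 0 x) k).

Definition Qsum_lt (N : nat) (f : nat -> Q) : Q :=
  fold_right Qplus 0%Q (map f (seq 1 (N - 1))).

(* qaux [a_r; ...; a_1] N = sum_{0<n_1<...<n_r<N} prod_j n_j^{-a_j}  *)
Fixpoint qaux (rk : list Z) (N : nat) : Q :=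
  match rk with
  | [] => 1%Q
  | a :: rest => Qsum_lt N (fun m => Qpower (inject_Z (Z.of_nat m)) (- a) * qaux rest m)%Q
  end.

Definition zeta_p (k : list Z) (p : nat) : Q := qaux (rev k) p.

Definition Qpoly := list Q.
Definition Qpoly_eval (c : Qpoly) (x : Q) : Q :=
  fold_right (fun a acc => a + x * acc)%Q 0%Q c.

(* Equality in A-hat of two families (a_p)_p, (b_p)_p of rationals that are
   p-integral for all but finitely many p:  for every n, a_p == b_p mod p^n
   for all but finitely many primes p. *)
Definition Ahat_eq (a b : nat -> Q) : Prop :=
  forall n : nat, exists P0 : nat, forall p : nat,
    prime (Z.of_nat p) -> (P0 < p)%nat ->
    (Z.pow (Z.of_nat p) (Z.of_nat n) | Qnum (Qred (a p - b p)%Q))%Z.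

Definition C_I_pi : C := (0%R, PI).

Definition Cexp (z : C) : C :=
  (exp (fst z) * cos (snd z), exp (fst z) * sin (snd z))%R.

(* principal logarithm on the right half-plane Re z > 0 (only used there) *)
Definition Clog_rhp (z : C) : C := (ln (Cmod z), atan (snd z / fst z))%R.

Definition Cpow_neg (w s : C) : C := Cexp (Copp (Cmult s (Clog_rhp w))).

Definition Csum_lt (N : nat) (f : nat -> C) : C :=
  fold_right Cplus (RtoC 0) (map f (seq 1 (N - 1))).

(* caux [s_r; ...; s_1] t N = sum_{0<n_1<...<n_r<N} prod_j (n_j - t)^{-s_j} *)
Fixpoint caux (rs : list C) (t : C) (N : nat) : C :=
  match rs with
  | [] => RtoC 1
  | a :: rest =>
      Csum_lt N (fun m => Cmult (Cpow_neg (Cminus (RtoC (INR m)) t) a) (caux rest t m))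
  end.

Definition zeta_trunc (s : list C) (t : C) (N : nat) : C := caux (rev s) t N.

Definition Csum_list (l : list C) : C := fold_right Cplus (RtoC 0) l.

Definition zetaU_trunc (s : list C) (t : C) (N : nat) : C :=
  Csum_list (map (fun i =>
      Cmult (Cexp (Cmult C_I_pi (Csum_list (skipn i s))))
            (Cmult (zeta_trunc (firstn i s) (RtoC 0) N)
                   (zeta_trunc (rev (skipn i s)) t N)))
    (seq 0 (S (length s)))).

Fixpoint upd (s : list C) (j : nat) (z : C) : list C :=
  match s, j with
  | [], _ => []
  | _ :: s', O => z :: s'
  | x :: s', S j' => x :: upd s' j' z
  end.

(* F is holomorphic on all of C^r (separately holomorphic in each variable,
   which by Hartogs' theorem is equivalent to holomorphy on C^r) *)
Definition entire_in (r : nat) (F : list C -> C) : Prop :=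
  forall (s : list C), length s = r -> forall j, (j < r)%nat ->
    forall z : C, ex_derive (K := C_AbsRing) (V := C_NormedModule) (fun w => F (upd s j w)) z.

(* the open set {Re s_j > 1 for all j}, contained in the domain of absolute
   convergence of every zeta-factor of zeta_U *)
Definition conv_region (r : nat) (s : list C) : Prop :=
  length s = r /\ List.Forall (fun z => (1 < fst z)%R) s.

Definition Z_to_C (z : Z) : C := RtoC (IZR z).

Definition is_MZV (z : C) : Prop :=
  exists k : list nat, List.Forall (fun a => (1 <= a)%nat) k /\ (2 <= last k 2)%nat /\
    filterlim (fun N => zeta_trunc (map (fun a => RtoC (INR a)) k) (RtoC 0) N)
              eventually (locally z).

Inductive ZPI : C -> Prop :=
  | ZPI_rat : forall q : Q, ZPI (RtoC (Q2R q))
  | ZPI_pi : ZPI C_I_pi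
  | ZPI_mzv : forall z, is_MZV z -> ZPI z
  | ZPI_add : forall x y, ZPI x -> ZPI y -> ZPI (Cplus x y)
  | ZPI_mul : forall x y, ZPI x -> ZPI y -> ZPI (Cmult x y).

Definition eq_mod_pi (x y : C) : Prop :=
  exists w, ZPI w /\ Cminus x y = Cmult C_I_pi w.

(* zetaS k a : the power series a (a n = coefficient of t^n) is the Taylor
   expansion at t = 0 of t |-> zeta_U(k; 0, t), where for each t near 0,
   zeta_U(.; 0, t) is the entire (in s) continuation of the defining series. *)
Definition zetaS (k : list Z) (a : nat -> C) : Prop :=
  exists (rho : R) (F : C -> list C -> C), (0 < rho <= 1)%R /\
    (forall t : C, (Cmod t < rho)%R ->
       entire_in (length k) (F t) /\
       (forall s, conv_region (length k) s ->
          filterlim (fun N => zetaU_trunc s t N) eventually (locally (F t s))) /\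
       is_series (K := C_AbsRing) (V := C_NormedModule)
         (fun n => Cmult (a n) (Cpow t n)) (F t (map Z_to_C k))).

Definition poly_mul_coef (c : Qpoly) (a : nat -> C) (n : nat) : C :=
  Csum_list (map (fun j => Cmult (RtoC (Q2R (nth j c 0%Q))) (a (n - j)%nat)) (seq 0 (S n))).

(* Main.v *)
(* Summing an exponent k_j = -m <= 0 over the points strictly between its two neighbours with a
   polynomial P such that P(x) - P(x-1) = x^m replaces the inner sum by boundary terms, which are
   combinations of sums of depth one less whose exponents have only decreased.  For zeta_p the outer
   boundary points are 0 and p.  For zeta_U(.; 0, t) one reads the defining expression as a sum over
   chains in 1 < 2 < ... < N-1 < t-(N-1) < ... < t-2 < t-1, with x^(-s) defined by log(-1) = - i pi,
   so the outer boundary points are 0 and t, and the same formal combination appears with t in place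
   of p.  Hence the identity on the S-side even holds without reduction modulo i pi.

   On the S-side the relation at an exponent -m lies outside the region of convergence.  Replacing P by
   an Euler-Maclaurin expression in a complex exponent z, whose error term is summable and vanishes at
   z = -m, gives entire functions of z that converge locally uniformly, agree in the limit with the
   nested sums for large Re z, and equal the boundary terms at z = -m.  A uniqueness principle transports
   this to the entire functions in the hypothesis: by the mean value property (Goursat), applied with a
   weight that is small off the arc Re z >= r/3, smallness on that arc implies smallness at the centre.

   Continuations are only given for depth r and for the depths of the indices in the answer.  Therefore the
   nonpositive exponents are eliminated one by one while all other exponents stay far to the right, so that
   no continuation of intermediate depth is needed.  Only real t < 0 are used: then all points have
   absolute value at least 1, and the coefficients at t = 0 are still determined. *)

(* The chain of points has a gap: a primitive taken along it jumps from its value at N-1 to its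
   value at t-N, and for a polynomial primitive this jump in general grows with N. The jump is
   carried by an extra formal point, and the boundary terms that leave it out define the
   interpolating functions [Phi]. For Re z >= 2 the jump is O(1/N), so [Phi] and the nested sums
   have the same limit; at z = -m the boundary terms alone remain. Continuation thus discards the
   divergent jump. All estimates are absolute. Each factor is compared with c/|x|^2, the product of
   the numbers 1 + c/|x|^2 bounds every nested sum, and an increment in N costs a multiple of 1/N -
   1/(N+1), so one constant controls the limits on a whole circle. Eliminating an entry lowers its
   neighbours, so positive entries may become nonpositive. What is preserved is entrywise
   domination: every new index is bounded by the old one with the eliminated entry deleted. This
   gives the bounds on depth and weight, and induction on depth ends the process. *)
Require Import Defs.
From Stdlib Require Import Lia Lra Psatz Qreals.
From Stdlib Require Import Reals ZArith QArith Qpower Znumtheory List.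
From Coquelicot Require Import Coquelicot.
Import ListNotations.
Local Open Scope C_scope.

(** * Nested sums *)

(* Sum over increasing positions i_1 < ... < i_r in xs of f_1(x_(i_1)) ... f_r(x_(i_r)). *)
Fixpoint nest {X : Type} (fs : list (X -> C)) (xs : list X) : C :=
  match fs with
  | [] => RtoC 1
  | f :: fs' =>
      (fix go (xs : list X) : C :=
         match xs with
         | [] => RtoC 0
         | x :: xs' => f x * nest fs' xs' + go xs'
         end) xs
  end.

Lemma nest_nil_l {X} (xs : list X) : nest [] xs = RtoC 1.
Proof. now destruct xs. Qed.

Lemma nest_nil_r {X} (f : X -> C) fs : nest (f :: fs) [] = RtoC 0.
Proof. reflexivity. Qed.

Lemma nest_cons {X} (f : X -> C) fs x xs :
  nest (f :: fs) (x :: xs) = f x * nest fs xs + nest (f :: fs) xs.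
Proof. reflexivity. Qed.

Lemma nest_app_nil {X} (pre : list (X -> C)) f post : nest (pre ++ f :: post) [] = RtoC 0.
Proof. now destruct pre. Qed.

Lemma nest_map {X Y} (g : Y -> X) (xs : list Y) : forall fs : list (X -> C),
  nest fs (map g xs) = nest (map (fun f y => f (g y)) fs) xs.
Proof.
  induction xs as [|x xs IH]; intros [|f fs]; try reflexivity.
  change (map g (x :: xs)) with (g x :: map g xs).
  rewrite nest_cons, IH, IH. reflexivity.
Qed.

Lemma nest_ext {X} (xs : list X) : forall fs gs : list (X -> C),
  Forall2 (fun f g => forall x, In x xs -> f x = g x) fs gs ->
  nest fs xs = nest gs xs.
Proof.
  induction xs as [|x xs IH]; intros fs gs H; inversion H as [|f g fs' gs' H1 H2]; subst; try reflexivity.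
  rewrite !nest_cons. rewrite (H1 x) by now left.
  rewrite (IH fs' gs'), (IH (f :: fs') (g :: gs')); try reflexivity.
  - constructor.
    + intros y Hy. apply H1. now right.
    + eapply Forall2_impl; [|exact H2]. simpl; intros; auto.
  - eapply Forall2_impl; [|exact H2]. simpl; intros; auto.
Qed.

Lemma nest_snoc {X} (f : X -> C) x (xs : list X) : forall fs,
  nest (fs ++ [f]) (xs ++ [x]) = nest fs xs * f x + nest (fs ++ [f]) xs.
Proof.
  induction xs as [|y xs IH]; intros [|g fs]; simpl app.
  - rewrite nest_cons, !nest_nil_l, nest_nil_r. ring.
  - rewrite nest_cons, !nest_nil_r, nest_app_nil. ring.
  - specialize (IH []). simpl app in IH. rewrite !nest_cons, IH, !nest_nil_l. ring.
  - rewrite !nest_cons, IH. specialize (IH (g :: fs)). simpl app in IH. rewrite IH. ring.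
Qed.

Definition csum {X} (f : X -> C) (l : list X) : C := Csum_list (map f l).

Lemma csum_nil {X} (f : X -> C) : csum f [] = RtoC 0.
Proof. reflexivity. Qed.

Lemma csum_cons {X} (f : X -> C) x l : csum f (x :: l) = f x + csum f l.
Proof. reflexivity. Qed.

Lemma csum_app {X} (f : X -> C) l l' : csum f (l ++ l') = csum f l + csum f l'.
Proof. induction l as [|x l IH]; simpl app; rewrite ?csum_cons, ?csum_nil, ?IH; ring. Qed.

Lemma csum_ext {X} (f g : X -> C) l : (forall x, In x l -> f x = g x) -> csum f l = csum g l.
Proof.
  induction l as [|x l IH]; intros H; [reflexivity|].
  rewrite !csum_cons, H by now left. rewrite IH; [reflexivity|]. intros; apply H; now right.
Qed.

Lemma csum_map {X Y} (f : X -> C) (g : Y -> X) l : csum f (map g l) = csum (fun y => f (g y)) l.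
Proof. unfold csum. now rewrite map_map. Qed.

Lemma csum_scal {X} (f : X -> C) c l : csum (fun x => c * f x) l = c * csum f l.
Proof. induction l as [|x l IH]; rewrite ?csum_cons, ?csum_nil, ?IH; ring. Qed.

Lemma csum_plus {X} (f g : X -> C) l : csum (fun x => f x + g x) l = csum f l + csum g l.
Proof. induction l as [|x l IH]; rewrite ?csum_cons, ?csum_nil, ?IH; ring. Qed.

Lemma csum_minus {X} (f g : X -> C) l : csum (fun x => f x - g x) l = csum f l - csum g l.
Proof. induction l as [|x l IH]; rewrite ?csum_cons, ?csum_nil, ?IH; ring. Qed.

Lemma csum_zero {X} (f : X -> C) l : (forall x, In x l -> f x = RtoC 0) -> csum f l = RtoC 0.
Proof.
  induction l as [|x l IH]; intros H; [reflexivity|].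
  rewrite csum_cons, IH, H by (simpl in *; auto). ring.
Qed.

(** This turns the sum over i in the definition of zeta_U into one nested sum over concatenated
    points: i counts the entries placed in the first half. *)
Lemma nest_split {X} (A B : list X) : forall fs : list (X -> C),
  nest fs (A ++ B) =
  csum (fun i => nest (firstn i fs) A * nest (skipn i fs) B) (seq 0 (S (length fs))).
Proof.
  induction A as [|x A IH]; intros fs.
  - simpl app. change (seq 0 (S (length fs))) with (0%nat :: seq 1 (length fs)).
    rewrite csum_cons. simpl firstn. simpl skipn. rewrite nest_nil_l.
    rewrite csum_zero; [ring|]. intros i Hi. apply in_seq in Hi. destruct i as [|i]; [lia|].
    destruct fs as [|f fs]; [simpl in Hi; lia|]. simpl firstn. rewrite nest_nil_r. ring.
  - destruct fs as [|f fs]; simpl app.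
    + change (seq 0 (S (length (@nil (X -> C))))) with [0%nat].
      rewrite csum_cons, csum_nil. simpl firstn. simpl skipn. rewrite !nest_nil_l. ring.
    + rewrite nest_cons, IH, (IH (f :: fs)).
      change (seq 0 (S (length (f :: fs)))) with (0%nat :: seq 1 (S (length fs))).
      rewrite <- seq_shift, !csum_cons, !csum_map. simpl firstn. simpl skipn.
      rewrite !nest_nil_l, <- csum_scal.
      match goal with |- _ + (_ + ?T) = _ + ?T' =>
        enough (E : T' = csum (fun i => f x * (nest (firstn i fs) A * nest (skipn i fs) B)) (seq 0 (S (length fs)))
          + T) end.
      * rewrite E. ring.
      * rewrite <- csum_plus. apply csum_ext. intros i _. rewrite nest_cons. ring.
Qed.

Lemma nest_plus {X} (f g : X -> C) post (xs : list X) : forall pre,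
  nest (pre ++ (fun x => f x + g x) :: post) xs =
  nest (pre ++ f :: post) xs + nest (pre ++ g :: post) xs.
Proof.
  induction xs as [|x xs IH]; intros pre.
  - rewrite !nest_app_nil. ring.
  - destruct pre as [|e pre]; simpl app.
    + specialize (IH []). simpl app in IH. rewrite !nest_cons, IH. ring.
    + pose proof (IH (e :: pre)) as IH2. simpl app in IH2. rewrite !nest_cons, IH, IH2. ring.
Qed.

Lemma nest_scal {X} (f : X -> C) c post (xs : list X) : forall pre,
  nest (pre ++ (fun x => c * f x) :: post) xs = c * nest (pre ++ f :: post) xs.
Proof.
  induction xs as [|x xs IH]; intros pre.
  - rewrite !nest_app_nil. ring.
  - destruct pre as [|e pre]; simpl app.
    + specialize (IH []). simpl app in IH. rewrite !nest_cons, IH. ring.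
    + pose proof (IH (e :: pre)) as IH2. simpl app in IH2. rewrite !nest_cons, IH, IH2. ring.
Qed.

Lemma nest_ext_mid {X} (f g : X -> C) pre post xs :
  (forall x, In x xs -> f x = g x) -> nest (pre ++ f :: post) xs = nest (pre ++ g :: post) xs.
Proof.
  intros H. apply nest_ext, Forall2_app; [|constructor; [exact H|]].
  - induction pre; constructor; auto.
  - induction post; constructor; auto.
Qed.

Lemma nest_csum {X I} (c : I -> C) (F : I -> X -> C) (l : list I) pre post xs :
  nest (pre ++ (fun x => csum (fun i => c i * F i x) l) :: post) xs =
  csum (fun i => c i * nest (pre ++ F i :: post) xs) l.
Proof.
  induction l as [|i l IH].
  - rewrite csum_nil. transitivity (0 * nest (pre ++ (fun _ => RtoC 0) :: post) xs); [|ring].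
    rewrite <- nest_scal. apply nest_ext_mid. intros. rewrite csum_nil. ring.
  - rewrite csum_cons, <- IH, <- nest_scal, <- nest_plus. apply nest_ext_mid.
    intros. now rewrite csum_cons.
Qed.

(** Expanding the product produces all increasing selections of points, so it majorizes nested sums
    of every depth at once. *)
Fixpoint prodv {X} (v : X -> R) (xs : list X) : R :=
  match xs with [] => 1%R | x :: xs' => ((1 + v x) * prodv v xs')%R end.

Definition dominated {X} (v : X -> R) (xs : list X) (f : X -> C) : Prop :=
  forall x, In x xs -> (Cmod (f x) <= v x)%R.

Lemma prodv_ge_1 {X} (v : X -> R) xs : (forall x, 0 <= v x)%R -> (1 <= prodv v xs)%R.
Proof. intros H. induction xs as [|x xs IH]; simpl; [lra|]. specialize (H x). nra. Qed.

Lemma dominated_tl {X} (v : X -> R) x xs f : dominated v (x :: xs) f -> dominated v xs f.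
Proof. intros H y Hy. apply H. now right. Qed.

Lemma Forall_dominated_tl {X} (v : X -> R) x xs fs :
  List.Forall (dominated v (x :: xs)) fs -> List.Forall (dominated v xs) fs.
Proof. apply Forall_impl. intro f. apply dominated_tl. Qed.

Lemma nest_bound {X} (v : X -> R) (xs : list X) : (forall x, 0 <= v x)%R ->
  forall fs, List.Forall (dominated v xs) fs -> (Cmod (nest fs xs) <= prodv v xs)%R.
Proof.
  intros Hv. induction xs as [|x xs IH]; intros fs H.
  - destruct fs; simpl; rewrite ?Cmod_0, ?Cmod_1; lra.
  - destruct fs as [|f fs].
    + rewrite nest_nil_l, Cmod_1. now apply prodv_ge_1.
    + rewrite nest_cons. eapply Rle_trans; [apply Cmod_triangle|].
      rewrite Cmod_mult. simpl prodv.
      pose proof (Forall_dominated_tl _ _ _ _ H) as H'.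
      pose proof (IH _ H'). inversion H' as [|? ? _ H'']; subst. pose proof (IH _ H'').
      inversion H as [|? ? Hf _]; subst. specialize (Hf x (or_introl eq_refl)).
      pose proof (Cmod_ge_0 (f x)). pose proof (Cmod_ge_0 (nest fs xs)). nra.
Qed.

(** Only selections through the new point change, and each carries the factor [v x]. The bound
    serves both for raising the truncation and for inserting the formal jump. *)
Lemma nest_insert {X} (v : X -> R) x (A B : list X) : (forall x, 0 <= v x)%R ->
  forall fs, List.Forall (dominated v (A ++ x :: B)) fs ->
  (Cmod (nest fs (A ++ x :: B) - nest fs (A ++ B)) <= v x * prodv v (A ++ B))%R.
Proof.
  intros Hv. induction A as [|a A IH]; intros fs H; simpl app in *.
  - destruct fs as [|f fs].
    + rewrite !nest_nil_l. replace (1 - 1) with (RtoC 0) by ring. rewrite Cmod_0.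
      pose proof (prodv_ge_1 v B Hv). specialize (Hv x). nra.
    + rewrite nest_cons. replace (_ - _) with (f x * nest fs B) by ring.
      rewrite Cmod_mult. inversion H as [|? ? Hf H']; subst.
      specialize (Hf x (or_introl eq_refl)).
      pose proof (nest_bound v B Hv fs (Forall_dominated_tl _ _ _ _ H')).
      apply Rmult_le_compat; auto using Cmod_ge_0.
  - destruct fs as [|f fs].
    + rewrite !nest_nil_l. replace (1 - 1) with (RtoC 0) by ring. rewrite Cmod_0.
      pose proof (prodv_ge_1 v (a :: A ++ B) Hv). specialize (Hv x). nra.
    + rewrite !nest_cons.
      replace (_ - _) with (f a * (nest fs (A ++ x :: B) - nest fs (A ++ B)) +
        (nest (f :: fs) (A ++ x :: B) - nest (f :: fs) (A ++ B))) by ring.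
      eapply Rle_trans; [apply Cmod_triangle|]. rewrite Cmod_mult. simpl prodv.
      pose proof (Forall_dominated_tl _ _ _ _ H) as H'.
      pose proof (IH _ H'). inversion H' as [|? ? _ H'']; subst. pose proof (IH _ H'').
      inversion H as [|? ? Hf _]; subst. specialize (Hf a (or_introl eq_refl)).
      pose proof (Cmod_ge_0 (f a)). pose proof (Cmod_ge_0 (nest fs (A ++ x :: B) - nest fs (A ++ B))).
      nra.
Qed.

Lemma nest_drop {X} x (A B : list X) : forall fs, List.Forall (fun f : X -> C => f x = RtoC 0) fs ->
  nest fs (A ++ x :: B) = nest fs (A ++ B).
Proof.
  induction A as [|a A IH]; intros fs H; (destruct fs as [|f fs]; [now rewrite !nest_nil_l|]);
    inversion H; subst; simpl app; rewrite !nest_cons.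
  - match goal with E : f x = _ |- _ => rewrite E end. ring.
  - now rewrite !IH.
Qed.

(** * Abel summation inside a nested sum *)

Section Abel.
Context {X : Type} (h hm : X -> C).

(** [hm] stands for [h] at the preceding point. As a separate function it can take a prescribed
    value at the first point and at the jump between the two halves, where the predecessor is not x
    - 1. *)
Fixpoint chain (c : C) (xs : list X) : Prop :=
  match xs with [] => True | x :: xs' => hm x = c /\ chain (h x) xs' end.

Fixpoint lastv (c : C) (xs : list X) : C :=
  match xs with [] => c | x :: xs' => lastv (h x) xs' end.

Lemma chain_app c A B : chain c A -> chain (lastv c A) B -> chain c (A ++ B).
Proof.
  revert c; induction A as [|x A IH]; intros c; simpl; [easy|]. intros [H1 H2] H. auto.
Qed.

Lemma lastv_app c A B : lastv c (A ++ B) = lastv (lastv c A) B.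
Proof. revert c; induction A as [|x A IH]; intros c; simpl; auto. Qed.

(* lst is the value of h at the last point; it takes the place of hm at a right neighbour. *)
Definition absorb_right (lst : C) (pre post : list (X -> C)) (xs : list X) : C :=
  match post with
  | [] => lst * nest pre xs
  | f :: post' => nest (pre ++ (fun x => f x * hm x) :: post') xs
  end.

Lemma abel_first xs : forall c post, chain c xs ->
  nest ((fun x => h x - hm x) :: post) xs = absorb_right (lastv c xs) [] post xs - c * nest post xs.
Proof.
  induction xs as [|x xs IH]; intros c post Hc.
  - destruct post as [|f post]; simpl; ring.
  - destruct Hc as [H1 H2]. rewrite nest_cons, (IH _ post H2), H1. simpl lastv.
    destruct post as [|f post]; unfold absorb_right; simpl app.
    + rewrite !nest_nil_l. ring.
    + rewrite !nest_cons, H1. ring.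
Qed.

(** For fixed positions of the neighbours the inner sum telescopes to [hm] at the right one minus
    [h] at the left one, and the neighbouring factors absorb these values. *)
Lemma abel_later e xs : forall pre c post, chain c xs ->
  nest (pre ++ e :: (fun x => h x - hm x) :: post) xs =
  absorb_right (lastv c xs) (pre ++ [e]) post xs - nest (pre ++ (fun x => e x * h x) :: post) xs.
Proof.
  induction xs as [|x xs IH]; intros pre c post Hc.
  - rewrite !nest_app_nil. destruct post as [|f post]; unfold absorb_right; rewrite !nest_app_nil; ring.
  - destruct Hc as [H1 H2]. destruct pre as [|d pre]; simpl app.
    + pose proof (IH [] _ post H2) as IH1. simpl app in IH1.
      rewrite nest_cons, IH1, (abel_first _ _ _ H2). simpl lastv.
      destruct post as [|f post]; unfold absorb_right; simpl app; rewrite !nest_cons, ?nest_nil_l; ring.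
    + pose proof (IH (d :: pre) _ post H2) as IH1. simpl app in IH1.
      pose proof (IH pre _ post H2) as IH2.
      rewrite nest_cons, IH1, IH2. simpl lastv.
      destruct post as [|f post]; unfold absorb_right; simpl app; rewrite <- ?app_assoc; simpl app;
        rewrite !nest_cons, <- ?app_assoc; simpl app; ring.
Qed.

(** The reversal exposes the last entry of [pre], which is the left neighbour; if there is none, the
    initial value [c0] takes its place. *)
Definition boundary_terms (lst c0 : C) (pre post : list (X -> C)) (xs : list X) : C :=
  absorb_right lst pre post xs -
  match rev pre with
  | [] => c0 * nest post xs
  | e :: rpre => nest (rev rpre ++ (fun x => e x * h x) :: post) xs
  end.

Lemma abel_summation c0 pre post xs : chain c0 xs ->
  nest (pre ++ (fun x => h x - hm x) :: post) xs = boundary_terms (lastv c0 xs) c0 pre post xs.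
Proof.
  intros H. unfold boundary_terms. destruct pre as [|e pre _] using rev_ind; [exact (abel_first xs c0 post H)|].
  rewrite rev_app_distr. cbn [rev app]. rewrite rev_involutive, <- app_assoc. exact (abel_later e xs pre c0 post H).
Qed.
End Abel.

(** * Complex derivatives *)

Lemma INR_S_pos n : (0 < INR (S n))%R.
Proof. apply lt_0_INR. lia. Qed.

Notation cder := (is_derive (K := C_AbsRing) (V := C_NormedModule)).
Notation rder := (is_derive (K := R_AbsRing) (V := C_R_NormedModule)).

Lemma C_R_norm (z : C) : norm (V := C_R_NormedModule) z = Cmod z.
Proof.
  unfold norm; simpl. unfold prod_norm, Cmod. unfold norm; simpl. unfold abs; simpl.
  f_equal. rewrite !Rmult_1_r, <- !Rabs_mult, !Rabs_pos_eq; nra.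
Qed.

(** C carries two normed-module structures over itself: the product rule is stated for one, the
    derivatives of the theorem for the other. *)
Lemma cder_AbsRing (f : C -> C) z d :
  is_derive (K := C_AbsRing) (V := AbsRing_NormedModule C_AbsRing) f z d <-> cder f z d.
Proof.
  split; intros [[H1 H2 H3] H4]; split; try exact H4; split; [exact H1|exact H2|exact H3|exact H1|exact H2|exact H3].
Qed.

Lemma cder_eps (f : C -> C) z d :
  cder f z d <->
  forall eps : posreal, exists delta : posreal, forall w,
    (Cmod (w - z) < delta)%R -> (Cmod (f w - f z - d * (w - z)) <= eps * Cmod (w - z))%R.
Proof.
  split.
  - intros [_ H] eps. destruct (H z (fun P HP => HP) eps) as [delta Hd].
    exists delta. intros w Hw. rewrite (Cmult_comm d). exact (Hd w Hw).
  - intros H. split; [apply is_linear_scal_l|]. intros x Hx eps.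
    rewrite <- (is_filter_lim_locally_unique (K := C_AbsRing) (V := AbsRing_NormedModule C_AbsRing) z x Hx).
    destruct (H eps) as [delta Hd]. exists delta. intros w Hw.
    specialize (Hd w Hw). rewrite (Cmult_comm d) in Hd. exact Hd.
Qed.

Lemma cder_ext (f g : C -> C) z d : (forall w, f w = g w) -> cder f z d -> cder g z d.
Proof. apply is_derive_ext. Qed.

Lemma cder_const (c z : C) : cder (fun _ => c) z (RtoC 0).
Proof. exact (is_derive_const (K := C_AbsRing) (V := C_NormedModule) c z). Qed.

Lemma cder_id (z : C) : cder (fun w => w) z (RtoC 1).
Proof. apply cder_AbsRing. exact (is_derive_id (K := C_AbsRing) z). Qed.

Lemma cder_plus (f g : C -> C) z df dg :
  cder f z df -> cder g z dg -> cder (fun w => f w + g w) z (df + dg).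
Proof. exact (is_derive_plus (K := C_AbsRing) (V := C_NormedModule) f g z df dg). Qed.

Lemma cder_mult (f g : C -> C) z df dg :
  cder f z df -> cder g z dg -> cder (fun w => f w * g w) z (df * g z + f z * dg).
Proof.
  intros H1 H2. apply cder_AbsRing. apply cder_AbsRing in H1. apply cder_AbsRing in H2.
  apply (is_derive_mult (K := C_AbsRing) f g z df dg H1 H2). intros; apply Cmult_comm.
Qed.

Lemma cder_comp (f g : C -> C) z df dg :
  cder f (g z) df -> cder g z dg -> cder (fun w => f (g w)) z (dg * df).
Proof.
  intros H1 H2. apply (is_derive_comp (K := C_AbsRing) (V := C_NormedModule) f g); [exact H1|].
  now apply cder_AbsRing.
Qed.

Definition entire (f : C -> C) : Prop := forall z, exists d, cder f z d.

Lemma entire_const c : entire (fun _ => c).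
Proof. intros z. exists (RtoC 0). apply cder_const. Qed.

Lemma entire_id : entire (fun w => w).
Proof. intros z. exists (RtoC 1). apply cder_id. Qed.

Lemma entire_plus f g : entire f -> entire g -> entire (fun w => f w + g w).
Proof. intros Hf Hg z. destruct (Hf z), (Hg z). eexists. eapply cder_plus; eassumption. Qed.

Lemma entire_mult f g : entire f -> entire g -> entire (fun w => f w * g w).
Proof. intros Hf Hg z. destruct (Hf z), (Hg z). eexists. eapply cder_mult; eassumption. Qed.

Lemma entire_comp f g : entire f -> entire g -> entire (fun w => f (g w)).
Proof. intros Hf Hg z. destruct (Hf (g z)), (Hg z). eexists. eapply cder_comp; eassumption. Qed.

Lemma entire_ext f g : (forall w, f w = g w) -> entire f -> entire g.
Proof. intros H Hf z. destruct (Hf z). eexists. eapply cder_ext; eassumption. Qed.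

Lemma entire_minus f g : entire f -> entire g -> entire (fun w => f w - g w).
Proof.
  intros Hf Hg z. destruct (Hf z), (Hg z). eexists.
  apply (is_derive_minus (K := C_AbsRing) (V := C_NormedModule)); eassumption.
Qed.

(* Syntactic matching: plain unification would unfold the operations of C. *)
Ltac entire_tac :=
  repeat match goal with
  | |- entire (fun w => Cplus (@?f w) (@?g w)) => apply (entire_plus f g)
  | |- entire (fun w => Cminus (@?f w) (@?g w)) => apply (entire_minus f g)
  | |- entire (fun w => Cmult (@?f w) (@?g w)) => apply (entire_mult f g)
  | |- entire (fun _ => ?c) => apply (entire_const c)
  | |- entire (fun w => w) => apply entire_id
  end; auto.

Lemma entire_csum {X} (F : X -> C -> C) l :
  (forall x, In x l -> entire (F x)) -> entire (fun w => csum (fun x => F x w) l).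
Proof.
  induction l as [|x l IH]; intros H; [exact (entire_const (RtoC 0))|].
  apply (entire_plus (F x)); [apply H; now left|]. apply IH. intros; apply H; now right.
Qed.

Lemma entire_nest {X} (fs : list (C -> X -> C)) (xs : list X) :
  (forall f, In f fs -> forall x, In x xs -> entire (fun z => f z x)) ->
  entire (fun z => nest (map (fun f => f z) fs) xs).
Proof.
  revert fs. induction xs as [|x xs IH]; intros fs H.
  - apply (entire_ext (fun z => nest (map (fun f : C -> X -> C => f (RtoC 0)) fs) [])).
    + intros w. now destruct fs.
    + apply entire_const.
  - destruct fs as [|f fs].
    + exact (entire_const (RtoC 1)).
    + apply (entire_ext (fun z => f z x * nest (map (fun f => f z) fs) xs
                                  + nest (map (fun f => f z) (f :: fs)) xs)).
      * reflexivity.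
      * apply entire_plus; [apply entire_mult|]; [apply H; now left|apply IH|apply IH];
          intros; apply H; simpl in *; tauto.
Qed.

(** Restriction of scalars: complex differentiability becomes real differentiability, so that f can
    be composed with real paths. *)
Lemma cder_filterdiff (f : C -> C) (z d : C) : cder f z d ->
  filterdiff (K := R_AbsRing) (U := C_R_NormedModule) (V := C_R_NormedModule) f (locally z) (fun h => d * h).
Proof.
  intros H. split.
  - split.
    + intros x y. exact (Cmult_plus_distr_l d x y).
    + intros k x. apply injective_projections; simpl; unfold scal; simpl; unfold mult; simpl; ring.
    + exists (Cmod d + 1)%R. pose proof (Cmod_ge_0 d). split; [lra|]. intros x.
      rewrite !C_R_norm, Cmod_mult. pose proof (Cmod_ge_0 x). nra.
  - intros x Hx eps.
    rewrite <- (is_filter_lim_locally_unique (K := R_AbsRing) (V := C_R_NormedModule) z x Hx).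
    destruct (proj1 (cder_eps f z d) H eps) as [delta Hd]. apply (locally_le_locally_norm (V := C_R_NormedModule) z).
    exists delta. intros y Hy. unfold ball_norm in Hy. rewrite C_R_norm in *. rewrite C_R_norm. exact (Hd y Hy).
Qed.

Lemma rder_comp (f : C -> C) (g : R -> C) t df dg :
  cder f (g t) df -> rder g t dg -> rder (fun u => f (g u)) t (df * dg).
Proof.
  intros Hf Hg.
  apply (filterdiff_ext_lin _ _ _ (filterdiff_comp' g f t _ _ Hg (cder_filterdiff f (g t) df Hf))).
  intros y. apply injective_projections; simpl; unfold scal; simpl; unfold mult; simpl; ring.
Qed.

Lemma rder_pair (u v : R -> R) (t du dv : R) :
  is_derive u t du -> is_derive v t dv -> rder (fun s => (u s, v s)) t (du, dv).
Proof.
  intros Hu Hv.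
  pose proof (is_derive_plus (K := R_AbsRing) (V := C_R_NormedModule) _ _ t _ _
    (is_derive_scal_l (V := C_R_NormedModule) u t du (RtoC 1) Hu)
    (is_derive_scal_l (V := C_R_NormedModule) v t dv Ci Hv)) as H.
  assert (E : forall x y : R, plus (scal (V := C_R_NormedModule) x (RtoC 1)) (scal y Ci) = (x, y)).
  { intros x y. apply injective_projections; simpl; unfold plus, scal; simpl; unfold mult; simpl; ring. }
  rewrite E in H. revert H. apply is_derive_ext. intros s. apply E.
Qed.

Lemma rder_fst (g : R -> C) t d : rder g t d -> is_derive (fun u => fst (g u)) t (fst d).
Proof.
  intros H. apply (filterdiff_ext_lin _ (fun y => fst (scal (V := C_R_NormedModule) y d))); [|reflexivity].
  apply (filterdiff_comp' (V := C_R_NormedModule) g fst t _ fst H). apply filterdiff_linear, is_linear_fst.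
Qed.

Lemma rder_snd (g : R -> C) t d : rder g t d -> is_derive (fun u => snd (g u)) t (snd d).
Proof.
  intros H. apply (filterdiff_ext_lin _ (fun y => snd (scal (V := C_R_NormedModule) y d))); [|reflexivity].
  apply (filterdiff_comp' (V := C_R_NormedModule) g snd t _ snd H). apply filterdiff_linear, is_linear_snd.
Qed.

Lemma abs_im_le_Cmod (z : C) : (Rabs (snd z) <= Cmod z)%R.
Proof. eapply Rle_trans; [apply Rmax_r|apply Rmax_Cmod]. Qed.

Lemma Cmod_le_abs (z : C) : (Cmod z <= Rabs (fst z) + Rabs (snd z))%R.
Proof.
  replace z with (RtoC (fst z) + Ci * RtoC (snd z)) at 1 by (apply injective_projections; simpl; ring).
  eapply Rle_trans; [apply Cmod_triangle|]. rewrite Cmod_mult, !Cmod_R, Cmod_Ci. lra.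
Qed.

(* Applying the real mean value theorem to both coordinates loses a factor 2, which is harmless. *)
Lemma mean_value_bound (g dg : R -> C) (b D : R) : (0 <= b <= 1)%R -> (0 <= D)%R ->
  (forall t, (0 <= t <= b)%R -> rder g t (dg t) /\ (Cmod (dg t) <= D)%R) ->
  (Cmod (g b - g 0%R) <= 2 * D)%R.
Proof.
  intros Hb HD H. eapply Rle_trans; [apply Cmod_le_abs|].
  assert (B : forall p : C -> R, (forall t d, rder g t d -> is_derive (fun u => p (g u)) t (p d)) ->
     (forall z, Rabs (p z) <= Cmod z)%R -> (Rabs (p (g b) - p (g 0%R)) <= D)%R).
  { intros p Hp Hm. destruct (MVT_gen (fun t => p (g t)) 0 b (fun t => p (dg t))) as [c [Hc E]];
      rewrite ?Rmin_left, ?Rmax_right in * by lra.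
    - intros x Hx. apply Hp, H. lra.
    - intros x Hx. apply derivable_continuous_pt. exists (p (dg x)). apply is_derive_Reals. now apply Hp, H.
    - rewrite E, Rminus_0_r, Rabs_mult, (Rabs_pos_eq b), <- (Rmult_1_r D) by lra.
      apply Rmult_le_compat; [apply Rabs_pos|lra| |lra]. eapply Rle_trans; [apply Hm|now apply H]. }
  pose proof (B fst (rder_fst g) re_le_Cmod). pose proof (B snd (rder_snd g) abs_im_le_Cmod).
  simpl. unfold Rminus in *. lra.
Qed.

(** * The complex exponential and its Taylor remainders *)

Lemma Cexp_plus (a b : C) : Cexp (a + b) = Cexp a * Cexp b.
Proof.
  unfold Cexp. apply injective_projections; simpl;
    rewrite exp_plus, ?cos_plus, ?sin_plus; ring.
Qed.

Lemma Cexp_0 : Cexp (RtoC 0) = RtoC 1.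
Proof. unfold Cexp. apply injective_projections; simpl; rewrite exp_0, ?cos_0, ?sin_0; ring. Qed.

Lemma Cmod_Cexp (z : C) : Cmod (Cexp z) = exp (fst z).
Proof.
  unfold Cexp, Cmod; simpl.
  match goal with |- sqrt ?x = _ => replace x with (exp (fst z) * exp (fst z) * (Rsqr (sin (snd z)) + Rsqr (cos (snd
    z))))%R by (unfold Rsqr; ring) end.
  rewrite sin2_cos2, Rmult_1_r. apply sqrt_square. left. apply exp_pos.
Qed.

Lemma Cexp_nat (n : nat) (z : C) : Cexp (RtoC (INR n) * z) = Cpow (Cexp z) n.
Proof.
  induction n as [|n IH].
  - simpl. rewrite <- Cexp_0. f_equal. ring.
  - rewrite S_INR, RtoC_plus. simpl Cpow. rewrite <- IH, <- Cexp_plus. f_equal. ring.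
Qed.

Lemma rder_Cexp_line (w : C) (t : R) : rder (fun u => Cexp (RtoC u * w)) t (w * Cexp (RtoC t * w)).
Proof.
  destruct w as [a b].
  apply (is_derive_ext (fun u => (exp (u * a) * cos (u * b), exp (u * a) * sin (u * b))%R)).
  { intros u. unfold Cexp. simpl.
    replace (u * a - 0 * b)%R with (u * a)%R by ring. now replace (u * b + 0 * a)%R with (u * b)%R by ring. }
  replace ((a, b) * Cexp (RtoC t * (a, b))) with
    ((a * exp (t * a) * cos (t * b) - b * exp (t * a) * sin (t * b),
      a * exp (t * a) * sin (t * b) + b * exp (t * a) * cos (t * b))%R : C).
  2:{ unfold Cexp. apply injective_projections; simpl;
      replace (t * a - 0 * b)%R with (t * a)%R by ring; replace (t * b + 0 * a)%R with (t * b)%R by ring; ring. }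
  apply (rder_pair (fun u => exp (u * a) * cos (u * b))%R (fun u => exp (u * a) * sin (u * b))%R t);
    auto_derive; auto; ring.
Qed.

Lemma rder_id (t : R) : rder RtoC t (RtoC 1).
Proof. exact (rder_pair (fun s => s) (fun _ => 0%R) t 1 0 (is_derive_id t) (is_derive_const 0%R t)). Qed.

Lemma Cmod_Cexp_line (w : C) (t : R) : (0 <= t <= 1)%R -> (Cmod (Cexp (RtoC t * w)) <= exp (Rmax 0 (fst w)))%R.
Proof.
  intros Ht. rewrite Cmod_Cexp. simpl. destruct w as [a b]; simpl.
  replace (t * a - 0 * b)%R with (t * a)%R by ring.
  assert (t * a <= Rmax 0 a)%R.
  { pose proof (Rmax_l 0 a). pose proof (Rmax_r 0 a). nra. }
  destruct H as [H|H]; [left; now apply exp_increasing|right; now rewrite H].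
Qed.

(** The mean value bound along the segment from 0 to w. The two remainder estimates below repeat the
    argument, each feeding on the preceding bound and doubling its constant. *)
Lemma Cexp_minus_1_bound (w : C) : (Cmod (Cexp w - RtoC 1) <= 2 * (Cmod w * exp (Rmax 0 (fst w))))%R.
Proof.
  assert (HD : (0 <= Cmod w * exp (Rmax 0 (fst w)))%R)
    by (apply Rmult_le_pos; [apply Cmod_ge_0|left; apply exp_pos]).
  pose proof (mean_value_bound (fun u => Cexp (RtoC u * w)) (fun t => w * Cexp (RtoC t * w))
    1 _ ltac:(lra) HD) as H. cbv beta in H.
  replace (RtoC 1 * w) with w in H by ring. replace (RtoC 0 * w) with (RtoC 0) in H by ring.
  rewrite Cexp_0 in H. apply H. intros t Ht. split; [apply rder_Cexp_line|].
  rewrite Cmod_mult. apply Rmult_le_compat_l; [apply Cmod_ge_0|]. now apply Cmod_Cexp_line.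
Qed.

Lemma rder_plus (f g : R -> C) t df dg : rder f t df -> rder g t dg -> rder (fun u => f u + g u) t (df + dg).
Proof. exact (is_derive_plus (K := R_AbsRing) (V := C_R_NormedModule) f g t df dg). Qed.

Lemma rder_const (c : C) t : rder (fun _ => c) t (RtoC 0).
Proof. exact (is_derive_const (K := R_AbsRing) (V := C_R_NormedModule) c t). Qed.

Lemma rder_ext (f g : R -> C) t d : (forall u, f u = g u) -> rder f t d -> rder g t d.
Proof. exact (is_derive_ext (K := R_AbsRing) (V := C_R_NormedModule) f g t d). Qed.

Lemma cder_cmult (c : C) f z d : cder f z d -> cder (fun w => c * f w) z (c * d).
Proof.
  intros H. replace (c * d) with (RtoC 0 * f z + c * d) by ring.
  apply (cder_mult (fun _ => c)); [apply cder_const|exact H].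
Qed.

Lemma rder_cmult (c : C) g t d : rder g t d -> rder (fun u => c * g u) t (c * d).
Proof.
  intros H. apply (rder_comp (fun w => c * w) g); [|exact H].
  pose proof (cder_cmult c (fun w => w) (g t) (RtoC 1) (cder_id _)) as H0.
  rewrite Cmult_1_r in H0. exact H0.
Qed.

Lemma cder_pow (n : nat) z : cder (fun w => Cpow w (S n)) z (RtoC (INR (S n)) * Cpow z n).
Proof.
  induction n as [|n IH].
  - simpl. replace (RtoC 1 * RtoC 1) with (RtoC 1 * RtoC 1 + z * RtoC 0) by ring.
    apply cder_mult; [apply cder_id|apply cder_const].
  - replace (RtoC (INR (S (S n))) * Cpow z (S n)) with
      (RtoC 1 * Cpow z (S n) + z * (RtoC (INR (S n)) * Cpow z n))
      by (rewrite (S_INR (S n)), RtoC_plus; simpl Cpow; ring).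
    apply (cder_mult (fun w => w) (fun w => Cpow w (S n))); [apply cder_id|exact IH].
Qed.

Lemma rder_pow (n : nat) (c : C) t :
  rder (fun u => Cpow (RtoC u * c) (S n)) t (RtoC (INR (S n)) * Cpow (RtoC t * c) n * c).
Proof.
  apply (rder_comp (fun w => Cpow w (S n)) (fun u => RtoC u * c)); [apply cder_pow|].
  apply (rder_ext (fun u => c * RtoC u)); [intros; ring|].
  pose proof (rder_cmult c RtoC t (RtoC 1) (rder_id _)) as H0. rewrite Cmult_1_r in H0. exact H0.
Qed.

Lemma exp_1_le_3 (x : R) : (x <= 1)%R -> (exp x <= 3)%R.
Proof.
  intros H. apply Rle_trans with (exp 1); [|apply exp_le_3].
  destruct H as [H|H]; [left; now apply exp_increasing|right; now rewrite H].
Qed.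

Lemma Cexp_remainder_1 (w : C) : (Cmod w <= 1)%R ->
  (Cmod (Cexp w - RtoC 1 - w) <= 12 * Cmod w ^ 2)%R.
Proof.
  (* 6 is 2 * 3, with 3 bounding exp 1; the mean value bound doubles it to 12. *)
  intros Hw. assert (HD : (0 <= 6 * Cmod w ^ 2)%R) by (pose proof (pow2_ge_0 (Cmod w)); lra).
  pose proof (mean_value_bound (fun u => Cexp (RtoC u * w) + (- w) * RtoC u)
    (fun t => w * Cexp (RtoC t * w) + (- w) * RtoC 1) 1 _ ltac:(lra) HD) as H. cbv beta in H.
  replace (RtoC 1 * w) with w in H by ring. replace (RtoC 0 * w) with (RtoC 0) in H by ring.
  rewrite Cexp_0 in H.
  replace (Cexp w - RtoC 1 - w) with (Cexp w + - w * RtoC 1 - (RtoC 1 + - w * RtoC 0)) by ring.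
  eapply Rle_trans; [apply H|lra]. intros t Ht. split.
  - apply rder_plus; [apply rder_Cexp_line|apply rder_cmult, rder_id].
  - replace (w * Cexp (RtoC t * w) + - w * RtoC 1) with (w * (Cexp (RtoC t * w) - RtoC 1)) by ring.
    rewrite Cmod_mult. pose proof (Cexp_minus_1_bound (RtoC t * w)) as B.
    assert (Hm : (Cmod (RtoC t * w) <= Cmod w)%R).
    { rewrite Cmod_mult, Cmod_R, Rabs_pos_eq by lra. pose proof (Cmod_ge_0 w). nra. }
    assert (exp (Rmax 0 (fst (RtoC t * w)%C)) <= 3)%R.
    { apply exp_1_le_3, Rmax_lub; [lra|]. eapply Rle_trans; [apply Rle_abs|].
      eapply Rle_trans; [apply re_le_Cmod|lra]. }
    pose proof (Cmod_ge_0 w). pose proof (Cmod_ge_0 (RtoC t * w)).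
    pose proof (exp_pos (Rmax 0 (fst (RtoC t * w)%C))).
    assert (Cmod (Cexp (RtoC t * w) - RtoC 1) <= 6 * Cmod w)%R by nra. nra.
Qed.

Lemma Cexp_remainder_2 (w : C) : (Cmod w <= 1)%R ->
  (Cmod (Cexp w - RtoC 1 - w - w * w / RtoC 2) <= 24 * Cmod w ^ 3)%R.
Proof.
  intros Hw. assert (HD : (0 <= 12 * Cmod w ^ 3)%R) by (pose proof (pow_le _ 3 (Cmod_ge_0 w)); lra).
  pose proof (mean_value_bound (fun u => Cexp (RtoC u * w) + ((- w) * RtoC u + (- / RtoC 2) * Cpow (RtoC u * w) 2))
    (fun t => w * Cexp (RtoC t * w) + ((- w) * RtoC 1 + (- / RtoC 2) * (RtoC (INR 2) * Cpow (RtoC t * w) 1 * w)))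
    1 _ ltac:(lra) HD) as H. cbv beta in H.
  replace (RtoC 1 * w) with w in H by ring. replace (RtoC 0 * w) with (RtoC 0) in H by ring.
  rewrite Cexp_0 in H.
  assert (E2 : RtoC 2 <> RtoC 0) by (intros E; apply RtoC_inj in E; lra).
  replace (Cexp w - RtoC 1 - w - w * w / RtoC 2) with
    (Cexp w + (- w * RtoC 1 + - / RtoC 2 * Cpow w 2) - (RtoC 1 + (- w * RtoC 0 + - / RtoC 2 * Cpow (RtoC 0) 2)))
    by (simpl Cpow; field; exact E2).
  eapply Rle_trans; [apply H|lra]. intros t Ht. split.
  - apply rder_plus; [apply rder_Cexp_line|]. apply rder_plus; apply rder_cmult; [apply rder_id|].
    apply (rder_pow 1).
  - replace (w * Cexp (RtoC t * w) + _) with (w * (Cexp (RtoC t * w) - RtoC 1 - RtoC t * w)).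
    2:{ simpl Cpow. simpl INR. rewrite RtoC_plus.
    replace (RtoC 1 + RtoC 1) with (RtoC 2) by (rewrite <- RtoC_plus; f_equal; ring). field. }
    assert (Hm : (Cmod (RtoC t * w) <= Cmod w)%R).
    { rewrite Cmod_mult, Cmod_R, Rabs_pos_eq by lra. pose proof (Cmod_ge_0 w). nra. }
    pose proof (Cexp_remainder_1 (RtoC t * w) ltac:(lra)) as B.
    rewrite Cmod_mult. pose proof (Cmod_ge_0 w). pose proof (Cmod_ge_0 (RtoC t * w)).
    assert (Cmod (RtoC t * w) ^ 2 <= Cmod w ^ 2)%R by (apply pow_incr; lra).
    apply Rle_trans with (Cmod w * (12 * Cmod w ^ 2))%R; [|right; ring].
    apply Rmult_le_compat_l; lra.
Qed.

Lemma cder_of_quadratic (f : C -> C) (z d : C) (K : R) : (0 < K)%R ->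
  (forall h, (Cmod h <= 1)%R -> (Cmod (f (z + h)%C - f z - d * h) <= K * Cmod h ^ 2)%R) -> cder f z d.
Proof.
  intros HK H. apply cder_eps. intros eps.
  assert (Hd : (0 < Rmin 1 (eps / K))%R)
    by (apply Rmin_pos; [lra|apply Rdiv_lt_0_compat; [apply cond_pos|lra]]).
  exists (mkposreal _ Hd). intros w Hw. simpl in Hw.
  pose proof (Rlt_le_trans _ _ _ Hw (Rmin_l _ _)) as H1.
  pose proof (Rlt_le_trans _ _ _ Hw (Rmin_r _ _)) as H2.
  specialize (H (w - z) ltac:(lra)). replace (z + (w - z)) with w in H by ring.
  eapply Rle_trans; [exact H|]. simpl. rewrite Rmult_1_r, <- Rmult_assoc.
  apply Rmult_le_compat_r; [apply Cmod_ge_0|].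
  apply (Rmult_lt_compat_l K) in H2; [|lra]. replace (K * (eps / K))%R with (pos eps) in H2 by (field; lra). lra.
Qed.

Lemma cder_Cexp z : cder Cexp z (Cexp z).
Proof.
  apply (cder_of_quadratic _ _ _ (12 * exp (fst z))).
  - pose proof (exp_pos (fst z)). lra.
  - intros h Hh. rewrite Cexp_plus.
    replace (Cexp z * Cexp h - Cexp z - Cexp z * h) with (Cexp z * (Cexp h - RtoC 1 - h)) by ring.
    rewrite Cmod_mult, Cmod_Cexp. pose proof (Cexp_remainder_1 h Hh). pose proof (exp_pos (fst z)). nra.
Qed.

Lemma entire_Cexp : entire Cexp.
Proof. intros z. eexists. apply cder_Cexp. Qed.

(** Filling the removable singularity is what later makes (x^a - 1)/a entire in a. *)
Definition expm1q (w : C) : C := if Ceq_dec w (RtoC 0) then RtoC 1 else (Cexp w - RtoC 1) / w.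

Lemma expm1q_0 : expm1q (RtoC 0) = RtoC 1.
Proof. unfold expm1q. now destruct (Ceq_dec (RtoC 0) (RtoC 0)). Qed.

Lemma expm1q_neq w : w <> RtoC 0 -> expm1q w = (Cexp w - RtoC 1) / w.
Proof. intros H. unfold expm1q. now destruct (Ceq_dec w (RtoC 0)). Qed.

Lemma expm1q_mult w : w * expm1q w = Cexp w - RtoC 1.
Proof.
  unfold expm1q. destruct (Ceq_dec w (RtoC 0)) as [->|H].
  - rewrite Cexp_0. ring.
  - now field.
Qed.

Lemma expm1q_bound w : (Cmod (expm1q w) <= 2 * exp (Rmax 0 (fst w)))%R.
Proof.
  destruct (Ceq_dec w (RtoC 0)) as [->|H].
  - rewrite expm1q_0, Cmod_1. simpl. rewrite Rmax_left, exp_0 by lra. lra.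
  - rewrite expm1q_neq by assumption. rewrite Cmod_div by assumption.
    pose proof (Cexp_minus_1_bound w). assert (0 < Cmod w)%R by now apply Cmod_gt_0.
    apply Rmult_le_reg_r with (Cmod w); [assumption|]. unfold Rdiv.
    rewrite Rmult_assoc, Rinv_l, Rmult_1_r by lra. lra.
Qed.

Lemma cder_inv z : z <> RtoC 0 -> exists d, cder Cinv z d.
Proof.
  intros Hz. exists (- / (z * z)). apply cder_eps. intros eps.
  assert (Hm : (0 < Cmod z)%R) by now apply Cmod_gt_0.
  assert (Hd : (0 < Rmin (Cmod z / 2) (eps * Cmod z ^ 3 / 2))%R).
  { apply Rmin_pos; [lra|]. pose proof (cond_pos eps). pose proof (pow_lt _ 3 Hm). nra. }
  exists (mkposreal _ Hd). intros w Hw. simpl in Hw.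
  pose proof (Rlt_le_trans _ _ _ Hw (Rmin_l _ _)) as H1.
  pose proof (Rlt_le_trans _ _ _ Hw (Rmin_r _ _)) as H2.
  assert (Hw2 : (Cmod z / 2 <= Cmod w)%R).
  { pose proof (Cmod_triangle w (z - w)) as T. replace (w + (z - w)) with z in T by ring.
    replace (z - w) with (- (w - z)) in T by ring. rewrite Cmod_opp in T. lra. }
  assert (Hw0 : w <> RtoC 0) by (intros ->; rewrite Cmod_0 in Hw2; lra).
  replace (/ w - / z - - / (z * z) * (w - z)) with ((w - z) * (w - z) / (z * z * w)) by (field; auto).
  rewrite Cmod_div by (repeat apply Cmult_neq_0; assumption). rewrite !Cmod_mult.
  set (a := Cmod (w - z)) in *. assert (0 <= a)%R by apply Cmod_ge_0.
  set (m := Cmod z) in *. set (n := Cmod w) in *.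
  assert (Hp : (0 < m * m * n)%R) by (repeat apply Rmult_lt_0_compat; lra).
  apply Rmult_le_reg_r with (m * m * n)%R; [exact Hp|]. unfold Rdiv at 1.
  rewrite Rmult_assoc, Rinv_l, Rmult_1_r by lra.
  assert (Hmn : (m * m * (m / 2) <= m * m * n)%R) by (apply Rmult_le_compat_l; [nra|exact Hw2]).
  assert (Ha : (a <= eps * (m * m * n))%R).
  { apply Rle_trans with (eps * (m * m * (m / 2)))%R; [left; eapply Rlt_le_trans; [exact H2|right; simpl; field]|].
    apply Rmult_le_compat_l; [left; apply cond_pos|exact Hmn]. }
  rewrite Rmult_assoc, (Rmult_comm a (m * m * n)), <- Rmult_assoc.
  apply Rmult_le_compat_r; assumption.
Qed.

Lemma entire_expm1q : entire expm1q.
Proof.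
  intros z. destruct (Ceq_dec z (RtoC 0)) as [->|Hz].
  - exists (/ RtoC 2). apply (cder_of_quadratic _ _ _ 24); [lra|]. intros h Hh.
    replace (RtoC 0 + h) with h by ring. rewrite expm1q_0.
    assert (E2 : RtoC 2 <> RtoC 0) by (intros E; apply RtoC_inj in E; lra).
    destruct (Ceq_dec h (RtoC 0)) as [->|H0].
    + rewrite expm1q_0. replace (RtoC 1 - RtoC 1 - / RtoC 2 * RtoC 0) with (RtoC 0) by ring.
      rewrite Cmod_0. lra.
    + rewrite expm1q_neq by assumption.
      replace ((Cexp h - RtoC 1) / h - RtoC 1 - / RtoC 2 * h) with
        ((Cexp h - RtoC 1 - h - h * h / RtoC 2) / h) by (field; auto).
      rewrite Cmod_div by assumption. pose proof (Cexp_remainder_2 h Hh).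
      assert (0 < Cmod h)%R by now apply Cmod_gt_0.
      apply Rmult_le_reg_r with (Cmod h); [assumption|]. unfold Rdiv at 1.
      rewrite Rmult_assoc, Rinv_l, Rmult_1_r by lra. simpl in *. lra.
  - destruct (cder_inv z Hz) as [d Hd].
    destruct (entire_minus Cexp (fun _ => RtoC 1) entire_Cexp (entire_const _) z) as [d1 Hd1].
    pose proof (cder_mult _ _ _ _ _ Hd1 Hd) as Hc.
    eexists. apply cder_eps. intros eps. destruct (proj1 (cder_eps _ _ _) Hc eps) as [delta H].
    assert (Hm : (0 < Cmod z)%R) by now apply Cmod_gt_0.
    assert (Hd' : (0 < Rmin delta (Cmod z))%R) by (apply Rmin_pos; [apply cond_pos|assumption]).
    exists (mkposreal _ Hd'). intros w Hw. simpl in Hw.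
    pose proof (Rlt_le_trans _ _ _ Hw (Rmin_l _ _)) as H1.
    pose proof (Rlt_le_trans _ _ _ Hw (Rmin_r _ _)) as H2.
    assert (Hw0 : w <> RtoC 0).
    { intros ->. replace (RtoC 0 - z) with (- z) in H2 by ring. rewrite Cmod_opp in H2. lra. }
    rewrite !expm1q_neq by assumption. now apply H.
Qed.

(** * Goursat's theorem *)

Lemma entire_continuous (f : C -> C) : entire f -> forall z (eps : R), (0 < eps)%R ->
  exists delta : R, (0 < delta)%R /\ forall w, (Cmod (w - z) < delta)%R -> (Cmod (f w - f z) < eps)%R.
Proof.
  intros Hf z eps He. destruct (Hf z) as [d Hd].
  destruct (proj1 (cder_eps _ _ _) Hd (mkposreal 1 Rlt_0_1)) as [d1 H1]. simpl in H1.
  set (M := (Cmod d + 1)%R). assert (HM : (0 < M)%R) by (unfold M; pose proof (Cmod_ge_0 d); lra).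
  exists (Rmin d1 (eps / M)). split.
  - apply Rmin_pos; [apply cond_pos|now apply Rdiv_lt_0_compat].
  - intros w Hw. pose proof (Rlt_le_trans _ _ _ Hw (Rmin_l _ _)) as Hw1.
    pose proof (Rlt_le_trans _ _ _ Hw (Rmin_r _ _)) as Hw2. specialize (H1 w Hw1).
    replace (f w - f z) with ((f w - f z - d * (w - z)) + d * (w - z)) by ring.
    eapply Rle_lt_trans; [apply Cmod_triangle|]. rewrite (Cmod_mult d).
    apply (Rmult_lt_compat_l M) in Hw2; [|lra]. replace (M * (eps / M))%R with eps in Hw2 by (field; lra).
    unfold M in Hw2. lra.
Qed.

Lemma continuous_along (f : C -> C) (g : R -> C) (t : R) :
  entire f -> (forall eps : R, (0 < eps)%R -> exists delta, (0 < delta)%R /\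
     forall u : R, (Rabs (u - t) < delta)%R -> (Cmod (g u - g t) < eps)%R) ->
  continuous (U := C_R_NormedModule) (fun u => f (g u)) t.
Proof.
  intros Hf Hg. apply filterlim_locally_ball_norm. intros eps.
  destruct (entire_continuous f Hf (g t) eps (cond_pos eps)) as [d1 [Hd1 H1]].
  destruct (Hg d1 Hd1) as [d2 [Hd2 H2]].
  exists (mkposreal _ Hd2). intros u Hu. unfold ball_norm. rewrite C_R_norm.
  apply H1, H2. exact Hu.
Qed.

Lemma continuous_horizontal f (y x : R) : entire f -> continuous (U := C_R_NormedModule) (fun u : R => f (u, y)) x.
Proof.
  intros Hf. apply (continuous_along f (fun u => (u, y))); [exact Hf|].
  intros eps He. exists eps. split; [exact He|]. intros u Hu. cbv beta.
  replace ((u, y) - (x, y)) with (RtoC (u - x)) by (apply injective_projections; simpl; ring).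
  now rewrite Cmod_R.
Qed.

Lemma continuous_vertical f (x y : R) : entire f -> continuous (U := C_R_NormedModule) (fun v : R => f (x, v)) y.
Proof.
  intros Hf. apply (continuous_along f (fun v => (x, v))); [exact Hf|].
  intros eps He. exists eps. split; [exact He|]. intros u Hu. cbv beta.
  replace ((x, u) - (x, y)) with (Ci * RtoC (u - y)) by (apply injective_projections; simpl; ring).
  now rewrite Cmod_mult, Cmod_Ci, Cmod_R, Rmult_1_l.
Qed.

Definition CRInt (f : R -> C) (a b : R) : C := RInt (V := C_R_CompleteNormedModule) f a b.

Definition h_int (f : C -> C) (y a b : R) : C := CRInt (fun x => f (x, y)) a b.
Definition v_int (f : C -> C) (x c d : R) : C := CRInt (fun y => f (x, y)) c d.

Definition boundary_int (f : C -> C) (a b c d : R) : C :=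
  h_int f c a b + Ci * v_int f b c d - h_int f d a b - Ci * v_int f a c d.

Lemma ex_h_int f y a b : entire f -> ex_RInt (V := C_R_CompleteNormedModule) (fun x => f (x, y)) a b.
Proof. intros Hf. apply ex_RInt_continuous. intros. now apply continuous_horizontal. Qed.

Lemma ex_v_int f x a b : entire f -> ex_RInt (V := C_R_CompleteNormedModule) (fun y => f (x, y)) a b.
Proof. intros Hf. apply ex_RInt_continuous. intros. now apply continuous_vertical. Qed.

Lemma CRInt_Chasles (f : R -> C) a b c :
  ex_RInt (V := C_R_CompleteNormedModule) f a b -> ex_RInt (V := C_R_CompleteNormedModule) f b c ->
  CRInt f a b + CRInt f b c = CRInt f a c.
Proof. exact (RInt_Chasles (V := C_R_CompleteNormedModule) f a b c). Qed.

Lemma h_int_Chasles f y a b c : entire f -> h_int f y a b + h_int f y b c = h_int f y a c.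
Proof. intros Hf. apply CRInt_Chasles; now apply ex_h_int. Qed.

Lemma v_int_Chasles f x a b c : entire f -> v_int f x a b + v_int f x b c = v_int f x a c.
Proof. intros Hf. apply CRInt_Chasles; now apply ex_v_int. Qed.

Lemma boundary_int_split_h f a m b c d : entire f ->
  boundary_int f a b c d = boundary_int f a m c d + boundary_int f m b c d.
Proof.
  intros Hf. unfold boundary_int.
  rewrite <- (h_int_Chasles f c a m b Hf), <- (h_int_Chasles f d a m b Hf). ring.
Qed.

Lemma boundary_int_split_v f a b c m d : entire f ->
  boundary_int f a b c d = boundary_int f a b c m + boundary_int f a b m d.
Proof.
  intros Hf. unfold boundary_int.
  rewrite <- (v_int_Chasles f a c m d Hf), <- (v_int_Chasles f b c m d Hf). ring.
Qed.

Lemma CRInt_minus (f g : R -> C) a b :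
  ex_RInt (V := C_R_CompleteNormedModule) f a b -> ex_RInt (V := C_R_CompleteNormedModule) g a b ->
  CRInt (fun x => f x - g x) a b = CRInt f a b - CRInt g a b.
Proof. exact (RInt_minus (V := C_R_CompleteNormedModule) f g a b). Qed.

Lemma boundary_int_minus f g a b c d : entire f -> entire g ->
  boundary_int (fun z => f z - g z) a b c d = boundary_int f a b c d - boundary_int g a b c d.
Proof.
  intros Hf Hg. unfold boundary_int, h_int, v_int.
  rewrite (CRInt_minus (fun x => f (x, c)) (fun x => g (x, c)) a b (ex_h_int f c a b Hf) (ex_h_int g c a b Hg)).
  rewrite (CRInt_minus (fun x => f (x, d)) (fun x => g (x, d)) a b (ex_h_int f d a b Hf) (ex_h_int g d a b Hg)).
  rewrite (CRInt_minus (fun y => f (a, y)) (fun y => g (a, y)) c d (ex_v_int f a c d Hf) (ex_v_int g a c d Hg)).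
  rewrite (CRInt_minus (fun y => f (b, y)) (fun y => g (b, y)) c d (ex_v_int f b c d Hf) (ex_v_int g b c d Hg)).
  ring.
Qed.

Lemma CRInt_bound (f : R -> C) a b M : (a <= b)%R ->
  ex_RInt (V := C_R_CompleteNormedModule) f a b ->
  (forall x, (a <= x <= b)%R -> (Cmod (f x) <= M)%R) -> (Cmod (CRInt f a b) <= (b - a) * M)%R.
Proof.
  intros Hab Hf HM. rewrite <- C_R_norm.
  apply (norm_RInt_le_const (V := C_R_NormedModule) f a b); [exact Hab| |].
  - intros x Hx. rewrite C_R_norm. now apply HM.
  - exact (RInt_correct (V := C_R_CompleteNormedModule) f a b Hf).
Qed.

Lemma boundary_int_bound f a b c d M : (a <= b)%R -> (c <= d)%R -> entire f ->
  (forall x y, (a <= x <= b)%R -> (c <= y <= d)%R -> (Cmod (f (x, y)) <= M)%R) ->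
  (Cmod (boundary_int f a b c d) <= 2 * M * ((b - a) + (d - c)))%R.
Proof.
  intros Hab Hcd Hf HM. unfold boundary_int.
  assert (H1 : (Cmod (h_int f c a b) <= (b - a) * M)%R)
    by (apply CRInt_bound; [assumption|now apply ex_h_int|intros; apply HM; lra]).
  assert (H2 : (Cmod (h_int f d a b) <= (b - a) * M)%R)
    by (apply CRInt_bound; [assumption|now apply ex_h_int|intros; apply HM; lra]).
  assert (H3 : (Cmod (v_int f a c d) <= (d - c) * M)%R)
    by (apply CRInt_bound; [assumption|now apply ex_v_int|intros; apply HM; lra]).
  assert (H4 : (Cmod (v_int f b c d) <= (d - c) * M)%R)
    by (apply CRInt_bound; [assumption|now apply ex_v_int|intros; apply HM; lra]).
  eapply Rle_trans; [apply Cmod_triangle|]. rewrite Cmod_opp.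
  eapply Rle_trans; [apply Rplus_le_compat_r, Cmod_triangle|]. rewrite Cmod_opp.
  eapply Rle_trans; [apply Rplus_le_compat_r, Rplus_le_compat_r, Cmod_triangle|].
  rewrite !Cmod_mult, Cmod_Ci. lra.
Qed.

Lemma h_int_primitive P p y a b : (forall z, cder P z (p z)) -> entire p ->
  h_int p y a b = P (b, y) - P (a, y).
Proof.
  intros HP Hp.
  apply (is_RInt_unique (V := C_R_CompleteNormedModule) (fun x => p (x, y)) a b (P (b, y) - P (a, y))).
  apply (is_RInt_derive (V := C_R_CompleteNormedModule) (fun x => P (x, y)) (fun x => p (x, y))).
  - intros x _. pose proof (rder_comp P (fun u => (u, y)) x (p (x, y)) (RtoC 1) (HP _)) as H.
    rewrite Cmult_1_r in H. apply H.
    exact (rder_pair (fun s => s) (fun _ => y) x 1 0 (is_derive_id x) (is_derive_const y x)).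
  - intros x _. now apply continuous_horizontal.
Qed.

Lemma v_int_primitive P p x c d : (forall z, cder P z (p z)) -> entire p ->
  Ci * v_int p x c d = P (x, d) - P (x, c).
Proof.
  intros HP Hp.
  assert (E : v_int p x c d = - Ci * P (x, d) - - Ci * P (x, c)).
  2:{ rewrite E. transitivity (- (Ci * Ci) * (P (x, d) - P (x, c))); [ring|].
      replace (Ci * Ci) with (- RtoC 1) by (apply injective_projections; simpl; ring). ring. }
  apply (is_RInt_unique (V := C_R_CompleteNormedModule) (fun y => p (x, y)) c d (- Ci * P (x, d) - - Ci * P (x, c))).
  apply (is_RInt_derive (V := C_R_CompleteNormedModule) (fun y => - Ci * P (x, y)) (fun y => p (x, y))).
  - intros y _. pose proof (rder_comp P (fun u => (x, u)) y (p (x, y)) Ci (HP _)) as H.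
    replace (p (x, y)) with (- Ci * (p (x, y) * Ci)).
    2:{ transitivity (- (Ci * Ci) * p (x, y)); [ring|].
        replace (Ci * Ci) with (- RtoC 1) by (apply injective_projections; simpl; ring). ring. }
    apply (rder_cmult (- Ci) (fun y => P (x, y))). apply H.
    exact (rder_pair (fun _ => x) (fun s => s) y 0 1 (is_derive_const x y) (is_derive_id y)).
  - intros y _. now apply continuous_vertical.
Qed.

Lemma boundary_int_primitive P p a b c d : (forall z, cder P z (p z)) -> entire p ->
  boundary_int p a b c d = RtoC 0.
Proof.
  intros HP Hp. unfold boundary_int.
  rewrite !(h_int_primitive P), !(v_int_primitive P) by assumption. ring.
Qed.

Lemma boundary_int_affine (u v : C) z0 a b c d :
  boundary_int (fun z => u + v * (z - z0)) a b c d = RtoC 0.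
Proof.
  assert (E2 : RtoC 2 <> RtoC 0) by (intros E; apply RtoC_inj in E; lra).
  apply (boundary_int_primitive (fun z => u * z + v / RtoC 2 * Cpow (z + - z0) 2)).
  - intros z. replace (u + v * (z - z0)) with
      (u * RtoC 1 + v / RtoC 2 * (RtoC 1 * (RtoC (INR 2) * Cpow (z + - z0) 1))).
    2:{ simpl Cpow. simpl INR. rewrite RtoC_plus.
        replace (RtoC 1 + RtoC 1) with (RtoC 2) by (rewrite <- RtoC_plus; f_equal; ring). field. }
    apply cder_plus; apply cder_cmult; [apply cder_id|].
    apply (cder_comp (fun w => Cpow w 2) (fun z => z + - z0)); [apply cder_pow|].
    replace (RtoC 1) with (RtoC 1 + RtoC 0) by ring. apply cder_plus; [apply cder_id|apply cder_const].
  - entire_tac.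
Qed.

Section Goursat.
Context (f : C -> C) (Hf : entire f) (a b c d : R) (Hab : (a <= b)%R) (Hcd : (c <= d)%R).

Record rect := mkrect { xl : R; xr : R; yl : R; yr : R }.
Definition rint (q : rect) : R := Cmod (boundary_int f (xl q) (xr q) (yl q) (yr q)).

Definition quarters (q : rect) : list rect :=
  let xm := ((xl q + xr q) / 2)%R in let ym := ((yl q + yr q) / 2)%R in
  [mkrect (xl q) xm (yl q) ym; mkrect xm (xr q) (yl q) ym;
   mkrect (xl q) xm ym (yr q); mkrect xm (xr q) ym (yr q)].

Lemma quarter_exists q : exists q', In q' (quarters q) /\ (rint q <= 4 * rint q')%R.
Proof.
  destruct q as [x1 x2 y1 y2]. unfold quarters; simpl.
  set (xm := ((x1 + x2) / 2)%R). set (ym := ((y1 + y2) / 2)%R).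
  set (q1 := mkrect x1 xm y1 ym). set (q2 := mkrect xm x2 y1 ym).
  set (q3 := mkrect x1 xm ym y2). set (q4 := mkrect xm x2 ym y2).
  assert (B : (rint (mkrect x1 x2 y1 y2) <= rint q1 + rint q2 + rint q3 + rint q4)%R).
  { unfold rint; simpl. rewrite (boundary_int_split_v f x1 x2 y1 ym y2 Hf).
    rewrite (boundary_int_split_h f x1 xm x2 y1 ym Hf), (boundary_int_split_h f x1 xm x2 ym y2 Hf).
    eapply Rle_trans; [apply Cmod_triangle|].
    eapply Rle_trans; [apply Rplus_le_compat; apply Cmod_triangle|]. lra. }
  destruct (Rle_dec (rint (mkrect x1 x2 y1 y2)) (4 * rint q1)) as [H1|H1]; [exists q1; tauto|].
  destruct (Rle_dec (rint (mkrect x1 x2 y1 y2)) (4 * rint q2)) as [H2|H2]; [exists q2; tauto|].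
  destruct (Rle_dec (rint (mkrect x1 x2 y1 y2)) (4 * rint q3)) as [H3|H3]; [exists q3; tauto|].
  exists q4. split; [tauto|]. lra.
Qed.

(** Comparison of reals is decided, so the bisection is an explicit function; the default branch is
    ruled out by [quarter_exists]. *)
Definition next (q : rect) : rect :=
  match find (fun q' => if Rle_dec (rint q) (4 * rint q') then true else false) (quarters q) with
  | Some q' => q'
  | None => q
  end.

Lemma next_spec q : In (next q) (quarters q) /\ (rint q <= 4 * rint (next q))%R.
Proof.
  unfold next. destruct (find _ _) as [q'|] eqn:E.
  - apply find_some in E. destruct E as [E1 E2]. split; [exact E1|].
    now destruct (Rle_dec (rint q) (4 * rint q')).
  - exfalso. destruct (quarter_exists q) as [q' [H1 H2]].
    pose proof (find_none _ _ E q' H1) as H. simpl in H. now destruct (Rle_dec (rint q) (4 * rint q')).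
Qed.

Fixpoint nested (n : nat) : rect :=
  match n with O => mkrect a b c d | S n => next (nested n) end.

Lemma nested_width n :
  (xr (nested n) - xl (nested n) = (b - a) / 2 ^ n /\ yr (nested n) - yl (nested n) = (d - c) / 2 ^ n)%R.
Proof.
  induction n as [|n [IH1 IH2]]; simpl; [split; field|].
  assert (H2 : (2 ^ n <> 0)%R) by (apply pow_nonzero; lra).
  replace ((b - a) / (2 * 2 ^ n))%R with ((b - a) / 2 ^ n / 2)%R by (field; exact H2).
  replace ((d - c) / (2 * 2 ^ n))%R with ((d - c) / 2 ^ n / 2)%R by (field; exact H2).
  rewrite <- IH1, <- IH2. destruct (next_spec (nested n)) as [H _].
  repeat destruct H as [<-|H]; try destruct H; simpl; split; lra.
Qed.

Lemma nested_ordered n : (xl (nested n) <= xr (nested n) /\ yl (nested n) <= yr (nested n))%R.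
Proof.
  destruct (nested_width n) as [H1 H2]. assert (0 < 2 ^ n)%R by (apply pow_lt; lra).
  assert (0 <= (b - a) / 2 ^ n)%R by (apply Rdiv_le_0_compat; lra).
  assert (0 <= (d - c) / 2 ^ n)%R by (apply Rdiv_le_0_compat; lra). lra.
Qed.

Lemma nested_monotone n :
  (xl (nested n) <= xl (nested (S n)) /\ xr (nested (S n)) <= xr (nested n) /\
   yl (nested n) <= yl (nested (S n)) /\ yr (nested (S n)) <= yr (nested n))%R.
Proof.
  destruct (nested_ordered n) as [H1 H2]. destruct (next_spec (nested n)) as [H _].
  change (nested (S n)) with (next (nested n)).
  repeat destruct H as [<-|H]; try destruct H; simpl; lra.
Qed.

Lemma nested_rint n : (rint (nested 0) <= 4 ^ n * rint (nested n))%R.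
Proof.
  induction n as [|n IH]; [simpl; lra|]. destruct (next_spec (nested n)) as [_ H].
  change (nested (S n)) with (next (nested n)). simpl pow.
  assert (0 < 4 ^ n)%R by (apply pow_lt; lra). nra.
Qed.

Lemma common_point (l r : nat -> R) : (forall n, (l n <= r n)%R) ->
  (forall n, (l n <= l (S n))%R) -> (forall n, (r (S n) <= r n)%R) -> exists x, forall n, (l n <= x <= r n)%R.
Proof.
  intros H Hl Hr.
  assert (Hl' : forall n k, (l n <= l (n + k)%nat)%R).
  { intros n k. induction k as [|k IH]; [rewrite Nat.add_0_r; lra|]. rewrite Nat.add_succ_r.
    eapply Rle_trans; eauto. }
  assert (Hr' : forall n k, (r (n + k)%nat <= r n)%R).
  { intros n k. induction k as [|k IH]; [rewrite Nat.add_0_r; lra|]. rewrite Nat.add_succ_r.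
    eapply Rle_trans; eauto. }
  assert (HB : forall n m, (l n <= r m)%R).
  { intros n m. eapply Rle_trans; [apply (Hl' n m)|]. eapply Rle_trans; [apply H|].
    rewrite Nat.add_comm. apply Hr'. }
  destruct (completeness (fun x => exists n, x = l n)) as [x [Hx1 Hx2]].
  - exists (r 0%nat). intros y [n ->]. apply HB.
  - exists (l 0%nat). now exists 0%nat.
  - exists x. intros n. split; [apply Hx1; now exists n|]. apply Hx2. intros y [m ->]. apply HB.
Qed.

Lemma goursat : boundary_int f a b c d = RtoC 0.
Proof.
  destruct (common_point (fun n => xl (nested n)) (fun n => xr (nested n))) as [x0 Hx0];
    [intro n; apply nested_ordered|intro n; apply nested_monotone|intro n; apply nested_monotone|].
  destruct (common_point (fun n => yl (nested n)) (fun n => yr (nested n))) as [y0 Hy0];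
    [intro n; apply nested_ordered|intro n; apply nested_monotone|intro n; apply nested_monotone|].
  set (z0 := (x0, y0) : C). destruct (Hf z0) as [df Hdf].
  set (w := ((b - a) + (d - c))%R). assert (Hw : (0 <= w)%R) by (unfold w; lra).
  assert (Hmain : forall eps : posreal, (rint (nested 0) <= 2 * eps * w ^ 2)%R).
  { intros eps. destruct (proj1 (cder_eps _ _ _) Hdf eps) as [delta Hd].
    assert (Hn : exists n, (w / 2 ^ n < delta)%R).
    { destruct (pow_lt_1_zero (/ 2) ltac:(rewrite Rabs_pos_eq; lra) (delta / (w + 1))) as [n Hn].
      - apply Rdiv_lt_0_compat; [apply cond_pos|lra].
      - exists n. specialize (Hn n (Nat.le_refl n)). rewrite Rabs_pos_eq in Hn by (apply pow_le; lra).
        rewrite pow_inv in Hn. unfold Rdiv.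
        apply Rle_lt_trans with ((w + 1) * / 2 ^ n)%R.
        + apply Rmult_le_compat_r; [|lra]. left. apply Rinv_0_lt_compat, pow_lt. lra.
        + apply (Rmult_lt_compat_l (w + 1)) in Hn; [|lra].
          replace ((w + 1) * (delta / (w + 1)))%R with (pos delta) in Hn by (field; lra). exact Hn. }
    destruct Hn as [n Hn]. destruct (nested_width n) as [W1 W2]. destruct (nested_ordered n) as [O1 O2].
    assert (P2 : (0 < 2 ^ n)%R) by (apply pow_lt; lra).
    assert (EW : (xr (nested n) - xl (nested n) + (yr (nested n) - yl (nested n)) = w / 2 ^ n)%R)
      by (rewrite W1, W2; unfold w; field; lra).
    (* Subtracting the tangent map leaves the boundary integral unchanged and makes the integrand at
       most eps times the side sum w / 2^n. The square of this quantity cancels the factor 4^n lost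
       by bisecting. *)
    set (g := fun z => f z - (f z0 + df * (z - z0))).
    assert (Hg : entire g) by (unfold g; entire_tac).
    assert (E : boundary_int f (xl (nested n)) (xr (nested n)) (yl (nested n)) (yr (nested n)) =
                boundary_int g (xl (nested n)) (xr (nested n)) (yl (nested n)) (yr (nested n))).
    { unfold g. rewrite boundary_int_minus; [|exact Hf|].
      - rewrite boundary_int_affine. ring.
      - entire_tac. }
    assert (B : (rint (nested n) <= 2 * (eps * (w / 2 ^ n)) * (w / 2 ^ n))%R).
    { unfold rint. rewrite E, <- EW at 1. rewrite <- EW.
      apply boundary_int_bound; [exact O1|exact O2|exact Hg|].
      intros x y Hx Hy. specialize (Hx0 n). specialize (Hy0 n). simpl in Hx0, Hy0.
      assert (Hdist : (Cmod ((x, y) - z0) <= w / 2 ^ n)%R).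
      { eapply Rle_trans; [apply Cmod_le_abs|]. simpl. rewrite <- EW.
        apply Rplus_le_compat; apply Rabs_le; lra. }
      assert (Hlt : (Cmod ((x, y) - z0) < delta)%R) by lra. specialize (Hd _ Hlt). unfold g.
      replace (f (x, y) - (f z0 + df * ((x, y) - z0))) with (f (x, y) - f z0 - df * ((x, y) - z0)) by ring.
      eapply Rle_trans; [exact Hd|]. apply Rmult_le_compat_l; [left; apply cond_pos|]. rewrite EW. exact Hdist. }
    eapply Rle_trans; [apply (nested_rint n)|].
    apply (Rmult_le_compat_l (4 ^ n)) in B; [|apply pow_le; lra]. eapply Rle_trans; [exact B|].
    right. replace 4%R with (2 * 2)%R by ring. rewrite Rpow_mult_distr. field. lra. }
  apply Cmod_eq_0. change (rint (nested 0) = 0%R).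
  assert (H0 : (0 <= rint (nested 0))%R) by apply Cmod_ge_0.
  destruct (Rle_lt_or_eq_dec _ _ H0) as [Hpos|]; [|auto]. exfalso.
  set (v := rint (nested 0)) in *. assert (He : (0 < v / (4 * (w ^ 2 + 1)))%R).
  { apply Rdiv_lt_0_compat; [exact Hpos|]. pose proof (pow2_ge_0 w). lra. }
  pose proof (Hmain (mkposreal _ He)) as H. cbn [pos] in H.
  pose proof (pow2_ge_0 w) as Hw2.
  assert (E : (2 * (v / (4 * (w ^ 2 + 1))) * w ^ 2 = v * (w ^ 2 / (w ^ 2 + 1)) / 2)%R) by (field; lra).
  rewrite E in H.
  assert (w ^ 2 / (w ^ 2 + 1) <= 1)%R by (apply Rle_div_l; lra). nra.
Qed.
End Goursat.

(** * A uniqueness principle *)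

Lemma CRInt_const (c : C) a b : CRInt (fun _ => c) a b = RtoC (b - a) * c.
Proof.
  unfold CRInt. rewrite (RInt_const (V := C_R_CompleteNormedModule)).
  destruct c as [x y]. apply injective_projections; simpl; unfold scal; simpl; unfold mult; simpl; ring.
Qed.

Lemma CRInt_ext (f g : R -> C) a b :
  (forall x, f x = g x) -> CRInt f a b = CRInt g a b.
Proof.
  intros H. apply (RInt_ext (V := C_R_CompleteNormedModule)). intros; apply H.
Qed.

(* In the coordinate xi = log z circles become vertical segments, and the horizontal
   sides of the rectangle cancel because exp is 2 pi i-periodic. *)
Lemma circle_mean_invariant g u v : entire g -> (u <= v)%R ->
  v_int (fun xi => g (Cexp xi)) v 0 (2 * PI) = v_int (fun xi => g (Cexp xi)) u 0 (2 * PI).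
Proof.
  intros Hg Huv. pose proof PI_RGT_0.
  pose proof (goursat (fun xi => g (Cexp xi)) (entire_comp _ _ Hg entire_Cexp) u v 0 (2 * PI) Huv ltac:(lra)) as G.
  unfold boundary_int in G.
  assert (E : h_int (fun xi => g (Cexp xi)) (2 * PI) u v = h_int (fun xi => g (Cexp xi)) 0 u v).
  { apply CRInt_ext. intros x. f_equal. unfold Cexp; simpl. now rewrite cos_2PI, sin_2PI, cos_0, sin_0. }
  rewrite E in G. set (V1 := v_int _ v _ _) in *. set (V2 := v_int _ u _ _) in *.
  assert (G' : Ci * (V1 - V2) = RtoC 0) by (rewrite <- G; ring).
  apply (f_equal (fun z => - Ci * z)) in G'.
  assert (EI : - Ci * Ci = RtoC 1) by (apply injective_projections; simpl; ring).
  rewrite Cmult_assoc, EI in G'. replace V1 with (RtoC 1 * (V1 - V2) + V2) by ring. rewrite G'. ring.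
Qed.

Lemma circle_mean g v : entire g ->
  v_int (fun xi => g (Cexp xi)) v 0 (2 * PI) = RtoC (2 * PI) * g (RtoC 0).
Proof.
  intros Hg. pose proof PI_RGT_0 as Hpi. set (K := fun xi => g (Cexp xi)).
  assert (HK : entire K) by (exact (entire_comp _ _ Hg entire_Cexp)).
  set (D := v_int K v 0 (2 * PI) - RtoC (2 * PI) * g (RtoC 0)).
  assert (B : forall eps : R, (0 < eps)%R -> (Cmod D <= 2 * PI * eps)%R).
  { intros eps He. destruct (entire_continuous g Hg (RtoC 0) eps He) as [delta [Hd H]].
    (* A segment this far to the left is a circle of radius at most delta / 2, on which g is within
       eps of its value at 0. *)
    set (u := Rmin v (ln (delta / 2))).
    unfold D, K. rewrite (circle_mean_invariant g u v Hg (Rmin_l _ _)). fold K.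
    assert (E : v_int K u 0 (2 * PI) - RtoC (2 * PI) * g (RtoC 0) =
                CRInt (fun y => K (u, y) - g (RtoC 0)) 0 (2 * PI)).
    { rewrite CRInt_minus, CRInt_const; [now rewrite Rminus_0_r|now apply ex_v_int|].
      apply (ex_RInt_const (V := C_R_NormedModule)). }
    rewrite E. eapply Rle_trans; [apply (CRInt_bound _ 0 (2 * PI) eps); [lra| |]|right; ring].
    - apply (ex_v_int (fun z => K z - g (RtoC 0)) u). entire_tac.
    - intros y _. left. apply H. replace (Cexp (u, y) - RtoC 0) with (Cexp (u, y)) by ring.
      rewrite Cmod_Cexp. simpl. apply Rle_lt_trans with (delta / 2)%R; [|lra].
      rewrite <- (exp_ln (delta / 2)) by lra. destruct (Rmin_r v (ln (delta / 2))) as [H1|H1].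
      + left. now apply exp_increasing.
      + right. unfold u. now rewrite H1. }
  assert (HD : D = RtoC 0).
  { apply Cmod_eq_0. destruct (Rle_lt_or_eq_dec 0 (Cmod D) (Cmod_ge_0 D)) as [Hp|Hp]; [|now auto].
    exfalso. assert (He : (0 < Cmod D / (4 * PI))%R) by (apply Rdiv_lt_0_compat; lra).
    specialize (B _ He). replace (2 * PI * (Cmod D / (4 * PI)))%R with (Cmod D / 2)%R in B by (field; lra). lra. }
  unfold D in HD. replace (v_int K v 0 (2 * PI)) with ((v_int K v 0 (2 * PI) - RtoC (2 * PI) * g (RtoC 0)) + RtoC (2
    * PI) * g (RtoC 0)) by ring.
  rewrite HD. ring.
Qed.

Definition on_circle (r : R) (z : C) : Prop := exists y, (0 <= y <= 2 * PI)%R /\ z = Cexp (ln r, y).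

Lemma on_circle_Cmod r z : (0 < r)%R -> on_circle r z -> Cmod z = r.
Proof. intros Hr [y [_ ->]]. rewrite Cmod_Cexp. simpl. now apply exp_ln. Qed.

Lemma center_bound g r B : (0 < r)%R -> entire g ->
  (forall z, on_circle r z -> (Cmod (g z) <= B)%R) -> (Cmod (g (RtoC 0)) <= B)%R.
Proof.
  intros Hr Hg HB. pose proof PI_RGT_0 as Hpi.
  pose proof (circle_mean g (ln r) Hg) as E. apply (f_equal Cmod) in E.
  rewrite Cmod_mult, Cmod_R, Rabs_pos_eq in E by lra.
  assert (Cmod (v_int (fun xi => g (Cexp xi)) (ln r) 0 (2 * PI)) <= (2 * PI - 0) * B)%R.
  { apply CRInt_bound; [lra| |].
    - apply (ex_v_int (fun xi => g (Cexp xi))). exact (entire_comp _ _ Hg entire_Cexp).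
    - intros y Hy. apply HB. now exists y. }
  rewrite E in H. nra.
Qed.

(* The weight exp (n (z/r + z^2/(2 r^2))) has modulus at most exp (- n/18) on the part
   Re z <= r/3 of the circle |z| = r, and value 1 at the centre. *)
Lemma arc_uniqueness (f : nat -> C -> C) (r M : R) : (0 < r)%R ->
  (forall N, entire (f N)) ->
  (forall N z, on_circle r z -> (Cmod (f N z) <= M)%R) ->
  (forall eps, (0 < eps)%R -> exists N0, forall N, (N0 <= N)%nat ->
     forall z, on_circle r z -> (r / 3 <= fst z)%R -> (Cmod (f N z) <= eps)%R) ->
  forall eps, (0 < eps)%R -> exists N0, forall N, (N0 <= N)%nat -> (Cmod (f N (RtoC 0)) <= eps)%R.
Proof.
  intros Hr Hf HM Harc eps He.
  assert (HM0 : (0 <= M)%R).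
  { eapply Rle_trans; [apply Cmod_ge_0|]. apply (HM 0%nat (Cexp (ln r, 0%R))).
    exists 0%R. pose proof PI_RGT_0. split; [lra|reflexivity]. }
  (* With this n the bound M exp (- n/18) off the arc is M exp (- M/eps), which is at most eps
     because exp y >= 1 + y. *)
  set (n := (18 * (M / eps))%R). assert (Hn : (0 <= n)%R).
  { unfold n. assert (0 <= M / eps)%R by (apply Rdiv_le_0_compat; lra). lra. }
  (* With t = Re z / r the weight has modulus exp (n (t + t^2 - 1/2)), at most exp (3n/2) on the
     circle; this factor undoes its growth on the arc. *)
  set (eps' := (eps * exp (- (3 / 2 * n)))%R).
  assert (He' : (0 < eps')%R) by (apply Rmult_lt_0_compat; [assumption|apply exp_pos]).
  destruct (Harc eps' He') as [N0 HN0]. exists N0. intros N HN.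
  set (q := fun z => RtoC (n / r) * z + RtoC (n / (2 * r * r)) * (z * z)).
  set (g := fun z => f N z * Cexp (q z)).
  assert (Eg0 : g (RtoC 0) = f N (RtoC 0)).
  { unfold g, q. replace (_ + _) with (RtoC 0) by ring. rewrite Cexp_0. ring. }
  rewrite <- Eg0. apply (center_bound g r); [exact Hr| |].
  - apply entire_mult; [apply Hf|]. apply (entire_comp Cexp q); [apply entire_Cexp|]. unfold q. entire_tac.
  - intros z Hc0. pose proof (on_circle_Cmod r z Hr Hc0) as Hz. unfold g. rewrite Cmod_mult, Cmod_Cexp.
    assert (Hsq : (fst z * fst z + snd z * snd z = r * r)%R).
    { rewrite <- Hz. unfold Cmod. rewrite sqrt_sqrt; [simpl; ring|]. simpl. nra. }
    assert (Hx : (- r <= fst z <= r)%R) by nra.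
    set (t := (fst z / r)%R). assert (Ht : (-1 <= t <= 1)%R).
    { unfold t. split; [apply Rle_div_r|apply Rle_div_l]; lra. }
    assert (Eq : fst (q z) = (n * (t + t * t - 1 / 2))%R).
    { unfold q, t. simpl. replace (snd z * snd z)%R with (r * r - fst z * fst z)%R by lra. field. lra. }
    rewrite Eq.
    assert (Hexp : forall x y, (x <= y)%R -> (exp x <= exp y)%R).
    { intros x y [H|H]; [left; now apply exp_increasing|right; now rewrite H]. }
    destruct (Rle_lt_dec (r / 3) (fst z)) as [Hc|Hc].
    + apply Rle_trans with (eps' * exp (3 / 2 * n))%R.
      * apply Rmult_le_compat; [apply Cmod_ge_0|left; apply exp_pos|now apply HN0|]. apply Hexp.
        rewrite (Rmult_comm (3 / 2)). apply Rmult_le_compat_l; [exact Hn|]. nra.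
      * unfold eps'. rewrite Rmult_assoc, <- exp_plus. replace (- (3 / 2 * n) + 3 / 2 * n)%R with 0%R by ring.
        rewrite exp_0. lra.
    + assert (Ht3 : (t < 1 / 3)%R) by (unfold t; apply Rlt_div_l; lra).
      apply Rle_trans with (M * exp (- (M / eps)))%R.
      * apply Rmult_le_compat; [apply Cmod_ge_0|left; apply exp_pos|now apply HM|]. apply Hexp.
        replace (- (M / eps))%R with (n * - (1 / 18))%R by (unfold n; field; lra).
        apply Rmult_le_compat_l; [exact Hn|]. nra.
      * rewrite exp_Ropp. pose proof (exp_ineq1_le (M / eps)) as H1.
        assert (H2 : (0 <= M / eps)%R) by (apply Rdiv_le_0_compat; lra).
        apply Rle_div_l; [apply exp_pos|]. apply Rle_trans with (eps * (1 + M / eps))%R.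
        -- replace (eps * (1 + M / eps))%R with (eps + M)%R by (field; lra). lra.
        -- apply Rmult_le_compat_l; lra.
Qed.

Lemma entire_bounded_on_circle f r : entire f ->
  exists M, forall z, on_circle r z -> (Cmod (f z) <= M)%R.
Proof.
  intros Hf. set (K := fun z => f (Cexp z)).
  assert (HK : entire K) by (exact (entire_comp f Cexp Hf entire_Cexp)).
  pose proof PI_RGT_0 as Hpi.
  destruct (continuity_ab_maj (fun y => Cmod (K (ln r, y))) 0 (2 * PI)) as [m [Hm _]]; [lra| |].
  - intros y _. apply continuity_pt_filterlim.
    apply (filterlim_ext (fun v => norm (V := C_R_NormedModule) (K (ln r, v)))).
    { intros v. apply C_R_norm. }
    rewrite <- C_R_norm.
    apply (filterlim_comp _ _ _ (fun v => K (ln r, v)) (norm (V := C_R_NormedModule)) (locally y)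
             (locally (T := C_R_NormedModule) (K (ln r, y)))).
    + exact (continuous_vertical K (ln r) y HK).
    + exact (filterlim_norm (K := R_AbsRing) (V := C_R_NormedModule) (K (ln r, y))).
  - exists (Cmod (K (ln r, m))). intros z [y [Hy ->]]. now apply Hm.
Qed.

(** * Euler-Maclaurin summation *)

Lemma rder_csum {I} (F dF : I -> R -> C) (l : list I) t :
  (forall i, In i l -> rder (F i) t (dF i t)) ->
  rder (fun u => csum (fun i => F i u) l) t (csum (fun i => dF i t) l).
Proof.
  induction l as [|i l IH]; intros H.
  - apply (rder_const (RtoC 0)).
  - rewrite csum_cons. apply (rder_ext (fun u => F i u + csum (fun i => F i u) l)); [reflexivity|].
    apply rder_plus; [apply H; now left|]. apply IH. intros; apply H; now right.
Qed.

Lemma Cmod_csum {I} (F : I -> C) (l : list I) :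
  (Cmod (csum F l) <= fold_right Rplus 0 (map (fun i => Cmod (F i)) l))%R.
Proof.
  induction l as [|i l IH]; [rewrite csum_nil, Cmod_0; simpl; lra|].
  rewrite csum_cons. simpl. eapply Rle_trans; [apply Cmod_triangle|]. lra.
Qed.

Lemma csum_seq_S (F : nat -> C) a n : csum F (seq a (S n)) = csum F (seq a n) + F (a + n)%nat.
Proof. rewrite seq_S, csum_app, csum_cons, csum_nil. ring. Qed.

(** Coefficient of the l-th derivative at x in the Taylor expansion of a function at x - u. *)
Definition tcoef (l : nat) (u : R) : R := ((- u) ^ l / INR (fact l))%R.

Lemma tcoef_derive l u : is_derive (tcoef (S l)) u (- tcoef l u)%R.
Proof.
  assert (H1 : INR (fact l) <> 0%R) by apply INR_fact_neq_0.
  assert (H2 : INR (S l) <> 0%R) by now apply not_0_INR.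
  assert (E : (INR (fact (S l)) = INR (S l) * INR (fact l))%R) by (rewrite fact_simpl; apply mult_INR).
  unfold tcoef. apply (is_derive_ext (fun u => / INR (fact (S l)) * (- u) ^ S l)%R);
    [intros v; apply Rmult_comm|].
  replace (- ((- u) ^ l / INR (fact l)))%R with (/ INR (fact (S l)) * (INR (S l) * (-1) * (- u) ^ l))%R
    by (rewrite E; field; auto).
  apply is_derive_scal. apply (is_derive_pow (fun u => - u)%R (S l) u (-1)%R).
  auto_derive; [auto|ring].
Qed.

Section EulerMaclaurin.
(** The F i are successive derivatives on [x - 1, x] only, because the intended functions are
    singular at 0. *)
Context (F : nat -> R -> C) (x : R)
  (HF : forall i u, (0 <= u <= 1)%R -> rder (fun u => F i (x - u)%R) u (- F (S i) (x - u)%R)).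

(** Induction on m: the derivative in u of the remainder for [F i] is, up to sign, the remainder for
    [F (S i)]. Each application of [mean_value_bound] costs a factor 2, whence 2^m. *)
Lemma taylor_back m : forall i D, (0 <= D)%R ->
  (forall u, (0 <= u <= 1)%R -> (Cmod (F (i + m)%nat (x - u)%R) <= D)%R) ->
  forall u, (0 <= u <= 1)%R ->
  (Cmod (F i (x - u)%R - csum (fun l => (RtoC (tcoef l u) * F (i + l)%nat x)%C) (seq 0 m)) <= 2 ^ m * D)%R.
Proof.
  induction m as [|m IH]; intros i D HD H u Hu.
  - cbn [seq]. rewrite csum_nil. replace (_ - RtoC 0) with (F i (x - u)%R) by ring. simpl. rewrite Rmult_1_l.
    rewrite Nat.add_0_r in H. now apply H.
  - set (g := fun u => F i (x - u)%R - csum (fun l => RtoC (tcoef l u) * F (i + l)%nat x) (seq 0 (S m))).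
    assert (Eg0 : g 0%R = RtoC 0).
    { unfold g. change (seq 0 (S m)) with (0%nat :: seq 1 m). rewrite csum_cons.
      rewrite csum_zero.
      - unfold tcoef at 1. simpl. rewrite Nat.add_0_r, Rminus_0_r.
        replace (1 / 1)%R with 1%R by field. ring.
      - intros l Hl. apply in_seq in Hl. unfold tcoef. rewrite Ropp_0, pow_i by lia. unfold Rdiv. rewrite Rmult_0_l.
        ring. }
    set (dg := fun u => - (F (S i) (x - u)%R - csum (fun l => RtoC (tcoef l u) * F (S i + l)%nat x) (seq 0 m))).
    fold (g u). replace (g u) with (g u - g 0%R) by (rewrite Eg0; ring).
    replace (2 ^ S m * D)%R with (2 * (2 ^ m * D))%R by (simpl; ring).
    apply (mean_value_bound g dg); [exact Hu|apply Rmult_le_pos; [apply pow_le; lra|exact HD]|].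
    intros s Hs. split.
    + unfold g, dg.
      apply (rder_ext (fun u => F i (x - u)%R + RtoC (-1) * csum (fun l => RtoC (tcoef l u) * F (i + l)%nat x) (seq
        0 (S m)))).
      { intros v. replace (RtoC (-1)) with (- RtoC 1) by (now rewrite <- RtoC_opp). ring. }
      replace (- _) with (- F (S i) (x - s)%R + RtoC (-1) * csum (fun l => match l with O => RtoC 0 |
        S l' => F (i + l)%nat x * RtoC (- tcoef l' s) end) (seq 0 (S m))).
      2:{ change (seq 0 (S m)) with (0%nat :: seq 1 m). rewrite csum_cons, <- seq_shift, csum_map.
          rewrite (csum_ext _ (fun l => (- RtoC 1) * (RtoC (tcoef l s) * F (S i + l)%nat x))).
          - rewrite csum_scal. replace (RtoC (-1)) with (- RtoC 1) by (now rewrite <- RtoC_opp). ring.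
          - intros l _. replace (S i + l)%nat with (i + S l)%nat by lia. rewrite RtoC_opp. ring. }
      apply rder_plus; [apply HF; lra|]. apply rder_cmult.
      apply (rder_csum (fun l u => RtoC (tcoef l u) * F (i + l)%nat x)
        (fun l u => match l with O => RtoC 0 | S l' => F (i + l)%nat x * RtoC (- tcoef l' u) end)).
      intros [|l] _.
      * apply (rder_ext (fun _ => F (i + 0)%nat x)); [intros v; unfold tcoef; simpl;
          replace (1 / 1)%R with 1%R by field; ring|].
        apply rder_const.
      * apply (rder_ext (fun u => F (i + S l)%nat x * RtoC (tcoef (S l) u))); [intros; ring|].
        apply rder_cmult. exact (rder_pair (tcoef (S l)) (fun _ => 0%R) s _ 0 (tcoef_derive l s) (is_derive_const
          0%R s)).
    + unfold dg. rewrite Cmod_opp. apply IH; [exact HD| |lra]. intros v Hv. rewrite <- Nat.add_succ_comm in H.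
      now apply H.
Qed.

(** For the generating series B(T) of [beta] this says B(T) (e^(-T) - 1) = -T, that is B(T) = T / (1
    - e^(-T)). With D = d/dx, the backward difference is 1 - e^(-D), so B(D) F has backward
    difference F'. *)
Context (beta : nat -> R)
  (Hbeta : forall n, (1 <= n)%nat ->
     csum (fun i => RtoC (beta i) * RtoC (tcoef (n - i) 1)) (seq 0 n) = - RtoC (if (n =? 1)%nat then 1 else 0)).

(** Passing from K to K + 1 adds the terms in [F (S K)], whose total coefficient is given by [Hbeta]
    and is nonzero only for the first derivative. *)
Lemma euler_maclaurin_algebra K : (1 <= K)%nat ->
  csum (fun i => RtoC (beta i) * csum (fun l => RtoC (tcoef l 1) * F (i + l)%nat x) (seq 1 (K - i))) (seq 0 K) = - F
    1%nat x.
Proof.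
  intros HK. induction K as [|K IH]; [lia|]. clear HK.
  rewrite (csum_ext _ (fun i => RtoC (beta i) * csum (fun l => RtoC (tcoef l 1) * F (i + l)%nat x) (seq 1 (K - i))
     + F (S K) x * (RtoC (beta i) * RtoC (tcoef (S K - i) 1)))).
  2:{ intros i Hi. apply in_seq in Hi. replace (S K - i)%nat with (S (K - i)) by lia.
      rewrite csum_seq_S. replace (1 + (K - i))%nat with (S (K - i)) by lia.
      replace (i + S (K - i))%nat with (S K) by lia. ring. }
  rewrite csum_plus, csum_scal, Hbeta by lia. rewrite csum_seq_S.
  replace (K - (0 + K))%nat with 0%nat by lia. cbn [seq]. rewrite csum_nil.
  destruct K as [|K].
  - simpl. rewrite csum_nil. ring.
  - rewrite IH by lia. simpl. ring.
Qed.

(** All Taylor polynomials are cut at the same derivative [F (S K)], so the error is proportional to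
    its size. It is zero when that derivative vanishes, which gives exactness at nonpositive integer
    exponents. *)
Lemma euler_maclaurin K : (1 <= K)%nat -> forall D, (0 <= D)%R ->
  (forall u, (0 <= u <= 1)%R -> (Cmod (F (S K) (x - u)%R) <= D)%R) ->
  (Cmod (csum (fun i => (RtoC (beta i) * F i x)%C) (seq 0 (S K)) -
         csum (fun i => (RtoC (beta i) * F i (x - 1)%R)%C) (seq 0 (S K)) - F 1%nat x)
   <= D * fold_right Rplus 0 (map (fun i => Rabs (beta i) * 2 ^ (S K - i)) (seq 0 (S K))))%R.
Proof.
  intros HK D HD H.
  assert (E : csum (fun i => RtoC (beta i) * F i x) (seq 0 (S K)) -
         csum (fun i => RtoC (beta i) * F i (x - 1)%R) (seq 0 (S K)) - F 1%nat x =
      csum (fun i => - RtoC (beta i) * (F i (x - 1)%R - csum (fun l => RtoC (tcoef l 1) * F (i + l)%nat x) (seq 0 (S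
        K - i)))) (seq 0 (S K))).
  { rewrite (csum_ext (fun i => - RtoC (beta i) * _) (fun i => (RtoC (beta i) * F i x - RtoC (beta i) * F i (x -
      1)%R) +
        RtoC (beta i) * csum (fun l => RtoC (tcoef l 1) * F (i + l)%nat x) (seq 1 (K - i)))).
    - rewrite csum_plus, csum_minus.
      rewrite (csum_seq_S (fun i => RtoC (beta i) * csum _ _)).
      rewrite euler_maclaurin_algebra by exact HK.
      replace (K - (0 + K))%nat with 0%nat by lia. cbn [seq]. rewrite csum_nil. ring.
    - intros i Hi. apply in_seq in Hi. replace (S K - i)%nat with (S (K - i)) by lia.
      change (seq 0 (S (K - i))) with (0%nat :: seq 1 (K - i)). rewrite csum_cons.
      unfold tcoef at 1. simpl pow. simpl fact. simpl INR. replace (1 / 1)%R with 1%R by field. rewrite Nat.add_0_r.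
      ring. }
  rewrite E. eapply Rle_trans; [apply Cmod_csum|].
  clear E. assert (Hl : forall i, In i (seq 0 (S K)) -> (i <= K)%nat) by (intros i Hi; apply in_seq in Hi; lia).
  induction (seq 0 (S K)) as [|i l IH]; [simpl; lra|].
  cbn [map fold_right]. rewrite Rmult_plus_distr_l. apply Rplus_le_compat.
  - rewrite Cmod_mult, Cmod_opp, Cmod_R.
    replace (D * (Rabs (beta i) * 2 ^ (S K - i)))%R with (Rabs (beta i) * (2 ^ (S K - i) * D))%R by ring.
    apply Rmult_le_compat_l; [apply Rabs_pos|]. apply taylor_back; [exact HD| |lra].
    intros u Hu. specialize (Hl i (or_introl eq_refl)). replace (i + (S K - i))%nat with (S K) by lia. now apply H.
  - apply IH. intros j Hj. apply Hl. now right.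
Qed.
End EulerMaclaurin.

(* The branch of the logarithm on R \ {0} with log (-1) = - i pi; it is the one for which
   exp (- s log (t - n)) = exp (i pi s) (n - t)^(-s). *)
Definition ell (x : R) : C := (ln (Rabs x), if Rlt_dec x 0 then (- PI)%R else 0%R).

Definition pw (a : C) (x : R) : C := Cexp (a * ell x).

Lemma ell_pos x : (0 < x)%R -> ell x = (ln x, 0%R).
Proof. intros H. unfold ell. rewrite Rabs_pos_eq by lra. destruct (Rlt_dec x 0); [lra|reflexivity]. Qed.

Lemma ell_neg x : (x < 0)%R -> ell x = (ln (- x), (- PI)%R).
Proof. intros H. unfold ell. rewrite Rabs_left by lra. destruct (Rlt_dec x 0); [reflexivity|lra]. Qed.

Lemma Cexp_ell x : x <> 0%R -> Cexp (ell x) = RtoC x.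
Proof.
  intros H. destruct (Rlt_dec x 0) as [Hx|Hx].
  - rewrite ell_neg by lra. unfold Cexp; simpl. rewrite cos_neg, sin_neg, cos_PI, sin_PI, exp_ln by lra.
    apply injective_projections; simpl; ring.
  - rewrite ell_pos by lra. unfold Cexp; simpl. rewrite cos_0, sin_0, exp_ln by lra.
    apply injective_projections; simpl; ring.
Qed.

Lemma pw_plus a b x : pw (a + b) x = pw a x * pw b x.
Proof. unfold pw. rewrite <- Cexp_plus. f_equal. ring. Qed.

Lemma pw_0 x : pw (RtoC 0) x = RtoC 1.
Proof. unfold pw. rewrite <- Cexp_0. f_equal. ring. Qed.

Lemma pw_nat n x : x <> 0%R -> pw (RtoC (INR n)) x = RtoC (x ^ n).
Proof. intros H. unfold pw. rewrite Cexp_nat, Cexp_ell, RtoC_pow by assumption. reflexivity. Qed.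

Lemma pw_minus_1 a x : x <> 0%R -> pw (a - RtoC 1) x = pw a x * RtoC (/ x).
Proof.
  intros H. assert (HC : RtoC x <> RtoC 0) by (intros E; apply RtoC_inj in E; auto).
  assert (E : pw a x = pw (a - RtoC 1) x * RtoC x).
  { replace a with ((a - RtoC 1) + RtoC (INR 1)) at 1 by (simpl INR; ring).
    rewrite pw_plus, pw_nat by assumption. now rewrite pow_1. }
  rewrite E, RtoC_inv by assumption. now field.
Qed.

Lemma rder_ell (x u : R) : (x - u <> 0)%R -> rder (fun u => ell (x - u)%R) u (RtoC (- / (x - u))).
Proof.
  intros H. destruct (Rlt_dec (x - u) 0) as [Hx|Hx].
  - apply (is_derive_ext_loc (K := R_AbsRing) (V := C_R_NormedModule) (fun u => (ln (- (x - u)), (- PI)%R))).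
    + assert (Hd : (0 < - (x - u))%R) by lra. exists (mkposreal _ Hd). intros v Hv.
      unfold ball in Hv; simpl in Hv. unfold AbsRing_ball, abs, minus, plus, opp in Hv; simpl in Hv.
      apply Rabs_def2 in Hv. symmetry. apply ell_neg. lra.
    + apply (rder_pair (fun u => ln (- (x - u)))%R (fun _ => (- PI)%R) u (- / (x - u)) 0 );
        [auto_derive; [lra|field; lra]|exact (is_derive_const (- PI)%R u)].
  - apply (is_derive_ext_loc (K := R_AbsRing) (V := C_R_NormedModule) (fun u => (ln (x - u), 0%R))).
    + assert (Hd : (0 < x - u)%R) by lra. exists (mkposreal _ Hd). intros v Hv.
      unfold ball in Hv; simpl in Hv. unfold AbsRing_ball, abs, minus, plus, opp in Hv; simpl in Hv.
      apply Rabs_def2 in Hv. symmetry. apply ell_pos. lra.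
    + apply (rder_pair (fun u => ln (x - u))%R (fun _ => 0%R) u (- / (x - u)) 0);
        [auto_derive; [lra|field; lra]|exact (is_derive_const 0%R u)].
Qed.

Lemma rder_pw a (x u : R) : (x - u <> 0)%R ->
  rder (fun u => pw a (x - u)%R) u (- (a * pw (a - RtoC 1) (x - u)%R)).
Proof.
  intros H. rewrite pw_minus_1 by assumption.
  replace (- (a * _)) with (pw a (x - u) * (a * RtoC (- / (x - u)))) by (rewrite RtoC_opp; ring).
  apply (rder_comp Cexp (fun u => a * ell (x - u)%R)); [apply cder_Cexp|]. now apply rder_cmult, rder_ell.
Qed.

Fixpoint fall (n : nat) (b : C) : C :=
  match n with O => RtoC 1 | S n' => fall n' b * (b - RtoC (INR n')) end.

(* em_term a 0 is (x^a - 1) / a (the logarithm if a = 0), and em_term a (S n) its derivatives. *)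
Definition em_term (a : C) (i : nat) (x : R) : C :=
  match i with
  | O => ell x * expm1q (a * ell x)
  | S n => fall n (a - RtoC 1) * pw (a - RtoC 1 - RtoC (INR n)) x
  end.

Lemma em_term_0_mult a x : a * em_term a 0 x = pw a x - RtoC 1.
Proof. unfold em_term, pw. rewrite <- expm1q_mult. ring. Qed.

Lemma rder_em_term a i (x u : R) : (x - u <> 0)%R ->
  rder (fun u => em_term a i (x - u)%R) u (- em_term a (S i) (x - u)%R).
Proof.
  intros H. destruct i as [|n].
  - unfold em_term at 2. simpl fall. replace (a - RtoC 1 - RtoC (INR 0)) with (a - RtoC 1) by (simpl INR; ring).
    destruct (Ceq_dec a (RtoC 0)) as [->|Ha].
    + apply (rder_ext (fun u => ell (x - u)%R)).
      * intros v. unfold em_term. replace (RtoC 0 * ell (x - v)) with (RtoC 0) by ring. rewrite expm1q_0. ring.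
      * rewrite pw_minus_1, pw_0 by assumption.
        replace (- (RtoC 1 * (RtoC 1 * RtoC (/ (x - u))))) with (RtoC (- / (x - u))) by (rewrite RtoC_opp; ring).
        now apply rder_ell.
    + apply (rder_ext (fun u => / a * (pw a (x - u)%R + - RtoC 1))).
      * intros v. pose proof (em_term_0_mult a (x - v)) as E.
        replace (pw a (x - v) + - RtoC 1) with (a * em_term a 0 (x - v)) by (rewrite E; ring). now field.
      * replace (- (RtoC 1 * _)) with (/ a * (- (a * pw (a - RtoC 1) (x - u)%R) + RtoC 0)) by (now field).
        apply rder_cmult, rder_plus; [now apply rder_pw|apply rder_const].
  - unfold em_term. replace (- (fall (S n) (a - RtoC 1) * pw (a - RtoC 1 - RtoC (INR (S n))) (x - u)))
      with (fall n (a - RtoC 1) * - ((a - RtoC 1 - RtoC (INR n)) * pw (a - RtoC 1 - RtoC (INR n) - RtoC 1) (x - u))).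
    + apply rder_cmult. now apply rder_pw.
    + rewrite S_INR, RtoC_plus. simpl fall.
      replace (a - RtoC 1 - (RtoC (INR n) + RtoC 1)) with (a - RtoC 1 - RtoC (INR n) - RtoC 1) by ring. ring.
Qed.

(** * Rational Bernoulli coefficients *)

Definition Q2C (q : Q) : C := RtoC (Q2R q).

Lemma Q2C_plus p q : Q2C (p + q)%Q = Q2C p + Q2C q.
Proof. unfold Q2C. now rewrite Q2R_plus, RtoC_plus. Qed.

Lemma Q2C_mult p q : Q2C (p * q)%Q = Q2C p * Q2C q.
Proof. unfold Q2C. now rewrite Q2R_mult, RtoC_mult. Qed.

Lemma Q2C_opp p : Q2C (- p)%Q = - Q2C p.
Proof. unfold Q2C. now rewrite Q2R_opp, RtoC_opp. Qed.

Lemma Q2R_inject_Z z : Q2R (inject_Z z) = IZR z.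
Proof. unfold Q2R, inject_Z; simpl. field. Qed.

Lemma Q2C_0 : Q2C 0 = RtoC 0.
Proof. unfold Q2C. now rewrite RMicromega.Q2R_0. Qed.

Lemma Q2C_1 : Q2C 1 = RtoC 1.
Proof. unfold Q2C. now rewrite RMicromega.Q2R_1. Qed.

Definition qsum {X} (f : X -> Q) (l : list X) : Q := fold_right Qplus 0%Q (map f l).

Lemma Q2C_qsum {X} (f : X -> Q) l : Q2C (qsum f l) = csum (fun x => Q2C (f x)) l.
Proof.
  induction l as [|x l IH]; [apply Q2C_0|]. unfold qsum in *. simpl. now rewrite Q2C_plus, csum_cons, IH.
Qed.

Definition tcoefQ (l : nat) : Q := (inject_Z ((-1) ^ Z.of_nat l) / inject_Z (Z.of_nat (fact l)))%Q.

Lemma tcoefQ_correct l : Q2C (tcoefQ l) = RtoC (tcoef l 1).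
Proof.
  unfold Q2C, tcoefQ, tcoef. f_equal. rewrite Q2R_div.
  - rewrite !Q2R_inject_Z, <- INR_IZR_INZ. f_equal.
    induction l as [|l IH]; [reflexivity|]. rewrite Nat2Z.inj_succ, Z.pow_succ_r by lia.
    rewrite mult_IZR, IH. simpl. ring.
  - intros H. unfold Qeq in H; simpl in H. pose proof (lt_O_fact l). lia.
Qed.

(* Up to sign conventions beta i is B_i / i!. *)
Fixpoint beta_list (n : nat) : list Q :=
  match n with
  | O => []
  | S n' => beta_list n' ++
      [((if (n' =? 0)%nat then 1 else 0) + qsum (fun i => nth i (beta_list n') 0 * tcoefQ (S n' - i)) (seq 0 n'))%Q]
  end.

Definition beta (n : nat) : Q := nth n (beta_list (S n)) 0%Q.

Lemma beta_list_length n : length (beta_list n) = n.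
Proof. induction n as [|n IH]; [reflexivity|]. simpl. rewrite length_app, IH. simpl. lia. Qed.

Lemma beta_list_nth n i : (i < n)%nat -> nth i (beta_list n) 0%Q = beta i.
Proof.
  intros H. unfold beta. induction n as [|n IH]; [lia|].
  destruct (Nat.eq_dec i n) as [->|Hi]; [reflexivity|].
  simpl beta_list at 1. rewrite app_nth1 by (rewrite beta_list_length; lia). apply IH. lia.
Qed.

Lemma beta_spec n : (1 <= n)%nat ->
  csum (fun i => RtoC (Q2R (beta i)) * RtoC (tcoef (n - i) 1)) (seq 0 n) = - RtoC (if (n =? 1)%nat then 1 else 0).
Proof.
  intros Hn. destruct n as [|n]; [lia|]. rewrite csum_seq_S. change (0 + n)%nat with n. cbv beta.
  assert (E : RtoC (Q2R (beta n)) = Q2C (if (n =? 0)%nat then 1 else 0) +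
     csum (fun i => RtoC (Q2R (beta i)) * RtoC (tcoef (S n - i) 1)) (seq 0 n)).
  { change (RtoC (Q2R (beta n))) with (Q2C (beta n)). unfold beta at 1. simpl beta_list.
    rewrite app_nth2 by (rewrite beta_list_length; lia). rewrite beta_list_length, Nat.sub_diag. cbn [nth].
    rewrite Q2C_plus, Q2C_qsum. f_equal. apply csum_ext. intros i Hi. apply in_seq in Hi.
    rewrite Q2C_mult, tcoefQ_correct, beta_list_nth by lia. reflexivity. }
  rewrite E. replace (S n - n)%nat with 1%nat by lia.
  replace (tcoef 1 1) with (-1)%R by (unfold tcoef; simpl; field).
  replace (RtoC (-1)) with (- RtoC 1) by (now rewrite <- RtoC_opp).
  change (S n =? 1)%nat with (n =? 0)%nat. destruct (n =? 0)%nat; rewrite ?Q2C_1, ?Q2C_0; ring.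
Qed.

(** A primitive of x^(a-1) for the backward difference, up to the error [em_rem]; here a is 1 - z
    for the exponent z being interpolated. *)
Definition em (K : nat) (a : C) (x : R) : C := csum (fun i => Q2C (beta i) * em_term a i x) (seq 0 (S K)).

Definition em_rem (K : nat) (a : C) (x : R) : C := em K a x - em K a (x - 1)%R - pw (a - RtoC 1) x.

(** This is 1/|x|^2 for nonzero x, written as an exponential so that it combines with the bounds for
    complex powers. *)
Definition inv_sq (x : R) : R := exp (-2 * ln (Rabs x)).

Lemma exp_le x y : (x <= y)%R -> (exp x <= exp y)%R.
Proof. intros [H|H]; [left; now apply exp_increasing|right; now rewrite H]. Qed.

Lemma ln_Rabs_nonneg x : (1 <= Rabs x)%R -> (0 <= ln (Rabs x))%R.
Proof. intros [H|H]; [|rewrite <- H, ln_1; lra]. left. rewrite <- ln_1. apply ln_increasing; lra. Qed.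

(** The factor exp (PI |Im a|) pays for the argument - PI on the negative axis. *)
Lemma Cmod_pw a x : (Cmod (pw a x) <= exp (PI * Rabs (snd a)) * exp (fst a * ln (Rabs x)))%R.
Proof.
  unfold pw. rewrite Cmod_Cexp, <- exp_plus. apply exp_le. destruct a as [a b]. unfold ell; simpl.
  pose proof PI_RGT_0.
  assert (PI * b <= PI * Rabs b)%R by (apply Rmult_le_compat_l; [lra|apply Rle_abs]).
  assert (0 <= PI * Rabs b)%R by (apply Rmult_le_pos; [lra|apply Rabs_pos]).
  destruct (Rlt_dec x 0); lra.
Qed.

Lemma Cmod_pw_decay a x : (1 <= Rabs x)%R -> (fst a <= -2)%R -> (Cmod (pw a x) <= exp (PI * Rabs (snd a)) * inv_sq
  x)%R.
Proof.
  intros Hx Ha. eapply Rle_trans; [apply Cmod_pw|]. apply Rmult_le_compat_l; [left; apply exp_pos|].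
  apply exp_le. pose proof (ln_Rabs_nonneg x Hx). nra.
Qed.

Lemma Cmod_ell x : (1 <= Rabs x)%R -> (Cmod (ell x) <= ln (Rabs x) + PI)%R.
Proof.
  intros H. eapply Rle_trans; [apply Cmod_le_abs|]. unfold ell; simpl. pose proof PI_RGT_0.
  rewrite (Rabs_pos_eq (ln _)) by (now apply ln_Rabs_nonneg).
  destruct (Rlt_dec x 0); [rewrite Rabs_Ropp, (Rabs_pos_eq PI) by lra; lra|rewrite Rabs_R0; lra].
Qed.

Lemma fst_le_Cmod z : (fst z <= Cmod z)%R.
Proof. eapply Rle_trans; [apply Rle_abs|apply re_le_Cmod]. Qed.

Lemma Cmod_pw_growth a x r : (1 <= Rabs x)%R -> (Cmod a <= r)%R -> (Cmod (pw a x) <= exp (r * PI) * exp (r * ln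
  (Rabs x)))%R.
Proof.
  intros Hx Ha. unfold pw. rewrite Cmod_Cexp, <- exp_plus. apply exp_le.
  eapply Rle_trans; [apply fst_le_Cmod|]. rewrite Cmod_mult.
  pose proof (Cmod_ell x Hx). pose proof (Cmod_ge_0 a). pose proof (Cmod_ge_0 (ell x)).
  replace (r * PI + r * ln (Rabs x))%R with (r * (ln (Rabs x) + PI))%R by ring. apply Rmult_le_compat; lra.
Qed.

Lemma Cmod_fall n b r : (Cmod b <= r)%R -> (Cmod (fall n b) <= (r + INR n) ^ n)%R.
Proof.
  intros Hb. assert (Hr : (0 <= r)%R) by (pose proof (Cmod_ge_0 b); lra).
  induction n as [|n IH]; [simpl; rewrite Cmod_1; lra|]. simpl fall. rewrite Cmod_mult, S_INR.
  pose proof (pos_INR n). replace ((r + (INR n + 1)) ^ S n)%R with ((r + (INR n + 1)) ^ n * (r + (INR n + 1)))%R by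
    (simpl; ring).
  apply Rmult_le_compat; try apply Cmod_ge_0.
  - eapply Rle_trans; [exact IH|]. apply pow_incr. lra.
  - eapply Rle_trans; [apply Cmod_triangle|]. rewrite Cmod_opp, Cmod_R, Rabs_pos_eq by assumption. lra.
Qed.

Lemma Cmod_shift a (r s : R) : (0 <= s)%R -> (Cmod a <= r)%R -> (Cmod (a - RtoC s) <= r + s)%R.
Proof.
  intros Hs Ha. eapply Rle_trans; [apply Cmod_triangle|]. rewrite Cmod_opp, Cmod_R, Rabs_pos_eq by assumption. lra.
Qed.

(** What matters is polynomial growth in x, uniform for a in a disc; it will be absorbed by
    neighbours with large exponents, so the degree is chosen generously. *)
Lemma em_term_growth i r : (0 <= r)%R -> exists D, (0 <= D)%R /\ forall a x, (Cmod a <= r)%R -> (1 <= Rabs x)%R ->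
  (Cmod (em_term a i x) <= D * exp ((r + INR i + 1) * ln (Rabs x)))%R.
Proof.
  intros Hr. pose proof PI_RGT_0 as Hpi. destruct i as [|n].
  - exists (2 * exp ((r + 1) * PI))%R. split; [pose proof (exp_pos ((r + 1) * PI)); lra|].
    intros a x Ha Hx. unfold em_term. rewrite Cmod_mult.
    replace (2 * exp ((r + 1) * PI) * exp ((r + INR 0 + 1) * ln (Rabs x)))%R with
      (exp (ln (Rabs x) + PI) * (2 * exp (r * (ln (Rabs x) + PI))))%R.
    2:{ transitivity (2 * (exp (ln (Rabs x) + PI) * exp (r * (ln (Rabs x) + PI))))%R; [ring|].
        rewrite Rmult_assoc, <- !exp_plus. f_equal. f_equal. simpl. ring. }
    pose proof (Cmod_ell x Hx) as Hl. pose proof (ln_Rabs_nonneg x Hx) as Hl0.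
    apply Rmult_le_compat; try apply Cmod_ge_0.
    + eapply Rle_trans; [exact Hl|]. pose proof (exp_ineq1_le (ln (Rabs x) + PI)). lra.
    + eapply Rle_trans; [apply expm1q_bound|]. apply Rmult_le_compat_l; [lra|]. apply exp_le.
      apply Rmax_lub; [nra|]. eapply Rle_trans; [apply fst_le_Cmod|]. rewrite Cmod_mult.
      apply Rmult_le_compat; try apply Cmod_ge_0; assumption.
  - exists ((r + 1 + INR n) ^ n * exp ((r + 1 + INR n) * PI))%R. pose proof (pos_INR n) as Hn. split.
    { apply Rmult_le_pos; [apply pow_le; lra|left; apply exp_pos]. }
    intros a x Ha Hx. unfold em_term. rewrite Cmod_mult, Rmult_assoc.
    pose proof (Cmod_shift a r 1 ltac:(lra) Ha) as Ha1.
    apply Rmult_le_compat; try apply Cmod_ge_0; [now apply Cmod_fall|].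
    eapply Rle_trans; [apply (Cmod_pw_growth _ _ (r + 1 + INR n) Hx); apply Cmod_shift; [exact Hn|exact Ha1]|].
    apply Rmult_le_compat_l; [left; apply exp_pos|]. apply exp_le. pose proof (ln_Rabs_nonneg x Hx).
    apply Rmult_le_compat_r; [assumption|]. rewrite S_INR. lra.
Qed.

Lemma em_growth K r : (0 <= r)%R -> exists D, (0 <= D)%R /\ forall a x, (Cmod a <= r)%R -> (1 <= Rabs x)%R ->
  (Cmod (em K a x) <= D * exp ((r + INR K + 1) * ln (Rabs x)))%R.
Proof.
  intros Hr. unfold em. assert (Hl : forall i, In i (seq 0 (S K)) -> (i <= K)%nat) by (intros i Hi;
    apply in_seq in Hi; lia).
  induction (seq 0 (S K)) as [|i l IH].
  - exists 0%R. split; [lra|]. intros. rewrite csum_nil, Cmod_0. lra.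
  - destruct IH as [D1 [HD1 H1]]; [intros; apply Hl; now right|].
    destruct (em_term_growth i r Hr) as [D2 [HD2 H2]].
    exists (Rabs (Q2R (beta i)) * D2 + D1)%R. pose proof (Rabs_pos (Q2R (beta i))). split; [nra|].
    intros a x Ha Hx. rewrite csum_cons. eapply Rle_trans; [apply Cmod_triangle|].
    rewrite Rmult_plus_distr_r. apply Rplus_le_compat; [|now apply H1].
    rewrite Cmod_mult. unfold Q2C. rewrite Cmod_R, Rmult_assoc. apply Rmult_le_compat_l; [assumption|].
    eapply Rle_trans; [now apply H2|]. apply Rmult_le_compat_l; [assumption|]. apply exp_le.
    pose proof (ln_Rabs_nonneg x Hx). apply Rmult_le_compat_r; [assumption|].
    specialize (Hl i (or_introl eq_refl)). apply le_INR in Hl. lra.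
Qed.

(** The condition on x keeps [x - 1, x] away from the singularity at 0. It excludes x = 1, which is
    why that point gets its own rule in [emm]. *)
Lemma em_rem_bound K : (1 <= K)%nat -> exists D, (0 <= D)%R /\ forall a x B, (1 < x \/ x < 0)%R -> (0 <= B)%R ->
  (forall u, (0 <= u <= 1)%R -> (Cmod (em_term a (S K) (x - u)%R) <= B)%R) -> (Cmod (em_rem K a x) <= B * D)%R.
Proof.
  intros HK. exists (fold_right Rplus 0 (map (fun i => Rabs (Q2R (beta i)) * 2 ^ (S K - i)) (seq 0 (S K))))%R. split.
  { induction (seq 0 (S K)) as [|i l IH]; simpl fold_right; [lra|].
    apply Rplus_le_le_0_compat; [|exact IH]. apply Rmult_le_pos; [apply Rabs_pos|apply pow_le; lra]. }
  intros a x B Hx HB H. unfold em_rem, em.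
  replace (pw (a - RtoC 1) x) with (em_term a 1 x).
  - apply (euler_maclaurin (em_term a) x); try assumption.
    + intros i u Hu. apply rder_em_term. lra.
    + intros n Hn. exact (beta_spec n Hn).
  - unfold em_term. simpl fall. replace (a - RtoC 1 - RtoC (INR 0)) with (a - RtoC 1) by (simpl INR; ring). ring.
Qed.

(** The derivative of order K + 1 carries the factor [fall K (a - RtoC 1)], so the preceding bound
    applies with B = 0. *)
Lemma em_rem_vanish K a x : (1 <= K)%nat -> (1 < x \/ x < 0)%R -> fall K (a - RtoC 1) = RtoC 0 -> em_rem K a x =
  RtoC 0.
Proof.
  intros HK Hx Hf. destruct (em_rem_bound K HK) as [D [_ H]]. apply Cmod_eq_0, Rle_antisym; [|apply Cmod_ge_0].
  replace 0%R with (0 * D)%R by ring. apply H; [exact Hx|lra|]. intros u _. unfold em_term. rewrite Hf.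
  rewrite Cmult_0_l, Cmod_0. lra.
Qed.

(** The condition on K brings the real part of the exponent a - 1 - K in the last derivative down to
    at most -2. *)
Lemma em_rem_decay K r : (1 <= K)%nat -> (0 <= r)%R -> (r + 1 <= INR K)%R ->
  exists D, (0 <= D)%R /\ forall a x, (Cmod a <= r)%R -> (2 <= x \/ x <= -1)%R ->
  (Cmod (em_rem K a x) <= D * inv_sq x)%R.
Proof.
  intros HK Hr HrK. destruct (em_rem_bound K HK) as [D [HD H]]. pose proof PI_RGT_0 as Hpi.
  pose proof (pos_INR K).
  (* 4 is the square of the constant in |x| <= 2 |x - u|, valid for u in [0, 1]. *)
  set (B := ((r + 1 + INR K) ^ K * (exp (PI * r) * 4))%R).
  assert (HB : (0 <= B)%R).
  { apply Rmult_le_pos; [apply pow_le; lra|]. pose proof (exp_pos (PI * r)). lra. }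
  exists (B * D)%R. split; [now apply Rmult_le_pos|]. intros a x Ha Hx.
  replace (B * D * inv_sq x)%R with (B * inv_sq x * D)%R by ring.
  assert (Hmj : forall y, (0 < inv_sq y)%R) by (intros; apply exp_pos).
  apply H; [lra|specialize (Hmj x); nra|]. intros u Hu. unfold em_term, B. rewrite Cmod_mult, (Rmult_assoc (_ ^ _)).
  apply Rmult_le_compat; try apply Cmod_ge_0.
  - apply Cmod_fall. apply Cmod_shift; [lra|exact Ha].
  - assert (Hy : (1 <= Rabs (x - u) /\ Rabs x <= 2 * Rabs (x - u))%R).
    { destruct Hx; [rewrite !Rabs_pos_eq by lra|rewrite !Rabs_left by lra]; lra. }
    destruct Hy as [Hy1 Hy2].
    eapply Rle_trans; [apply Cmod_pw_decay; [exact Hy1|]|].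
    + simpl. pose proof (fst_le_Cmod a). lra.
    + rewrite Rmult_assoc. apply Rmult_le_compat; [left; apply exp_pos|left; apply Hmj| |].
      * apply exp_le. apply Rmult_le_compat_l; [lra|]. simpl.
        replace (snd a + - 0 + - 0)%R with (snd a) by ring.
        eapply Rle_trans; [apply abs_im_le_Cmod|exact Ha].
      * unfold inv_sq. replace 4%R with (exp (2 * ln 2)).
        -- rewrite <- exp_plus. apply exp_le.
           assert (ln (Rabs x) <= ln 2 + ln (Rabs (x - u)))%R; [|lra].
           assert (0 < Rabs x)%R by (apply Rabs_pos_lt; lra). rewrite <- ln_mult by lra.
           destruct Hy2 as [Hy2|Hy2]; [left; apply ln_increasing; lra|right; now rewrite Hy2].
        -- replace (2 * ln 2)%R with (ln 2 + ln 2)%R by ring. rewrite exp_plus, exp_ln by lra. ring.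
Qed.

Lemma fall_nat_vanish K m : (m < K)%nat -> fall K (RtoC (INR m)) = RtoC 0.
Proof.
  induction K as [|K IH]; [lia|]. intros H. simpl. destruct (Nat.eq_dec m K) as [->|Hm].
  - ring.
  - rewrite IH by lia. ring.
Qed.

Lemma entire_pw x : entire (fun a => pw a x).
Proof. apply (entire_comp Cexp (fun a => a * ell x)); [apply entire_Cexp|entire_tac]. Qed.

Lemma entire_em K x : entire (fun a => em K a x).
Proof.
  apply (entire_csum (fun i a => Q2C (beta i) * em_term a i x)). intros i _.
  apply entire_mult; [apply entire_const|]. destruct i as [|n]; unfold em_term.
  - apply entire_mult; [apply entire_const|].
    apply (entire_comp expm1q (fun a => a * ell x)); [apply entire_expm1q|entire_tac].
  - apply entire_mult.
    + apply (entire_comp (fall n) (fun a => a - RtoC 1)); [|entire_tac].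
      clear. induction n as [|n IH]; simpl; entire_tac.
    + apply (entire_comp (fun b => pw b x) (fun a => a - RtoC 1 - RtoC (INR n))); [apply entire_pw|entire_tac].
Qed.

(** * The nested sums over the points of both sides *)

Definition Wt (s : C) (x : R) : C := pw (- s) x.

Definition Xpos (N : nat) : list R := map INR (seq 1 (N - 1)).
Definition Xneg (t : R) (N : nat) : list R := map (fun n => (t - INR n)%R) (rev (seq 1 (N - 1))).
Definition Xs (t : R) (N : nat) : list R := Xpos N ++ Xneg t N.

Lemma Xpos_S N : Xpos (S (S N)) = Xpos (S N) ++ [INR (S N)].
Proof. unfold Xpos. replace (S (S N) - 1)%nat with (S N) by lia. rewrite seq_S, map_app. simpl.
now rewrite Nat.sub_0_r. Qed.

Lemma Xneg_S t N : Xneg t (S (S N)) = (t - INR (S N))%R :: Xneg t (S N).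
Proof.
  unfold Xneg. replace (S (S N) - 1)%nat with (S N) by lia. rewrite seq_S, rev_app_distr.
  replace (S N - 1)%nat with N by lia. reflexivity.
Qed.

Lemma Xs_S t N : Xs t (S (S N)) = Xpos (S N) ++ INR (S N) :: (t - INR (S N))%R :: Xneg t (S N).
Proof. unfold Xs. rewrite Xpos_S, Xneg_S, <- app_assoc. reflexivity. Qed.

Lemma Clog_rhp_real (x : R) : (0 < x)%R -> Clog_rhp (RtoC x) = (ln x, 0%R).
Proof.
  intros H. unfold Clog_rhp. rewrite Cmod_R, Rabs_pos_eq by lra. simpl. unfold Rdiv. now rewrite Rmult_0_l, atan_0.
Qed.

Lemma caux_pos rs N : caux rs (RtoC 0) N = nest (map Wt (rev rs)) (Xpos N).
Proof.
  revert N. induction rs as [|a rs IH]; intros N; [reflexivity|].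
  simpl rev. rewrite map_app. simpl caux. unfold Csum_lt, Xpos.
  match goal with |- fold_right _ _ (map ?F ?l) = _ =>
    change (csum F l = nest (map Wt (rev rs) ++ [Wt a]) (map INR l)); set (G := F) end.
  induction (N - 1)%nat as [|n IHn].
  - cbn [seq map]. now rewrite nest_app_nil.
  - rewrite csum_seq_S, seq_S, map_app. cbn [map]. rewrite nest_snoc, <- IHn.
    unfold G at 2. rewrite IH. unfold Xpos. replace (1 + n - 1)%nat with n by lia.
    assert (Hn : (0 < INR (1 + n))%R) by (apply lt_0_INR; lia).
    unfold Cpow_neg. replace (RtoC (INR (1 + n)) - RtoC 0) with (RtoC (INR (1 + n))) by ring.
    rewrite Clog_rhp_real by assumption. unfold Wt, pw. rewrite ell_pos by assumption.
    replace (- a * (ln (INR (1 + n)), 0%R)) with (- (a * (ln (INR (1 + n)), 0%R))) by ring. ring.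
Qed.

Lemma Wt_neg (t : R) (m : nat) (a : C) : (t - INR m < 0)%R ->
  Wt a (t - INR m) = Cexp (C_I_pi * a) * Cpow_neg (RtoC (INR m) - RtoC t) a.
Proof.
  intros H. unfold Wt, pw, Cpow_neg. rewrite <- RtoC_minus, Clog_rhp_real, ell_neg, <- Cexp_plus by lra.
  f_equal. replace (- (t - INR m))%R with (INR m - t)%R by ring. unfold C_I_pi.
  apply injective_projections; simpl; ring.
Qed.

(** With argument - PI on the negative axis, each factor e^(i pi s) is absorbed into the power of t
    - n. Larger n come first in [Xneg], which accounts for the reversed indices in the definition of
    zeta_U. *)
Lemma caux_neg (t : R) (s : list C) N : (t <= 0)%R ->
  Cexp (C_I_pi * Csum_list s) * caux s (RtoC t) N = nest (map Wt s) (Xneg t N).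
Proof.
  intros Ht. revert N. induction s as [|a s IH]; intros N.
  - change (Cexp (C_I_pi * RtoC 0) * RtoC 1 = RtoC 1). replace (C_I_pi * RtoC 0) with (RtoC 0) by ring.
    rewrite Cexp_0. ring.
  - simpl caux. unfold Csum_lt, Xneg.
    match goal with |- _ * fold_right _ _ (map ?F ?l) = _ =>
      change (Cexp (C_I_pi * Csum_list (a :: s)) * csum F l = nest (Wt a ::
        map Wt s) (map (fun n => (t - INR n)%R) (rev l)));
      set (G := F) end.
    induction (N - 1)%nat as [|n IHn].
    + cbn [seq map rev]. rewrite csum_nil, nest_nil_r. ring.
    + rewrite csum_seq_S, seq_S, rev_app_distr. simpl app. cbn [map]. change (1 + n)%nat with (S n).
      rewrite nest_cons, <- IHn. change (Csum_list (a :: s)) with (a + Csum_list s).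
      assert (Hn : (t - INR (S n) < 0)%R) by (assert (0 < INR (S n))%R by (apply lt_0_INR; lia); lra).
      rewrite (Wt_neg t (S n) a Hn).
      specialize (IH (S n)). unfold Xneg in IH. replace (S n - 1)%nat with n in IH by lia. rewrite <- IH.
      unfold G at 2. replace (C_I_pi * (a + Csum_list s)) with (C_I_pi * a + C_I_pi * Csum_list s) by ring.
      rewrite Cexp_plus. ring.
Qed.

Definition zetaU (t : R) (N : nat) (s : list C) : C := nest (map Wt s) (Xs t N).

Lemma zetaU_trunc_nest (t : R) s N : (t <= 0)%R -> zetaU_trunc s (RtoC t) N = zetaU t N s.
Proof.
  intros Ht. unfold zetaU_trunc, zetaU, Xs. rewrite nest_split, length_map.
  apply csum_ext. intros i _. unfold zeta_trunc. rewrite rev_involutive, caux_pos, rev_involutive.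
  rewrite firstn_map, skipn_map, <- caux_neg by assumption. ring.
Qed.

(** The point 1 is listed apart because its predecessor is 0; all other predecessors have absolute
    value at least 1. *)
Definition good (x : R) : Prop := (x = 1 \/ 2 <= x \/ x <= -1)%R.

Lemma good_abs x : good x -> (1 <= Rabs x)%R.
Proof. intros [->|[H|H]]; [rewrite Rabs_R1; lra|rewrite Rabs_pos_eq; lra|rewrite Rabs_left; lra]. Qed.

Lemma good_INR n : good (INR (S n)).
Proof.
  destruct n as [|n]; [left; reflexivity|right; left]. rewrite !S_INR. pose proof (pos_INR n). lra.
Qed.

Lemma good_neg t n : (t <= 0)%R -> good (t - INR (S n)).
Proof. intros Ht. right; right. rewrite S_INR. pose proof (pos_INR n). lra. Qed.

Lemma Xs_good t N x : (t <= 0)%R -> In x (Xs t N) -> good x.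
Proof.
  intros Ht H. apply in_app_iff in H. destruct H as [H|H]; apply in_map_iff in H; destruct H as [n [<- Hn]].
  - apply in_seq in Hn. destruct n as [|n]; [lia|]. apply good_INR.
  - apply in_rev, in_seq in Hn. destruct n as [|n]; [lia|]. now apply good_neg.
Qed.

Lemma prodv_app {X} (v : X -> R) A B : prodv v (A ++ B) = (prodv v A * prodv v B)%R.
Proof. induction A as [|x A IH]; simpl; [ring|]. rewrite IH. ring. Qed.

Lemma prodv_map {X Y} (v : X -> R) (g : Y -> X) A : prodv v (map g A) = prodv (fun y => v (g y)) A.
Proof. induction A as [|x A IH]; simpl; [reflexivity|]. now rewrite IH. Qed.

Lemma inv_sq_eq x : x <> 0%R -> (inv_sq x = / (Rabs x * Rabs x))%R.
Proof.
  intros H. pose proof (Rabs_pos_lt x H). unfold inv_sq.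
  replace (-2 * ln (Rabs x))%R with (- (ln (Rabs x) + ln (Rabs x)))%R by ring.
  rewrite exp_Ropp, exp_plus, exp_ln by assumption. reflexivity.
Qed.

Lemma inv_sq_pos x : (0 < inv_sq x)%R.
Proof. apply exp_pos. Qed.

Lemma inv_sq_le_1 x : good x -> (inv_sq x <= 1)%R.
Proof.
  intros H. apply good_abs, ln_Rabs_nonneg in H. unfold inv_sq. rewrite <- exp_0. apply exp_le. lra.
Qed.

(** The telescoping majorant bounds both the total product and the single increments, and later
    yields a rate of convergence. *)
Lemma inv_sq_nat_le n : (inv_sq (INR (S n)) <= 2 / INR (S n) - 2 / INR (S (S n)))%R.
Proof.
  pose proof (INR_S_pos n) as H.
  rewrite inv_sq_eq, Rabs_pos_eq, (S_INR (S n)) by lra. set (y := INR (S n)) in *.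
  assert (Hy : (1 <= y)%R) by (unfold y; rewrite S_INR; pose proof (pos_INR n); lra).
  replace (2 / y - 2 / (y + 1))%R with (/ (y * y) * (2 * y / (y + 1)))%R by (field; lra).
  rewrite <- (Rmult_1_r (/ (y * y))) at 1. apply Rmult_le_compat_l; [left; apply Rinv_0_lt_compat; nra|].
  apply Rle_div_r; lra.
Qed.

Lemma inv_sq_neg_le t n : (t <= 0)%R -> (inv_sq (t - INR (S n)) <= inv_sq (INR (S n)))%R.
Proof.
  intros Ht. pose proof (INR_S_pos n) as H.
  unfold inv_sq. apply exp_le. rewrite Rabs_left, (Rabs_pos_eq (INR (S n))) by lra.
  assert (ln (INR (S n)) <= ln (- (t - INR (S n))))%R; [|lra].
  destruct (Rle_lt_or_eq_dec t 0 Ht) as [H1|H1]; [left; apply ln_increasing; lra|right; f_equal; lra].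
Qed.

(** By 1 + u <= exp u the product becomes a telescoping sum in the exponent. *)
Lemma prodv_seq_bound (c : R) (v : nat -> R) n : (0 <= c)%R -> (forall k, 0 <= v k)%R ->
  (forall k, v (S k) <= c * inv_sq (INR (S k)))%R ->
  (prodv v (seq 1 n) <= exp (c * (2 - 2 / INR (S n))))%R.
Proof.
  intros Hc Hv0 Hv. induction n as [|n IH].
  - simpl. replace (c * (2 - 2 / 1))%R with 0%R by field. rewrite exp_0. lra.
  - rewrite seq_S, prodv_app. simpl prodv at 2. rewrite Rmult_1_r. specialize (Hv n). pose proof (Hv0 (S n)).
    replace (c * (2 - 2 / INR (S (S n))))%R with (c * (2 - 2 / INR (S n)) + c * (2 / INR (S n) - 2 / INR (S (S
      n))))%R by ring.
    rewrite exp_plus. apply Rmult_le_compat; [|lra|exact IH|].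
    + pose proof (prodv_ge_1 v (seq 1 n) Hv0). lra.
    + pose proof (exp_ineq1_le (c * (2 / INR (S n) - 2 / INR (S (S n))))) as E.
      pose proof (inv_sq_nat_le n) as M. apply (Rmult_le_compat_l c) in M; [|exact Hc]. lra.
Qed.

Lemma prodv_rev {X} (v : X -> R) A : prodv v (rev A) = prodv v A.
Proof. induction A as [|x A IH]; [reflexivity|]. simpl. rewrite prodv_app, IH. simpl. ring. Qed.

Lemma prodv_Xs (c t : R) N : (0 <= c)%R -> (t <= 0)%R ->
  (prodv (fun x => c * inv_sq x) (Xs t N) <= exp (4 * c))%R.
Proof.
  intros Hc Ht. unfold Xs, Xpos, Xneg. rewrite prodv_app, !prodv_map, prodv_rev.
  replace (4 * c)%R with (2 * c + 2 * c)%R by ring. rewrite exp_plus.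
  assert (H0 : forall x, (0 <= c * inv_sq x)%R) by (intros x; apply Rmult_le_pos; [exact Hc|left; apply inv_sq_pos]).
  assert (HE : forall n, (exp (c * (2 - 2 / INR (S n))) <= exp (2 * c))%R).
  { intros n. apply exp_le. rewrite (Rmult_comm 2). apply Rmult_le_compat_l; [exact Hc|].
    assert (0 <= 2 / INR (S n))%R; [|lra]. apply Rdiv_le_0_compat; [lra|apply lt_0_INR; lia]. }
  apply Rmult_le_compat.
  - match goal with |- (0 <= prodv ?w ?l)%R => pose proof (prodv_ge_1 w l (fun k => H0 _)); lra end.
  - match goal with |- (0 <= prodv ?w ?l)%R => pose proof (prodv_ge_1 w l (fun k => H0 _)); lra end.
  - eapply Rle_trans; [apply (prodv_seq_bound c); [exact Hc|intros; apply H0|intros; lra]|apply HE].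
  - eapply Rle_trans; [apply (prodv_seq_bound c); [exact Hc|intros; apply H0|]|apply HE].
    intros k. apply Rmult_le_compat_l; [exact Hc|]. now apply inv_sq_neg_le.
Qed.

(** * Uniform bounds for the truncated sums and their increments *)

Definition summable (c : R) (f : R -> C) : Prop := forall x, good x -> (Cmod (f x) <= c * inv_sq x)%R.

Lemma summable_dominated c t N f : (t <= 0)%R -> summable c f -> dominated (fun x => c * inv_sq x)%R (Xs t N) f.
Proof. intros Ht H x Hx. apply H. eapply Xs_good; eassumption. Qed.

Lemma nest_Xs_bound c t N fs : (0 <= c)%R -> (t <= 0)%R -> List.Forall (summable c) fs ->
  (Cmod (nest fs (Xs t N)) <= exp (4 * c))%R.
Proof.
  intros Hc Ht H. eapply Rle_trans; [|apply (prodv_Xs c t N Hc Ht)]. apply nest_bound.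
  - intros x. apply Rmult_le_pos; [exact Hc|left; apply inv_sq_pos].
  - eapply List.Forall_impl; [|exact H]. intros f. now apply summable_dominated.
Qed.

(** Raising the truncation inserts two adjacent points in the middle of the list, one for each half.
    Each insertion costs at most c/(N+1)^2 times a uniform bound; 4 is two insertions times the 2 of
    [inv_sq_nat_le]. *)
Lemma nest_Xs_step c t N fs : (0 <= c)%R -> (t <= 0)%R -> List.Forall (summable c) fs ->
  (Cmod (nest fs (Xs t (S (S N))) - nest fs (Xs t (S N))) <=
   4 * c * (1 + c) * exp (4 * c) * (/ INR (S N) - / INR (S (S N))))%R.
Proof.
  intros Hc Ht H. rewrite Xs_S. set (v := fun x => (c * inv_sq x)%R).
  assert (Hv : forall x, (0 <= v x)%R) by (intros x; apply Rmult_le_pos; [exact Hc|left; apply inv_sq_pos]).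
  set (p := INR (S N)). set (q := (t - INR (S N))%R).
  assert (Hall : List.Forall (dominated v (Xs t (S (S N)))) fs).
  { eapply List.Forall_impl; [|exact H]. intros f. now apply summable_dominated. }
  rewrite Xs_S in Hall. fold p q in Hall.
  pose proof (nest_insert v p (Xpos (S N)) (q :: Xneg t (S N)) Hv fs Hall) as I1.
  assert (Hall2 : List.Forall (dominated v (Xpos (S N) ++ q :: Xneg t (S N))) fs).
  { eapply List.Forall_impl; [|exact Hall]. intros f Hf x Hx. apply Hf. rewrite in_app_iff in *. simpl. tauto. }
  pose proof (nest_insert v q (Xpos (S N)) (Xneg t (S N)) Hv fs Hall2) as I2. fold (Xs t (S N)) in I2.
  set (m := (inv_sq p)). assert (Hm : (0 < m)%R) by apply inv_sq_pos.
  assert (Hm1 : (m <= 1)%R) by (apply inv_sq_le_1, good_INR).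
  assert (Hq : (inv_sq q <= m)%R) by (now apply inv_sq_neg_le).
  pose proof (prodv_Xs c t (S N) Hc Ht) as P. fold v in P.
  assert (P1 : (1 <= prodv v (Xs t (S N)))%R) by now apply prodv_ge_1.
  assert (E : (prodv v (Xpos (S N) ++ q :: Xneg t (S N)) = (1 + v q) * prodv v (Xs t (S N)))%R).
  { unfold Xs. rewrite !prodv_app. cbn [prodv]. ring. }
  rewrite E in I1. set (Q := prodv v (Xs t (S N))) in *. set (W := exp (4 * c)) in *.
  set (u := nest fs (Xpos (S N) ++ q :: Xneg t (S N))) in *.
  match goal with |- (Cmod (?A - ?B) <= _)%R => replace (A - B) with ((A - u) + (u - B)) by ring end.
  eapply Rle_trans; [apply Cmod_triangle|].
  assert (B1 : (v p * ((1 + v q) * Q) <= c * m * ((1 + c) * W))%R).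
  { apply Rmult_le_compat; [apply Hv| |right; reflexivity|].
    - apply Rmult_le_pos; [specialize (Hv q); lra|lra].
    - apply Rmult_le_compat; [specialize (Hv q); lra|lra| |exact P].
      assert (v q <= c)%R; [|lra]. unfold v. rewrite <- (Rmult_1_r c) at 2. apply Rmult_le_compat_l; lra. }
  assert (B2 : (v q * Q <= c * m * ((1 + c) * W))%R).
  { apply Rmult_le_compat; [apply Hv|lra| |].
    - apply Rmult_le_compat_l; lra.
    - assert (0 < W)%R by apply exp_pos. assert (0 <= c * W)%R by (apply Rmult_le_pos; lra). lra. }
  assert (B3 : (m <= 2 * (/ INR (S N) - / INR (S (S N))))%R).
  { eapply Rle_trans; [apply inv_sq_nat_le|]. unfold Rdiv. lra. }
  assert (HW : (0 <= c * ((1 + c) * W))%R).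
  { apply Rmult_le_pos; [exact Hc|]. apply Rmult_le_pos; [lra|left; apply exp_pos]. }
  apply (Rmult_le_compat_l _ _ _ HW) in B3.
  eapply Rle_trans; [apply Rplus_le_compat; [exact I1|exact I2]|].
  eapply Rle_trans; [apply Rplus_le_compat; [exact B1|exact B2]|].
  fold p in B3 |- *. lra.
Qed.

(* The value of em at the predecessor of x, where the predecessor of the first point x = 1 gets
   the value making em - emm equal to 1 there. *)
Definition emm (K : nat) (a : C) (x : R) : C :=
  if Req_EM_T x 1 then em K a 1%R - RtoC 1 else em K a (x - 1)%R.

Lemma emm_ne K a x : x <> 1%R -> emm K a x = em K a (x - 1)%R.
Proof. intros H. unfold emm. now destruct (Req_EM_T x 1). Qed.

Lemma emm_1 K a : emm K a 1%R = em K a 1%R - RtoC 1.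
Proof. unfold emm. now destruct (Req_EM_T 1 1). Qed.

Lemma emm_INR K a n : emm K a (INR (S (S n))) = em K a (INR (S n)).
Proof.
  rewrite emm_ne.
  - f_equal. rewrite (S_INR (S n)). ring.
  - rewrite !S_INR. pose proof (pos_INR n). lra.
Qed.

(** Kept general in [h] and [hm]: it serves the interpolating functions here and the polynomials in
    the sums up to p. *)
Lemma chain_pos (h hm : R -> C) n : (forall n, hm (INR (S (S n))) = h (INR (S n))) -> forall k,
  chain h hm (hm (INR (S k))) (map INR (seq (S k) n)) /\
  lastv h (hm (INR (S k))) (map INR (seq (S k) n)) = hm (INR (S (k + n))).
Proof.
  intros Hh. induction n as [|n IH]; intros k.
  - simpl seq. cbn [map chain lastv]. now rewrite Nat.add_0_r.
  - cbn [seq map chain lastv]. destruct (IH (S k)) as [H1 H2].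
    rewrite Hh in H1, H2. rewrite H2. split; [split; [reflexivity|exact H1]|].
    do 2 f_equal. lia.
Qed.

Lemma chain_neg K a t n : (t <= 0)%R ->
  chain (em K a) (emm K a) (em K a (t - INR (S n))%R) (map (fun n => (t - INR n)%R) (rev (seq 1 n))) /\
  lastv (em K a) (em K a (t - INR (S n))%R) (map (fun n => (t - INR n)%R) (rev (seq 1 n))) = em K a (t - 1)%R.
Proof.
  intros Ht. induction n as [|n [IH1 IH2]].
  - simpl. auto.
  - rewrite seq_S, rev_app_distr. change (1 + n)%nat with (S n). cbn [rev app map chain lastv].
    split; [|exact IH2]. split; [|exact IH1]. rewrite emm_ne.
    + f_equal. rewrite (S_INR (S n)). ring.
    + rewrite S_INR. pose proof (pos_INR n). lra.
Qed.

Definition lift {Y Z : Type} (w : Y -> Z) (c : Z) (o : option Y) : Z :=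
  match o with Some x => w x | None => c end.

Lemma chain_map {X Y} (g : Y -> X) h hm xs : forall c,
  chain (fun y => h (g y)) (fun y => hm (g y)) c xs -> chain h hm c (map g xs).
Proof. induction xs as [|x xs IH]; intros c; simpl; [easy|]. intros [H1 H2]. auto. Qed.

Lemma lastv_map {X Y} (g : Y -> X) (h : X -> C) xs : forall c,
  lastv h c (map g xs) = lastv (fun y => h (g y)) c xs.
Proof. induction xs as [|x xs IH]; intros c; simpl; auto. Qed.

(* None stands for the jump from N-1 to t-(N-1), "through infinity". *)
Definition XJ (t : R) (N : nat) : list (option R) := map Some (Xpos N) ++ None :: map Some (Xneg t N).
Definition hJ K a t N := lift (em K a) (em K a (t - INR N)%R).
Definition hmJ K a N := lift (emm K a) (emm K a (INR N)).

Lemma chain_XJ K a t N : (t <= 0)%R ->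
  chain (hJ K a t (S N)) (hmJ K a (S N)) (em K a 1%R - RtoC 1) (XJ t (S N)) /\
  lastv (hJ K a t (S N)) (em K a 1%R - RtoC 1) (XJ t (S N)) = em K a (t - 1)%R.
Proof.
  intros Ht. unfold XJ. rewrite lastv_app. rewrite <- emm_1.
  destruct (chain_pos (em K a) (emm K a) N (emm_INR K a) 0) as [P1 P2]. destruct (chain_neg K a t N Ht) as [N1 N2].
  assert (EP : lastv (hJ K a t (S N)) (emm K a 1%R) (map Some (Xpos (S N))) = emm K a (INR (S N))).
  { rewrite lastv_map. unfold Xpos. replace (S N - 1)%nat with N by lia. exact P2. }
  split.
  - apply chain_app.
    + apply chain_map. unfold Xpos. replace (S N - 1)%nat with N by lia. exact P1.
    + rewrite EP. cbn [chain]. split; [reflexivity|]. apply chain_map.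
      unfold Xneg. replace (S N - 1)%nat with N by lia. exact N1.
  - rewrite EP. cbn [lastv]. rewrite lastv_map. unfold Xneg. replace (S N - 1)%nat with N by lia. exact N2.
Qed.

(** The other factors vanish at the jump, so only the factor being summed can sit there. *)
Definition lift_zero : list (R -> C) -> list (option R -> C) := map (fun w => lift w (RtoC 0)).

Lemma nest_XJ t N fs : nest (lift_zero fs) (XJ t N) = nest fs (Xs t N).
Proof.
  unfold XJ, Xs. rewrite nest_drop.
  - rewrite <- map_app, nest_map. unfold lift_zero. rewrite map_map. f_equal.
    rewrite <- map_id. apply map_ext. reflexivity.
  - unfold lift_zero. apply Forall_map, List.Forall_forall. reflexivity.
Qed.

Lemma nest_XJ' t N fs gs :
  Forall2 (fun f (g : option R -> C) => (forall x, g (Some x) = f x) /\ g None = RtoC 0) fs gs ->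
  nest gs (XJ t N) = nest fs (Xs t N).
Proof.
  intros H. rewrite <- nest_XJ. apply nest_ext. unfold lift_zero.
  induction H as [|f g fs gs [H1 H2] H IH]; constructor; [|exact IH].
  intros [x|] _; simpl; auto.
Qed.

(** The two end values belong to the outer boundary points: [em] at t - 1 is the predecessor value
    of t, and [em] at 1, minus 1, replaces the singular value at 0. *)
Definition bd K a t N pre post : C :=
  boundary_terms (em K a) (emm K a) (em K a (t - 1)%R) (em K a 1%R - RtoC 1) pre post (Xs t N).

Definition jump_diff K a t N (o : option R) : C := hJ K a t N o - hmJ K a N o.

Lemma Forall2_lift0 fs :
  Forall2 (fun (f : R -> C) (g : option R -> C) => (forall x, g (Some x) = f x) /\ g None = RtoC 0) fs (lift_zero fs).
Proof. induction fs; constructor; auto. Qed.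

(** With the jump included the chain is unbroken and Abel summation is exact for every a. The
    boundary terms no longer see the jump, since the absorbing factors vanish there. *)
Lemma nest_gJ K a t N pre post : (t <= 0)%R ->
  nest (lift_zero pre ++ jump_diff K a t (S N) :: lift_zero post) (XJ t (S N)) = bd K a t (S N) pre post.
Proof.
  intros Ht. destruct (chain_XJ K a t N Ht) as [H1 H2].
  unfold jump_diff. rewrite (abel_summation _ _ _ _ _ _ H1), H2. unfold bd, boundary_terms. f_equal; [|f_equal].
  - destruct post as [|f post]; cbn [lift_zero map absorb_right]; [now rewrite nest_XJ|].
    apply nest_XJ'. apply Forall2_app; [apply Forall2_lift0|]. constructor; [|apply Forall2_lift0].
    split; [reflexivity|]. simpl. ring.
  - unfold lift_zero at 1. rewrite <- map_rev. destruct (rev pre) as [|e rpre]; cbn [map]; [now rewrite nest_XJ|].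
    apply nest_XJ'. rewrite <- map_rev. apply Forall2_app; [apply Forall2_lift0|].
    constructor; [|apply Forall2_lift0]. split; [reflexivity|]. simpl. ring.
Qed.

Definition em_defect K a x : C := em K a x - emm K a x - pw (a - RtoC 1) x.

Lemma pw_at_1 a : pw a 1%R = RtoC 1.
Proof.
  unfold pw. rewrite ell_pos by lra. rewrite ln_1.
  replace (a * (0%R, 0%R)) with (RtoC 0) by (apply injective_projections; simpl; ring).
  apply Cexp_0.
Qed.

Lemma em_defect_1 K a : em_defect K a 1%R = RtoC 0.
Proof. unfold em_defect. rewrite emm_1, pw_at_1. ring. Qed.

Lemma em_defect_ne K a x : x <> 1%R -> em_defect K a x = em_rem K a x.
Proof. intros H. unfold em_defect, em_rem. now rewrite emm_ne. Qed.

(* An approximation of the truncated sum with exponent z between pre and post that converges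
   also where the sum itself diverges. *)
Definition Phi K t N pre post (z : C) : C :=
  bd K (RtoC 1 - z) t N pre post - nest (pre ++ em_defect K (RtoC 1 - z) :: post) (Xs t N).

(** On the right stands the same nested sum without and with the jump point, so the error of [Phi]
    is exactly the contribution of the jump. *)
Lemma nest_minus_Phi K t N pre post z : (t <= 0)%R ->
  nest (pre ++ Wt z :: post) (Xs t (S N)) - Phi K t (S N) pre post z =
  nest (pre ++ (fun x => em K (RtoC 1 - z) x - emm K (RtoC 1 - z) x) :: post) (Xs t (S N)) -
  nest (lift_zero pre ++ jump_diff K (RtoC 1 - z) t (S N) :: lift_zero post) (XJ t (S N)).
Proof.
  intros Ht. rewrite nest_gJ by assumption. unfold Phi.
  rewrite (nest_ext_mid (fun x => em K (RtoC 1 - z) x - emm K (RtoC 1 - z) x) (fun x => Wt z x + em_defect K (RtoC 1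
    - z) x)).
  - rewrite nest_plus. ring.
  - intros x _. unfold em_defect, Wt. replace (RtoC 1 - z - RtoC 1) with (- z) by ring. ring.
Qed.

Lemma entire_emm K x : entire (fun a => emm K a x).
Proof.
  unfold emm. destruct (Req_EM_T x 1); entire_tac; auto using entire_em.
Qed.

Lemma entire_em_defect K x : entire (fun a => em_defect K a x).
Proof.
  unfold em_defect. apply entire_minus; [entire_tac; auto using entire_em, entire_emm|].
  apply (entire_comp (fun b => pw b x) (fun a => a - RtoC 1)); [apply entire_pw|entire_tac].
Qed.

Lemma entire_nest_mid {X} (F : C -> X -> C) pre post (xs : list X) :
  (forall x, entire (fun z => F z x)) -> entire (fun z => nest (pre ++ F z :: post) xs).
Proof.
  intros HF.
  apply (entire_ext (fun z => nest (map (fun f : C -> X -> C => f z) (map (fun w _ => w) pre ++ F ::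
    map (fun w _ => w) post)) xs)).
  - intros z. rewrite map_app. cbn [map]. rewrite !map_map, !map_id. reflexivity.
  - apply entire_nest. intros f Hf x _. apply in_app_iff in Hf. cbn [In] in Hf.
    destruct Hf as [Hf|[<-|Hf]]; [|apply HF|]; apply in_map_iff in Hf; destruct Hf as [w [<- _]]; apply entire_const.
Qed.

Lemma entire_Phi K t N pre post : entire (Phi K t N pre post).
Proof.
  assert (A : entire (fun z => RtoC 1 - z)) by entire_tac.
  apply (entire_comp (fun a => bd K a t N pre post - nest (pre ++ em_defect K a ::
    post) (Xs t N)) (fun z => RtoC 1 - z)); [|exact A].
  apply entire_minus; [|apply entire_nest_mid; intros; apply entire_em_defect].
  unfold bd, boundary_terms. apply entire_minus.
  - destruct post as [|f post]; unfold absorb_right.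
    + entire_tac; auto using entire_em.
    + apply (entire_nest_mid (fun a x => f x * emm K a x)). intros x. entire_tac; auto using entire_emm.
  - destruct (rev pre) as [|e rpre].
    + entire_tac; auto using entire_em.
    + apply (entire_nest_mid (fun a x => e x * em K a x)). intros x. entire_tac; auto using entire_em.
Qed.

Lemma abs_pred x : good x -> x <> 1%R -> (1 <= Rabs (x - 1) <= 2 * Rabs x)%R.
Proof.
  intros [H|[H|H]] H1; [contradiction| |].
  - rewrite !Rabs_pos_eq by lra. lra.
  - rewrite !Rabs_left by lra. lra.
Qed.

Lemma emm_growth K r : (0 <= r)%R -> exists D, (0 <= D)%R /\ forall a x, (Cmod a <= r)%R -> good x ->
  (Cmod (emm K a x) <= D * exp ((r + INR K + 1) * ln (Rabs x)))%R.
Proof.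
  intros Hr. destruct (em_growth K r Hr) as [D [HD H]]. pose proof (pos_INR K) as HK.
  set (p := (r + INR K + 1)%R) in *.
  (* exp (p ln 2) accounts for |x - 1| <= 2 |x|, and 1 for the special value at x = 1. *)
  exists (D * exp (p * ln 2) + 1)%R. pose proof (exp_pos (p * ln 2)) as Hp. split; [nra|].
  intros a x Ha Hx. pose proof (good_abs x Hx) as Hx1. pose proof (ln_Rabs_nonneg x Hx1) as Hl.
  assert (Hln2 : (0 < ln 2)%R) by (rewrite <- ln_1; apply ln_increasing; lra).
  assert (HE : (1 <= exp (p * ln (Rabs x)))%R) by (rewrite <- exp_0; apply exp_le; unfold p; nra).
  assert (HE2 : (1 <= exp (p * ln 2))%R) by (rewrite <- exp_0; apply exp_le; unfold p; nra).
  destruct (Req_EM_T x 1) as [->|Hne].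
  - rewrite emm_1. eapply Rle_trans; [apply Cmod_triangle|]. rewrite Cmod_opp, Cmod_1.
    pose proof (H a 1%R Ha Hx1) as H1. set (E := exp (p * ln (Rabs 1))) in *.
    assert (0 <= D * E)%R by (apply Rmult_le_pos; lra). nra.
  - rewrite emm_ne by assumption. destruct (abs_pred x Hx Hne) as [A1 A2].
    eapply Rle_trans; [apply (H a (x - 1)%R Ha A1)|].
    rewrite Rmult_plus_distr_r, Rmult_assoc, <- exp_plus.
    apply Rle_trans with (D * exp (p * ln 2 + p * ln (Rabs x)))%R; [|lra].
    apply Rmult_le_compat_l; [exact HD|]. apply exp_le. rewrite <- Rmult_plus_distr_l.
    apply Rmult_le_compat_l; [unfold p; lra|]. rewrite <- ln_mult by lra.
    destruct A2 as [A2|A2]; [left; apply ln_increasing; lra|right; now rewrite A2].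
Qed.

(** Decay that leaves a summable function after multiplication by anything growing like |x|^p;
    neighbours need it because they absorb values of [em]. *)
Definition fast (p c : R) (f : R -> C) : Prop :=
  forall x, good x -> (Cmod (f x) * exp (p * ln (Rabs x)) <= c * inv_sq x)%R.

Lemma summable_weaken c c' f : (c <= c')%R -> summable c f -> summable c' f.
Proof.
  intros H Hf x Hx. eapply Rle_trans; [now apply Hf|]. apply Rmult_le_compat_r; [left; apply inv_sq_pos|exact H].
Qed.

Lemma fast_summable p c f : (0 <= p)%R -> fast p c f -> summable c f.
Proof.
  intros Hp H x Hx. eapply Rle_trans; [|now apply H]. rewrite <- (Rmult_1_r (Cmod (f x))) at 1.
  apply Rmult_le_compat_l; [apply Cmod_ge_0|]. rewrite <- exp_0. apply exp_le.
  apply Rmult_le_pos; [exact Hp|]. now apply ln_Rabs_nonneg, good_abs.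
Qed.

Lemma fast_mult p c D (f h : R -> C) : (0 <= D)%R -> fast p c f ->
  (forall x, good x -> (Cmod (h x) <= D * exp (p * ln (Rabs x)))%R) -> summable (D * c) (fun x => f x * h x).
Proof.
  intros HD Hf Hh x Hx. rewrite Cmod_mult. specialize (Hf x Hx). specialize (Hh x Hx).
  eapply Rle_trans; [apply Rmult_le_compat_l; [apply Cmod_ge_0|exact Hh]|].
  replace (Cmod (f x) * (D * exp (p * ln (Rabs x))))%R with (D * (Cmod (f x) * exp (p * ln (Rabs x))))%R by ring.
  rewrite Rmult_assoc. now apply Rmult_le_compat_l.
Qed.

Lemma Wt_fast s p : (p + 2 <= fst s)%R -> fast p (exp (PI * Rabs (snd s))) (Wt s).
Proof.
  intros Hs x Hx. apply good_abs, ln_Rabs_nonneg in Hx. unfold Wt, inv_sq.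
  eapply Rle_trans; [apply Rmult_le_compat_r; [left; apply exp_pos|apply Cmod_pw]|].
  replace (snd (- s)) with (- snd s)%R by reflexivity. rewrite Rabs_Ropp, Rmult_assoc, <- exp_plus.
  apply Rmult_le_compat_l; [left; apply exp_pos|]. apply exp_le. simpl. nra.
Qed.

Lemma Wt_fast_all (ss : list C) p : List.Forall (fun s => (p + 2 <= fst s)%R) ss ->
  exists c, (0 <= c)%R /\ List.Forall (fast p c) (map Wt ss).
Proof.
  induction 1 as [|s ss Hs _ [c [Hc IH]]]; [exists 0%R; split; [lra|constructor]|].
  exists (Rmax c (exp (PI * Rabs (snd s)))). split; [eapply Rle_trans; [exact Hc|apply Rmax_l]|].
  constructor.
  - intros x Hx. eapply Rle_trans; [now apply (Wt_fast s p Hs)|].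
    apply Rmult_le_compat_r; [left; apply inv_sq_pos|apply Rmax_r].
  - eapply List.Forall_impl; [|exact IH]. intros f Hf x Hx. eapply Rle_trans; [now apply Hf|].
    apply Rmult_le_compat_r; [left; apply inv_sq_pos|apply Rmax_l].
Qed.

Lemma em_defect_summable K r : (1 <= K)%nat -> (0 <= r)%R -> (r + 1 <= INR K)%R ->
  exists D, (0 <= D)%R /\ forall a, (Cmod a <= r)%R -> summable D (em_defect K a).
Proof.
  intros HK Hr HrK. destruct (em_rem_decay K r HK Hr HrK) as [D [HD H]]. exists D. split; [exact HD|].
  intros a Ha x Hx. destruct (Req_EM_T x 1) as [->|Hne].
  - rewrite em_defect_1, Cmod_0. apply Rmult_le_pos; [exact HD|left; apply inv_sq_pos].
  - rewrite em_defect_ne by assumption. apply H; [exact Ha|]. destruct Hx as [Hx|Hx]; [contradiction|exact Hx].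
Qed.

Definition tele (N : nat) : R := (/ INR (S N) - / INR (S (S N)))%R.

(* The increments are dominated by a telescoping series, so the same D for all z in a set gives
   uniform convergence on that set. *)
Definition tame (D : R) (A : nat -> C) : Prop :=
  (0 <= D)%R /\ (forall N, (Cmod (A N) <= D)%R) /\ (forall N, (Cmod (A (S (S N)) - A (S N)) <= D * tele N)%R).

Lemma tele_nonneg N : (0 <= tele N)%R.
Proof.
  unfold tele. pose proof (INR_S_pos N) as H.
  assert (/ INR (S (S N)) <= / INR (S N))%R; [|lra]. apply Rinv_le_contravar; [exact H|]. apply le_INR. lia.
Qed.

Lemma tame_weaken D D' A : (D <= D')%R -> tame D A -> tame D' A.
Proof.
  intros H [H0 [H1 H2]]. split; [lra|]. split; intros N.
  - eapply Rle_trans; [apply H1|exact H].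
  - eapply Rle_trans; [apply H2|]. apply Rmult_le_compat_r; [apply tele_nonneg|exact H].
Qed.

Lemma tame_scal u B D A : (Cmod u <= B)%R -> tame D A -> tame (B * D) (fun N => u * A N).
Proof.
  intros Hu [H0 [H1 H2]]. pose proof (Cmod_ge_0 u). split; [apply Rmult_le_pos; lra|]. split; intros N.
  - rewrite Cmod_mult. apply Rmult_le_compat; auto using Cmod_ge_0.
  - replace (u * A (S (S N)) - u * A (S N)) with (u * (A (S (S N)) - A (S N))) by ring.
    rewrite Cmod_mult, Rmult_assoc. apply Rmult_le_compat; auto using Cmod_ge_0.
Qed.

Lemma tame_plus D D' A A' : tame D A -> tame D' A' -> tame (D + D') (fun N => A N + A' N).
Proof.
  intros [H0 [H1 H2]] [H0' [H1' H2']]. split; [lra|]. split; intros N.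
  - eapply Rle_trans; [apply Cmod_triangle|]. now apply Rplus_le_compat.
  - replace (_ - _) with ((A (S (S N)) - A (S N)) + (A' (S (S N)) - A' (S N))) by ring.
    eapply Rle_trans; [apply Cmod_triangle|]. rewrite Rmult_plus_distr_r. now apply Rplus_le_compat.
Qed.

Lemma tame_minus D D' A A' : tame D A -> tame D' A' -> tame (D + D') (fun N => A N - A' N).
Proof.
  intros HA [H0' [H1' H2']]. apply (tame_plus D D' A (fun N => - A' N) HA).
  split; [exact H0'|]. split; intros N; [now rewrite Cmod_opp|].
  replace (_ - _) with (- (A' (S (S N)) - A' (S N))) by ring. now rewrite Cmod_opp.
Qed.

Lemma tame_nest c t fs : (0 <= c)%R -> (t <= 0)%R -> List.Forall (summable c) fs ->
  tame (exp (4 * c) + 4 * c * (1 + c) * exp (4 * c)) (fun N => nest fs (Xs t N)).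
Proof.
  intros Hc Ht H. pose proof (exp_pos (4 * c)) as HE.
  assert (HS : (0 <= 4 * c * (1 + c) * exp (4 * c))%R) by (repeat apply Rmult_le_pos; lra).
  split; [lra|]. split; intros N.
  - eapply Rle_trans; [exact (nest_Xs_bound c t N fs Hc Ht H)|lra].
  - eapply Rle_trans; [exact (nest_Xs_step c t N fs Hc Ht H)|]. apply Rmult_le_compat_r; [apply tele_nonneg|lra].
Qed.

Lemma Forall_mid {X} (P : X -> Prop) pre f post :
  List.Forall P pre -> P f -> List.Forall P post -> List.Forall P (pre ++ f :: post).
Proof. intros H1 H2 H3. apply Forall_app. split; [exact H1|]. now constructor. Qed.

(** The boundary terms are controlled by the decay of the neighbours and the defect by its own
    decay, so D is uniform on the whole disc, including exponents at which the original sum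
    diverges. *)
Lemma Phi_tame K r t c pre post :
  (1 <= K)%nat -> (0 <= r)%R -> (r + 2 <= INR K)%R -> (t <= 0)%R -> (0 <= c)%R ->
  List.Forall (fast (r + 1 + INR K + 1) c) pre -> List.Forall (fast (r + 1 + INR K + 1) c) post ->
  exists D, forall z, (Cmod z <= r)%R -> tame D (fun N => Phi K t N pre post z).
Proof.
  intros HK Hr HrK Ht Hc Hpre Hpost. set (p := (r + 1 + INR K + 1)%R) in *.
  assert (Hp : (0 <= p)%R) by (unfold p; lra).
  destruct (em_growth K (r + 1)) as [D1 [HD1 H1]]; [lra|]. fold p in H1.
  destruct (emm_growth K (r + 1)) as [D2 [HD2 H2]]; [lra|]. fold p in H2.
  destruct (em_defect_summable K (r + 1)) as [D3 [HD3 H3]]; [exact HK|lra|lra|].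
  set (q := (c + D1 * c + D2 * c + D3)%R).
  assert (0 <= D1 * c)%R by now apply Rmult_le_pos. assert (0 <= D2 * c)%R by now apply Rmult_le_pos.
  assert (Hq : (0 <= q)%R) by (unfold q; lra).
  set (T := (exp (4 * q) + 4 * q * (1 + q) * exp (4 * q))%R).
  assert (HT : forall fs, List.Forall (summable q) fs -> tame T (fun N => nest fs (Xs t N)))
    by (intros; now apply tame_nest).
  assert (HT0 : (0 <= T)%R) by (apply (HT []); constructor).
  assert (Hsum : forall fs, List.Forall (fast p c) fs -> List.Forall (summable q) fs).
  { intros fs Hfs. eapply List.Forall_impl; [|exact Hfs]. intros f Hf.
    apply (summable_weaken c); [unfold q; lra|]. now apply (fast_summable p). }
  pose proof (Hsum _ Hpre) as Spre. pose proof (Hsum _ Hpost) as Spost.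
  set (B := (D1 * exp (p * ln (Rabs (t - 1))))%R).
  assert (HB : (0 <= B)%R) by (apply Rmult_le_pos; [exact HD1|left; apply exp_pos]).
  exists ((B + 1) * T + (D1 + 1 + 1) * T + T)%R. intros z Hz.
  set (a := RtoC 1 - z).
  assert (Ha : (Cmod a <= r + 1)%R).
  { unfold a. eapply Rle_trans; [apply Cmod_triangle|]. rewrite Cmod_opp, Cmod_1. lra. }
  unfold Phi, bd, boundary_terms. fold a. apply tame_minus; [apply tame_minus|].
  - destruct post as [|f post]; unfold absorb_right.
    + apply (tame_weaken (B * T)); [nra|]. apply tame_scal; [|now apply HT].
      apply H1; [exact Ha|]. rewrite Rabs_left by lra. lra.
    + apply (tame_weaken T); [nra|]. apply HT.
      inversion Hpost as [|? ? Hf _]; subst. inversion Spost as [|? ? _ Spost']; subst.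
      apply Forall_mid; [exact Spre| |exact Spost'].
      apply (summable_weaken (D2 * c)); [unfold q; lra|]. apply (fast_mult p c D2 f (emm K a)); auto.
  - assert (Hr1 : List.Forall (fast p c) (rev pre)) by now apply Forall_rev.
    destruct (rev pre) as [|e rpre].
    + apply (tame_weaken ((D1 + 1) * T)); [nra|]. apply tame_scal; [|now apply HT].
      eapply Rle_trans; [apply Cmod_triangle|]. rewrite Cmod_opp, Cmod_1. apply Rplus_le_compat_r.
      pose proof (H1 a 1%R Ha) as H4. rewrite Rabs_R1, ln_1, Rmult_0_r, exp_0 in H4. specialize (H4 ltac:(lra)). lra.
    + apply (tame_weaken T); [nra|]. apply HT. inversion Hr1 as [|? ? He Hr2]; subst.
      apply Forall_mid; [apply Forall_rev; now apply Hsum| |exact Spost].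
      apply (summable_weaken (D1 * c)); [unfold q; lra|]. apply (fast_mult p c D1 e (em K a)); auto.
      intros x Hx. apply H1; [exact Ha|now apply good_abs].
  - apply HT. apply Forall_mid; [exact Spre| |exact Spost].
    apply (summable_weaken D3); [unfold q; lra|]. now apply H3.
Qed.

(** For Re a <= -1 all powers that occur are O(1/|x|); the constant - 1/a in [em_term a 0] is not
    small but cancels in the difference. *)
Lemma em_term_difference i a : (fst a <= -1)%R -> exists D, (0 <= D)%R /\ forall x y,
  (1 <= Rabs x)%R -> (1 <= Rabs y)%R ->
  (Cmod (em_term a i x - em_term a i y) <= D * (/ Rabs x + / Rabs y))%R.
Proof.
  intros Ha.
  assert (Hpw : forall b, (fst b <= -1)%R -> forall x, (1 <= Rabs x)%R ->
     (Cmod (pw b x) <= exp (PI * Rabs (snd b)) * / Rabs x)%R).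
  { intros b Hb x Hx. eapply Rle_trans; [apply Cmod_pw|]. apply Rmult_le_compat_l; [left; apply exp_pos|].
    rewrite <- (exp_ln (/ Rabs x)) by (apply Rinv_0_lt_compat; lra). apply exp_le. rewrite ln_Rinv by lra.
    pose proof (ln_Rabs_nonneg x Hx). nra. }
  destruct i as [|n].
  - assert (Ha0 : a <> RtoC 0) by (intros ->; simpl in Ha; lra).
    assert (Hm : (0 < Cmod a)%R) by now apply Cmod_gt_0.
    exists (/ Cmod a * exp (PI * Rabs (snd a)))%R. split.
    { apply Rmult_le_pos; [left; now apply Rinv_0_lt_compat|left; apply exp_pos]. }
    intros x y Hx Hy.
    replace (em_term a 0 x - em_term a 0 y) with (/ a * (a * em_term a 0 x - a * em_term a 0 y)) by (now field).
    rewrite !em_term_0_mult, Cmod_mult, Cmod_inv, Rmult_assoc by assumption.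
    apply Rmult_le_compat_l; [left; now apply Rinv_0_lt_compat|].
    replace (pw a x - RtoC 1 - (pw a y - RtoC 1)) with (pw a x + - pw a y) by ring.
    eapply Rle_trans; [apply Cmod_triangle|]. rewrite Cmod_opp, Rmult_plus_distr_l.
    apply Rplus_le_compat; now apply Hpw.
  - set (b := a - RtoC 1 - RtoC (INR n)).
    assert (Hb : (fst b <= -1)%R) by (unfold b; simpl; pose proof (pos_INR n); lra).
    exists (Cmod (fall n (a - RtoC 1)) * exp (PI * Rabs (snd b)))%R. split.
    { apply Rmult_le_pos; [apply Cmod_ge_0|left; apply exp_pos]. }
    intros x y Hx Hy. unfold em_term. fold b.
    replace (fall n (a - RtoC 1) * pw b x - fall n (a - RtoC 1) * pw b y) with (fall n (a - RtoC 1) * (pw b x + - pw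
      b y)) by ring.
    rewrite Cmod_mult, Rmult_assoc. apply Rmult_le_compat_l; [apply Cmod_ge_0|].
    eapply Rle_trans; [apply Cmod_triangle|]. rewrite Cmod_opp, Rmult_plus_distr_l.
    apply Rplus_le_compat; now apply Hpw.
Qed.

Lemma em_difference K a : (fst a <= -1)%R -> exists D, (0 <= D)%R /\ forall x y,
  (1 <= Rabs x)%R -> (1 <= Rabs y)%R -> (Cmod (em K a x - em K a y) <= D * (/ Rabs x + / Rabs y))%R.
Proof.
  intros Ha. unfold em. induction (seq 0 (S K)) as [|i l [D1 [HD1 IH]]].
  - exists 0%R. split; [lra|]. intros. rewrite !csum_nil. replace (RtoC 0 - RtoC 0) with (RtoC 0) by ring.
    rewrite Cmod_0. lra.
  - destruct (em_term_difference i a Ha) as [D2 [HD2 H2]].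
    exists (Cmod (Q2C (beta i)) * D2 + D1)%R. pose proof (Cmod_ge_0 (Q2C (beta i))). split; [nra|].
    intros x y Hx Hy. rewrite !csum_cons.
    match goal with |- (Cmod (?p * ?u + ?v - (?p * ?u' + ?v')) <= _)%R =>
      replace (p * u + v - (p * u' + v')) with (p * (u - u') + (v - v')) by ring end.
    eapply Rle_trans; [apply Cmod_triangle|]. rewrite Rmult_plus_distr_r, Cmod_mult, Rmult_assoc.
    apply Rplus_le_compat; [|now apply IH]. apply Rmult_le_compat_l; [assumption|]. now apply H2.
Qed.

(** [em] tends to the same limit at both ends of the real line, so the jump closes up at the rate
    1/N. *)
Lemma junction_small K a t : (t <= 0)%R -> (fst a <= -1)%R -> exists D, (0 <= D)%R /\ forall N,
  (Cmod (jump_diff K a t (S (S N)) None) <= D * / INR (S N))%R.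
Proof.
  intros Ht Ha. destruct (em_difference K a Ha) as [D [HD H]]. exists (2 * D)%R. split; [lra|].
  intros N. unfold jump_diff, hJ, hmJ, lift. rewrite emm_INR.
  pose proof (good_abs _ (good_neg t (S N) Ht)) as G1. pose proof (good_abs _ (good_INR N)) as G2.
  eapply Rle_trans; [now apply H|].
  pose proof (INR_S_pos N) as HN.
  rewrite (Rabs_pos_eq (INR (S N))) by lra.
  assert (/ Rabs (t - INR (S (S N))) <= / INR (S N))%R.
  { apply Rinv_le_contravar; [exact HN|]. rewrite (S_INR (S N)) in *. rewrite Rabs_left by lra. lra. }
  nra.
Qed.

Lemma nest_minus_Phi_small K t pre post (z : C) c : (1 <= K)%nat -> (t <= 0)%R -> (2 <= fst z)%R ->
  (Cmod z + 2 <= INR K)%R -> (0 <= c)%R ->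
  List.Forall (summable c) pre -> List.Forall (summable c) post ->
  forall eps, (0 < eps)%R -> exists N0, forall N, (N0 <= N)%nat ->
  (Cmod (nest (pre ++ Wt z :: post) (Xs t N) - Phi K t N pre post z) <= eps)%R.
Proof.
  intros HK Ht Hz HzK Hc Hpre Hpost eps Heps. pose proof (Cmod_ge_0 z) as Hz0.
  set (a := RtoC 1 - z).
  assert (Ha : (Cmod a <= Cmod z + 1)%R).
  { unfold a. eapply Rle_trans; [apply Cmod_triangle|]. rewrite Cmod_opp, Cmod_1. lra. }
  destruct (em_defect_summable K (Cmod z + 1)) as [D3 [HD3 H3]]; [exact HK|lra|lra|].
  destruct (junction_small K a t Ht) as [D [HD HJ]]; [unfold a; simpl; lra|].
  set (w := exp (PI * Rabs (snd z))). assert (Hw : (0 < w)%R) by apply exp_pos.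
  set (q := (c + w + D3)%R). assert (Hq : (0 <= q)%R) by (unfold q; lra).
  set (g := fun x => em K a x - emm K a x).
  assert (Hg : summable q g).
  { intros x Hx. unfold g. replace (em K a x - emm K a x) with (Wt z x + em_defect K a x).
    2:{ unfold em_defect, Wt. replace (a - RtoC 1) with (- z) by (unfold a; ring). ring. }
    eapply Rle_trans; [apply Cmod_triangle|].
    pose proof (H3 a Ha x Hx) as H4.
    assert (H5 : (Cmod (Wt z x) <= w * inv_sq x)%R).
    { unfold Wt, w. rewrite <- (Rabs_Ropp (snd z)).
      apply (Cmod_pw_decay (- z)%C x); [now apply good_abs|simpl; lra]. }
    assert (0 <= c * inv_sq x)%R by (apply Rmult_le_pos; [exact Hc|left; apply inv_sq_pos]). unfold q. lra. }
  assert (Hup : forall fs, List.Forall (summable c) fs -> List.Forall (summable q) fs).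
  { intros fs Hfs. eapply List.Forall_impl; [|exact Hfs]. intros f. apply summable_weaken. unfold q; lra. }
  set (E := exp (4 * q)). assert (HE : (0 < E)%R) by apply exp_pos.
  destruct (INR_unbounded (D * E / eps)) as [n0 Hn0]. exists (S (S n0)). intros N HN.
  destruct N as [|[|N]]; [lia|lia|].
  rewrite nest_minus_Phi by assumption. fold a. change (fun x => em K a x - emm K a x) with g.
  (* At the formal point the majorant is the size of the jump itself, so inserting that point costs
     an error proportional to the jump. *)
  set (v := lift (fun x => q * inv_sq x)%R (Cmod (jump_diff K a t (S (S N)) None)) : option R -> R).
  set (fs := lift_zero pre ++ jump_diff K a t (S (S N)) :: lift_zero post).
  assert (Hdom : List.Forall (dominated v (XJ t (S (S N)))) fs).
  { assert (Hin : forall x, In (Some x) (XJ t (S (S N))) -> good x).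
    { intros x Hx. apply (Xs_good t (S (S N))); [exact Ht|]. unfold XJ in Hx. unfold Xs.
      apply in_app_iff in Hx. apply in_app_iff. destruct Hx as [Hx|[Hx|Hx]]; [left|discriminate|right];
        apply in_map_iff in Hx; destruct Hx as [y [Hy Hx]]; inversion Hy; now subst. }
    assert (Hl : forall ws, List.Forall (summable c) ws -> List.Forall (dominated v (XJ t (S (S N)))) (lift_zero ws)).
    { intros ws Hws. apply Forall_map. eapply List.Forall_impl; [|exact (Hup _ Hws)]. intros f Hf [x|] Ho.
      - apply Hf. now apply Hin.
      - simpl. rewrite Cmod_0. apply Cmod_ge_0. }
    apply Forall_mid; [now apply Hl| |now apply Hl]. intros [x|] Ho.
    - apply Hg. now apply Hin.
    - simpl. lra. }
  assert (Hv : forall o, (0 <= v o)%R).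
  { intros [x|]; [|apply Cmod_ge_0]. simpl. apply Rmult_le_pos; [exact Hq|left; apply inv_sq_pos]. }
  pose proof (nest_insert v None (map Some (Xpos (S (S N)))) (map Some (Xneg t (S (S N)))) Hv fs Hdom) as I.
  fold (XJ t (S (S N))) in I. rewrite <- map_app in I. fold (Xs t (S (S N))) in I.
  rewrite prodv_map, nest_map in I.
  assert (Efs : map (fun f y => f (Some y)) fs = pre ++ g :: post).
  { unfold fs. rewrite map_app. cbn [map]. unfold lift_zero. rewrite !map_map.
    transitivity (map (fun w => w) pre ++ g :: map (fun w => w) post); [reflexivity|now rewrite !map_id]. }
  rewrite Efs in I.
  replace (nest (pre ++ g :: post) (Xs t (S (S N))) - nest fs (XJ t (S (S N)))) with
    (- (nest fs (XJ t (S (S N))) - nest (pre ++ g :: post) (Xs t (S (S N))))) by ring.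
  rewrite Cmod_opp. eapply Rle_trans; [exact I|].
  pose proof (prodv_Xs q t (S (S N)) Hq Ht) as P. fold E in P. specialize (HJ N).
  change (prodv (fun y => v (Some y)) (Xs t (S (S N)))) with (prodv (fun x => q * inv_sq x)%R (Xs t (S (S N)))).
  change (v None) with (Cmod (jump_diff K a t (S (S N)) None)).
  assert (HN1 : (D * E / eps < INR (S N))%R).
  { eapply Rlt_le_trans; [exact Hn0|]. apply le_INR. lia. }
  pose proof (INR_S_pos N) as HSN.
  apply Rle_trans with (D * / INR (S N) * E)%R.
  - apply Rmult_le_compat; [apply Cmod_ge_0| |exact HJ|exact P].
    match goal with |- (0 <= prodv ?w ?l)%R => pose proof (prodv_ge_1 w l); assert (1 <= prodv w l)%R; [|lra] end.
    apply H. intros x. apply Rmult_le_pos; [exact Hq|left; apply inv_sq_pos].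
  - apply (Rmult_lt_compat_r (eps / INR (S N))) in HN1; [|now apply Rdiv_lt_0_compat].
    replace (D * E / eps * (eps / INR (S N)))%R with (D * / INR (S N) * E)%R in HN1 by (field; lra).
    replace (INR (S N) * (eps / INR (S N)))%R with eps in HN1 by (field; lra). lra.
Qed.

(** * Faulhaber polynomials and formal combinations *)

Definition peval (c : Qpoly) (x : C) : C := fold_right (fun a acc => Q2C a + x * acc) (RtoC 0) c.

Lemma peval_cons a c x : peval (a :: c) x = Q2C a + x * peval c x.
Proof. reflexivity. Qed.

Lemma Q2C_Qpoly_eval c q : Q2C (Qpoly_eval c q) = peval c (Q2C q).
Proof.
  induction c as [|a c IH]; [apply Q2C_0|]. rewrite peval_cons, <- IH, <- Q2C_mult, <- Q2C_plus. reflexivity.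
Qed.

Fixpoint padd (c d : Qpoly) : Qpoly :=
  match c, d with
  | [], _ => d
  | _, [] => c
  | a :: c', b :: d' => (a + b)%Q :: padd c' d'
  end.

Definition pscal (a : Q) (c : Qpoly) : Qpoly := map (Qmult a) c.

Fixpoint pmul (c d : Qpoly) : Qpoly :=
  match c with [] => [] | a :: c' => padd (pscal a d) (0%Q :: pmul c' d) end.

Lemma peval_padd c d x : peval (padd c d) x = peval c x + peval d x.
Proof.
  revert d; induction c as [|a c IH]; intros [|b d]; simpl padd; rewrite ?peval_cons, ?IH, ?Q2C_plus;
    unfold peval; simpl; ring.
Qed.

Lemma peval_pscal a c x : peval (pscal a c) x = Q2C a * peval c x.
Proof.
  induction c as [|b c IH]; [unfold peval; simpl; ring|]. change (pscal a (b :: c)) with ((a * b)%Q :: pscal a c).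
  rewrite !peval_cons, Q2C_mult, IH. ring.
Qed.

Lemma peval_pmul c d x : peval (pmul c d) x = peval c x * peval d x.
Proof.
  induction c as [|a c IH]; [unfold peval; simpl; ring|]. simpl pmul.
  rewrite peval_padd, peval_pscal, !peval_cons, IH, Q2C_0. ring.
Qed.

Lemma peval_const a x : peval [a] x = Q2C a.
Proof. rewrite peval_cons. unfold peval; simpl. ring. Qed.

Lemma peval_shift c : exists c', forall x, peval c' x = peval c (x - RtoC 1).
Proof.
  induction c as [|a c [c' IH]]; [exists []; reflexivity|].
  exists (padd [a] (pmul [(-1)%Q; 1%Q] c')). intros x.
  rewrite peval_padd, peval_pmul, peval_const, !peval_cons, IH.
  replace (Q2C (-1)) with (- RtoC 1) by (rewrite <- Q2C_1, <- Q2C_opp; reflexivity).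
  rewrite Q2C_1. unfold peval at 1; simpl. ring.
Qed.

(** At 0 the logarithm has only a default value, so agreement is claimed elsewhere. *)
Definition polynomial_on_nonzero (f : R -> C) : Prop :=
  exists c : Qpoly, forall x : R, x <> 0%R -> f x = peval c (RtoC x).

Lemma polynomial_plus f g : polynomial_on_nonzero f -> polynomial_on_nonzero g ->
  polynomial_on_nonzero (fun x => f x + g x).
Proof. intros [c Hc] [d Hd]. exists (padd c d). intros x Hx. now rewrite peval_padd, Hc, Hd. Qed.

Lemma polynomial_scal q f : polynomial_on_nonzero f -> polynomial_on_nonzero (fun x => Q2C q * f x).
Proof. intros [c Hc]. exists (pscal q c). intros x Hx. now rewrite peval_pscal, Hc. Qed.

Lemma polynomial_pow n : polynomial_on_nonzero (fun x => RtoC (x ^ n)).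
Proof.
  induction n as [|n [c Hc]].
  - exists [1%Q]. intros x _. rewrite peval_const, Q2C_1. reflexivity.
  - exists (0%Q :: c). intros x Hx. rewrite peval_cons, <- Hc, Q2C_0 by assumption. simpl. rewrite RtoC_mult. ring.
Qed.

Lemma polynomial_csum {I} (F : I -> R -> C) l : (forall i, In i l -> polynomial_on_nonzero (F i)) ->
  polynomial_on_nonzero (fun x => csum (fun i => F i x) l).
Proof.
  induction l as [|i l IH]; intros H.
  - exists []. reflexivity.
  - destruct (polynomial_plus (F i) (fun x => csum (fun i => F i x) l)) as [c Hc].
    + apply H; now left.
    + apply IH. intros; apply H; now right.
    + exists c. intros x Hx. now rewrite csum_cons, Hc.
Qed.

Lemma Q2C_inv_nat n : exists q, Q2C q = / RtoC (INR (S n)).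
Proof.
  exists (/ inject_Z (Z.of_nat (S n)))%Q. unfold Q2C. rewrite Q2R_inv.
  - rewrite Q2R_inject_Z, <- INR_IZR_INZ, RtoC_inv; [reflexivity|]. now apply not_0_INR.
  - intros H. unfold Qeq in H. simpl in H. lia.
Qed.

Lemma Q2C_inject_nat n : Q2C (inject_Z (Z.of_nat n)) = RtoC (INR n).
Proof. unfold Q2C. now rewrite Q2R_inject_Z, <- INR_IZR_INZ. Qed.

Lemma fall_rational n m : exists q, fall n (RtoC (INR m)) = Q2C q.
Proof.
  induction n as [|n [q IH]]; [exists 1%Q; now rewrite Q2C_1|].
  exists (q * (inject_Z (Z.of_nat m) - inject_Z (Z.of_nat n)))%Q. simpl fall.
  unfold Qminus. rewrite Q2C_mult, Q2C_plus, Q2C_opp, !Q2C_inject_nat, IH. reflexivity.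
Qed.

Lemma RtoC_INR_S m : RtoC (INR (S m)) - RtoC 1 = RtoC (INR m).
Proof. rewrite S_INR, RtoC_plus. ring. Qed.

(** At a = m + 1 the terms are rational multiples of x^(m+1) - 1 and of x^(m-n) with n <= m:
    Euler-Maclaurin specializes to Bernoulli's formula for sums of m-th powers. *)
Lemma em_polynomial m : polynomial_on_nonzero (em (S m) (RtoC (INR (S m)))).
Proof.
  apply (polynomial_csum (fun i x => Q2C (beta i) * em_term (RtoC (INR (S m))) i x)). intros i Hi.
  apply in_seq in Hi. apply polynomial_scal. destruct i as [|n].
  - destruct (Q2C_inv_nat m) as [q Hq].
    destruct (polynomial_scal q (fun x => RtoC (x ^ S m) + Q2C (-1))) as [c Hc].
    { apply polynomial_plus; [apply polynomial_pow|]. exists [(-1)%Q]. intros. now rewrite peval_const. }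
    assert (H0 : RtoC (INR (S m)) <> RtoC 0) by (intros E; apply RtoC_inj in E; revert E; now apply not_0_INR).
    exists c. intros x Hx. rewrite <- Hc, Hq by assumption.
    replace (Q2C (-1)) with (- RtoC 1) by (rewrite <- Q2C_1, <- Q2C_opp; reflexivity).
    rewrite <- pw_nat by assumption.
    pose proof (em_term_0_mult (RtoC (INR (S m))) x) as E.
    replace (pw (RtoC (INR (S m))) x + - RtoC 1) with (RtoC (INR (S m)) * em_term (RtoC (INR (S m))) 0 x) by
      (rewrite E; ring).
    now field.
  - destruct (fall_rational n m) as [q Hq]. destruct (polynomial_scal q _ (polynomial_pow (m - n))) as [c Hc].
    exists c. intros x Hx. rewrite <- Hc by assumption. unfold em_term. rewrite RtoC_INR_S, Hq. f_equal.
    rewrite <- pw_nat by assumption. f_equal. rewrite minus_INR, RtoC_minus by lia. reflexivity.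
Qed.

(** K has to grow with the disc of exponents, whereas the polynomial must be fixed in advance; the
    additional terms contain a vanishing falling factorial. *)
Lemma em_stable m K x : (S m <= K)%nat -> em K (RtoC (INR (S m))) x = em (S m) (RtoC (INR (S m))) x.
Proof.
  intros H. induction H as [|K H IH]; [reflexivity|]. rewrite <- IH. unfold em. rewrite (csum_seq_S _ 0 (S K)).
  change (0 + S K)%nat with (S K). unfold em_term at 2. rewrite RtoC_INR_S, fall_nat_vanish by lia. ring.
Qed.

Lemma peval_continuous c (x0 eps : R) : (0 < eps)%R -> exists delta, (0 < delta)%R /\
  forall x : R, (Rabs (x - x0) < delta)%R -> (Cmod (peval c (RtoC x) - peval c (RtoC x0)) < eps)%R.
Proof.
  intros He.
  assert (HE : entire (fun z => peval c z)).
  { induction c as [|a c IH]; [apply (entire_const (RtoC 0))|].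
    apply (entire_ext (fun z => Q2C a + z * peval c z)); [reflexivity|].
    entire_tac. }
  destruct (entire_continuous _ HE (RtoC x0) eps He) as [d [Hd H]]. exists d. split; [exact Hd|].
  intros x Hx. apply H. now rewrite <- RtoC_minus, Cmod_R.
Qed.

(** Call the polynomial P. Since P(1) - P(0) = 1, the artificial value of [emm] at 1 is P(0), so at
    a = m + 1 the functions [em] and [emm] are exactly P(x) and P(x - 1) on the points. *)
Lemma faulhaber m : exists c c' : Qpoly,
  (forall x, peval c' x = peval c (x - RtoC 1)) /\
  (forall x : R, (1 <= x)%R -> peval c (RtoC x) - peval c' (RtoC x) = RtoC (x ^ m)) /\
  (forall K x, (S m <= K)%nat -> x <> 0%R -> em K (RtoC (INR (S m))) x = peval c (RtoC x)) /\
  (forall K x, (S m <= K)%nat -> good x -> emm K (RtoC (INR (S m))) x = peval c' (RtoC x)).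
Proof.
  destruct (em_polynomial m) as [c Hc]. destruct (peval_shift c) as [c' Hc']. exists c, c'.
  assert (HK : forall K x, (S m <= K)%nat -> x <> 0%R -> em K (RtoC (INR (S m))) x = peval c (RtoC x)).
  { intros K x HK Hx. rewrite em_stable by assumption. now apply Hc. }
  assert (Hgt : forall x : R, (1 < x)%R -> peval c (RtoC x) - peval c' (RtoC x) = RtoC (x ^ m)).
  { intros x Hx. rewrite Hc', <- RtoC_minus, <- !(HK (S m)) by (lia || lra).
    pose proof (em_rem_vanish (S m) (RtoC (INR (S m))) x ltac:(lia) (or_introl Hx)) as E.
    rewrite RtoC_INR_S in E. specialize (E (fall_nat_vanish _ _ (Nat.lt_succ_diag_r m))).
    unfold em_rem in E. rewrite RtoC_INR_S, pw_nat in E by lra.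
    match goal with |- ?u - ?v = ?w => replace (u - v) with ((u - v - w) + w) by ring end. rewrite E. ring. }
  assert (Hge : forall x : R, (1 <= x)%R -> peval c (RtoC x) - peval c' (RtoC x) = RtoC (x ^ m)).
  { intros x [Hx|<-]; [now apply Hgt|]. destruct (polynomial_pow m) as [d Hd].
    set (e := padd c (padd (pscal (-1) c') (pscal (-1) d))).
    assert (Em : Q2C (-1) = - RtoC 1) by (rewrite <- Q2C_1, <- Q2C_opp; reflexivity).
    assert (He : forall x : R, peval e (RtoC x) = peval c (RtoC x) - peval c' (RtoC x) - peval d (RtoC x)).
    { intros x. unfold e. rewrite !peval_padd, !peval_pscal, Em. ring. }
    assert (H0 : peval e (RtoC 1) = RtoC 0).
    { apply Cmod_eq_0. destruct (Rle_lt_or_eq_dec 0 (Cmod (peval e (RtoC 1))) (Cmod_ge_0 _)) as [Hp|Hp]; [|now auto].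
      exfalso. destruct (peval_continuous e 1 _ Hp) as [delta [Hd0 H]].
      assert (Hx : (1 < 1 + delta / 2)%R) by lra.
      specialize (H (1 + delta / 2)%R). rewrite (He (1 + delta / 2)%R), Hgt, Hd in H by lra.
      replace (peval d (RtoC (1 + delta / 2)) - peval d (RtoC (1 + delta / 2)) - peval e (RtoC 1)) with (- peval e
        (RtoC 1)) in H by ring.
      rewrite Cmod_opp in H. assert (Rabs (1 + delta / 2 - 1) < delta)%R by (rewrite Rabs_pos_eq; lra).
      specialize (H H0). lra. }
    rewrite He in H0. rewrite Hd by lra.
    match goal with |- ?u - ?v = ?w => replace (u - v) with ((u - v - w) + w) by ring end. rewrite H0. ring. }
  split; [exact Hc'|]. split; [exact Hge|]. split; [exact HK|].
  intros K x H1 Hx. destruct (Req_EM_T x 1) as [->|Hne].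
  - rewrite emm_1, HK by (assumption || lra). pose proof (Hge 1%R ltac:(lra)) as E. rewrite pow1 in E.
    transitivity (peval c (RtoC 1) - (peval c (RtoC 1) - peval c' (RtoC 1))); [now rewrite E|ring].
  - rewrite emm_ne, HK, Hc', RtoC_minus by (assumption || (destruct Hx as [Hx|[Hx|Hx]]; lra)). reflexivity.
Qed.

(** * Boundary terms as formal combinations of indices *)

Definition Zadd_C (k : Z) (s : C) : C := Z_to_C k + s.

(** Exponents have the form l + s with an integer index l and complex parameters s. Combinations act
    on l alone, so one formal identity holds for all s. *)
Fixpoint addl (l : list Z) (s : list C) : list C :=
  match l, s with k :: l', z :: s' => Zadd_C k z :: addl l' s' | _, _ => [] end.

Lemma addl_app l1 s1 l2 s2 : length l1 = length s1 -> addl (l1 ++ l2) (s1 ++ s2) = addl l1 s1 ++ addl l2 s2.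
Proof.
  revert s1; induction l1 as [|k l1 IH]; intros [|z s1] H; try discriminate; [reflexivity|].
  simpl in *. f_equal. apply IH. lia.
Qed.

Lemma addl_0 l : addl l (repeat (RtoC 0) (length l)) = map Z_to_C l.
Proof. induction l as [|k l IH]; [reflexivity|]. simpl. rewrite IH. f_equal. unfold Zadd_C. ring. Qed.

Definition comb := list (list Z * Qpoly).

Definition cev (V : list Z -> C) (x : C) (T : comb) : C := csum (fun lc => peval (snd lc) x * V (fst lc)) T.

Definition idx (c : Qpoly) : list (nat * Q) := combine (seq 0 (length c)) c.

Lemma peval_idx_from c x : forall k,
  csum (fun ia => Q2C (snd ia) * Cpow x (fst ia)) (combine (seq k (length c)) c) = Cpow x k * peval c x.
Proof.
  induction c as [|a c IH]; intros k; [change (RtoC 0 = Cpow x k * RtoC 0); ring|].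
  cbn [length seq combine]. rewrite csum_cons, IH, peval_cons. cbn [fst snd Cpow]. ring.
Qed.

Lemma peval_idx c x : peval c x = csum (fun ia => Q2C (snd ia) * Cpow x (fst ia)) (idx c).
Proof. unfold idx. rewrite peval_idx_from. simpl. ring. Qed.

Lemma Wt_mult_pow (f : Z) (s : C) i x : x <> 0%R ->
  Wt (Zadd_C f s) x * Cpow (RtoC x) i = Wt (Zadd_C (f - Z.of_nat i) s) x.
Proof.
  intros Hx. unfold Wt. rewrite <- RtoC_pow, <- pw_nat, <- pw_plus by assumption. f_equal.
  unfold Zadd_C, Z_to_C. rewrite minus_IZR, <- INR_IZR_INZ, RtoC_minus. ring.
Qed.

Lemma nest_Wt_peval pre (f : Z) (s : C) c post xs : (forall x, In x xs -> x <> 0%R) ->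
  nest (pre ++ (fun x => Wt (Zadd_C f s) x * peval c (RtoC x)) :: post) xs =
  csum (fun ia => Q2C (snd ia) * nest (pre ++ Wt (Zadd_C (f - Z.of_nat (fst ia)) s) :: post) xs) (idx c).
Proof.
  intros Hx. rewrite <- nest_csum. apply nest_ext_mid. intros x Hin. rewrite peval_idx, <- csum_scal.
  apply csum_ext. intros ia _. rewrite <- Wt_mult_pow by auto. ring.
Qed.

(** Without a right neighbour the boundary point p or t contributes P(x - 1) evaluated there. This
    is the source of the non-constant coefficients. *)
Definition comb_right (c' : Qpoly) (pre post : list Z) : comb :=
  match post with
  | [] => [(pre, c')]
  | f :: post' => map (fun ia => (pre ++ (f - Z.of_nat (fst ia))%Z :: post', [snd ia])) (idx c')
  end.

(** Without a left neighbour the boundary point is 0, which contributes the constant - P(0). *)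
Definition comb_left (c : Qpoly) (rpre post : list Z) : comb :=
  match rpre with
  | [] => [(post, [(- Qpoly_eval c 0)%Q])]
  | e :: rpre' => map (fun ia => (rev rpre' ++ (e - Z.of_nat (fst ia))%Z :: post, [(- snd ia)%Q])) (idx c)
  end.

Lemma absorb_right_ext hm hm' lst pre post (xs : list R) : (forall x, In x xs -> hm x = hm' x) ->
  absorb_right hm lst pre post xs = absorb_right hm' lst pre post xs.
Proof.
  intros H. destruct post as [|f post]; [reflexivity|]. unfold absorb_right. apply nest_ext_mid.
  intros x Hx. now rewrite H.
Qed.

Lemma comb_right_correct c' pre post spre spost tt xs : (forall x, In x xs -> x <> 0%R) ->
  length pre = length spre -> length post = length spost ->
  absorb_right (fun x => peval c' (RtoC x)) (peval c' tt) (map Wt (addl pre spre)) (map Wt (addl post spost)) xs =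
  cev (fun l => nest (map Wt (addl l (spre ++ spost))) xs) tt (comb_right c' pre post).
Proof.
  intros Hx H1 H2. destruct post as [|f post], spost as [|s spost]; try discriminate.
  - unfold cev. cbn [addl map absorb_right comb_right]. rewrite csum_cons, csum_nil, app_nil_r. cbn [fst snd]. ring.
  - cbn [addl map absorb_right comb_right]. rewrite nest_Wt_peval by assumption. unfold cev. rewrite csum_map.
    apply csum_ext. intros ia _. cbn [fst snd]. rewrite peval_const, addl_app, map_app by assumption. reflexivity.
Qed.

Lemma addl_length l s : length l = length s -> length (addl l s) = length l.
Proof. revert s; induction l as [|k l IH]; intros [|z s] H; try discriminate; [reflexivity|]. simpl in *.
rewrite IH; lia. Qed.

Lemma comb_left_correct c pre post spre spost tt xs : (forall x, In x xs -> x <> 0%R) ->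
  length pre = length spre -> length post = length spost ->
  - (match rev (map Wt (addl pre spre)) with
    | [] => peval c (RtoC 0) * nest (map Wt (addl post spost)) xs
    | e :: rpre' => nest (rev rpre' ++ (fun x => e x * peval c (RtoC x)) :: map Wt (addl post spost)) xs
    end) =
  cev (fun l => nest (map Wt (addl l (spre ++ spost))) xs) tt (comb_left c (rev pre) post).
Proof.
  intros Hx H1 H2. destruct pre as [|e pre _] using rev_ind.
  - destruct spre; [|discriminate]. unfold cev. cbn [rev map addl comb_left app]. rewrite csum_cons, csum_nil.
    cbn [fst snd]. rewrite peval_const, Q2C_opp, Q2C_Qpoly_eval, Q2C_0. ring.
  - destruct spre as [|s spre _] using rev_ind; [rewrite length_app in H1; simpl in H1; lia|].
    rewrite !length_app in H1. simpl in H1. assert (H3 : length pre = length spre) by lia.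
    rewrite addl_app, map_app, !rev_app_distr by exact H3. cbn [rev app addl map comb_left].
    rewrite rev_involutive, nest_Wt_peval by assumption. unfold cev. rewrite csum_map.
    match goal with |- - ?S = _ => replace (- S) with ((- RtoC 1) * S) by ring end. rewrite <- csum_scal.
    apply csum_ext. intros ia _. cbn [fst snd].
    rewrite peval_const, Q2C_opp, rev_involutive, <- app_assoc, addl_app, map_app by exact H3.
    cbn [app addl map]. ring.
Qed.

Lemma boundary_terms_comb h hm lst c0 c c' pre post spre spost tt xs : (forall x, In x xs -> x <> 0%R) ->
  length pre = length spre -> length post = length spost ->
  (forall x, In x xs -> h x = peval c (RtoC x)) -> (forall x, In x xs -> hm x = peval c' (RtoC x)) ->
  lst = peval c' tt -> c0 = peval c (RtoC 0) ->
  boundary_terms h hm lst c0 (map Wt (addl pre spre)) (map Wt (addl post spost)) xs =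
  cev (fun l => nest (map Wt (addl l (spre ++ spost))) xs) tt (comb_right c' pre post ++ comb_left c (rev pre) post).
Proof.
  intros Hx H1 H2 Hh Hhm -> ->. unfold cev. rewrite csum_app. unfold boundary_terms.
  rewrite (absorb_right_ext hm (fun x => peval c' (RtoC x))) by assumption.
  change (csum ?f ?l) with (csum f l).
  pose proof (comb_right_correct c' pre post spre spost tt xs Hx H1 H2) as ER.
  pose proof (comb_left_correct c pre post spre spost tt xs Hx H1 H2) as EL.
  unfold cev in ER, EL. rewrite <- ER, <- EL. unfold Cminus. f_equal. f_equal.
  destruct (rev (map Wt (addl pre spre))) as [|e r]; [reflexivity|].
  apply nest_ext_mid. intros x Hin. now rewrite Hh.
Qed.

Lemma comb_right_le c' pre post lc : In lc (comb_right c' pre post) -> Forall2 Z.le (fst lc) (pre ++ post).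
Proof.
  assert (Hr : forall l, Forall2 Z.le l l) by (induction l; constructor; auto; lia).
  unfold comb_right. destruct post as [|f post]; intros H.
  - destruct H as [<-|[]]. rewrite app_nil_r. apply Hr.
  - apply in_map_iff in H. destruct H as [ia [<- _]]. cbn [fst]. apply Forall2_app; [apply Hr|].
    constructor; [lia|apply Hr].
Qed.

Lemma comb_left_le c pre post lc : In lc (comb_left c (rev pre) post) -> Forall2 Z.le (fst lc) (pre ++ post).
Proof.
  assert (Hr : forall l, Forall2 Z.le l l) by (induction l; constructor; auto; lia).
  destruct pre as [|e pre _] using rev_ind.
  - cbn [rev comb_left app]. intros [<-|[]]. apply Hr.
  - rewrite rev_app_distr. cbn [rev app comb_left]. intros H. apply in_map_iff in H. destruct H as [ia [<- _]].
    cbn [fst]. rewrite rev_involutive, <- app_assoc. cbn [app]. apply Forall2_app; [apply Hr|].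
    constructor; [lia|apply Hr].
Qed.

Definition zetaP (p : nat) (l : list Z) : C := nest (map Wt (map Z_to_C l)) (Xpos p).

Lemma Xpos_ge_1 p x : In x (Xpos p) -> (1 <= x)%R.
Proof.
  intros H. apply in_map_iff in H. destruct H as [n [<- Hn]]. apply in_seq in Hn.
  apply (le_INR 1). lia.
Qed.

Lemma Wt_opp_nat m x : x <> 0%R -> Wt (Z_to_C (- Z.of_nat m)) x = RtoC (x ^ m).
Proof.
  intros Hx. unfold Wt, Z_to_C. rewrite opp_IZR, <- INR_IZR_INZ, <- RtoC_opp, Ropp_involutive. now apply pw_nat.
Qed.

(** The chain 1 < ... < p-1 is finite and without a gap, so polynomial telescoping is exact and the
    relation is an equality of numbers for each p. *)
Lemma faulhaber_zetaP m c c' pre post p : (1 <= p)%nat ->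
  (forall x, peval c' x = peval c (x - RtoC 1)) ->
  (forall x : R, (1 <= x)%R -> peval c (RtoC x) - peval c' (RtoC x) = RtoC (x ^ m)) ->
  zetaP p (pre ++ (- Z.of_nat m)%Z :: post) =
  cev (zetaP p) (RtoC (INR p)) (comb_right c' pre post ++ comb_left c (rev pre) post).
Proof.
  intros Hp Hc' Hge. destruct p as [|n]; [lia|]. clear Hp.
  set (h := fun x : R => peval c (RtoC x)). set (hm := fun x : R => peval c' (RtoC x)).
  assert (Hh : forall n, hm (INR (S (S n))) = h (INR (S n))).
  { intros k. unfold h, hm. rewrite Hc'. f_equal. rewrite (S_INR (S k)), RtoC_plus. ring. }
  destruct (chain_pos h hm n Hh 0) as [H1 H2].
  assert (EX : Xpos (S n) = map INR (seq 1 n)) by (unfold Xpos; now replace (S n - 1)%nat with n by lia).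
  rewrite <- EX in H1, H2.
  set (spre := repeat (RtoC 0) (length pre)). set (spost := repeat (RtoC 0) (length post)).
  assert (L1 : length pre = length spre) by (unfold spre; now rewrite repeat_length).
  assert (L2 : length post = length spost) by (unfold spost; now rewrite repeat_length).
  pose proof (abel_summation h hm _ (map Wt (addl pre spre)) (map Wt (addl post spost)) _ H1) as E.
  rewrite (boundary_terms_comb h hm _ _ c c' pre post spre spost (RtoC (INR (S n)))) in E; try assumption;
    try reflexivity.
  - unfold zetaP. rewrite !map_app. cbn [map].
    rewrite (nest_ext_mid (Wt (Z_to_C (- Z.of_nat m))) (fun x => h x - hm x)).
    + unfold spre, spost in E. rewrite !addl_0 in E. rewrite E.
      unfold cev. apply csum_ext. intros lc Hlc. f_equal.
      rewrite <- repeat_app, <- length_app.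
      assert (Hlen : length (fst lc) = length (pre ++ post)).
      { apply in_app_iff in Hlc. destruct Hlc as [Hlc|Hlc]; [apply comb_right_le in Hlc|apply comb_left_le in Hlc];
          now apply Forall2_length in Hlc. }
      rewrite <- Hlen. now rewrite addl_0.
    + intros x Hx. apply Xpos_ge_1 in Hx. rewrite Wt_opp_nat by lra. symmetry. now apply Hge.
  - intros x Hx. apply Xpos_ge_1 in Hx. lra.
  - unfold hm. rewrite Hc'. f_equal. change (INR 1) with 1%R. ring.
Qed.

(* Ph continues the limit of A from b <= Re w to the whole disc, with value B at the centre. *)
Definition approx (r b : R) (A : nat -> C -> C) (B : nat -> C) : Prop :=
  exists Ph : nat -> C -> C,
    (forall N, entire (Ph N)) /\
    (exists D, forall w, (Cmod w <= r)%R -> tame D (fun N => Ph N w)) /\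
    (forall w, (Cmod w <= r)%R -> (b <= fst w)%R -> forall eps, (0 < eps)%R ->
       exists N0, forall N, (N0 <= N)%nat -> (Cmod (A N w - Ph N w) <= eps)%R) /\
    (forall N, Ph (S N) (RtoC 0) = B (S N)).

Lemma approx_zero r b : approx r b (fun _ _ => RtoC 0) (fun _ => RtoC 0).
Proof.
  exists (fun _ _ => RtoC 0). split; [intros; apply entire_const|]. split; [|split].
  - exists 0%R. intros w _. split; [lra|]. split; intros N; rewrite ?Cmod_0; [lra|].
    replace (RtoC 0 - RtoC 0) with (RtoC 0) by ring. rewrite Cmod_0. lra.
  - intros w _ _ eps He. exists 0%nat. intros N _. replace (RtoC 0 - RtoC 0) with (RtoC 0) by ring. rewrite Cmod_0.
    lra.
  - reflexivity.
Qed.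

Lemma approx_mono r b b' A B : (b <= b')%R -> approx r b A B -> approx r b' A B.
Proof.
  intros Hb [Ph [H1 [H2 [H3 H4]]]]. exists Ph. repeat split; auto. intros w Hw Hbw. apply H3; [exact Hw|lra].
Qed.

Lemma approx_ext r b A A' B B' : (forall N w, A N w = A' N w) -> (forall N, B N = B' N) ->
  approx r b A B -> approx r b A' B'.
Proof.
  intros HA HB [Ph [H1 [H2 [H3 H4]]]]. exists Ph. repeat split; auto.
  - intros w Hw Hbw eps He. destruct (H3 w Hw Hbw eps He) as [N0 HN]. exists N0. intros N. rewrite <- HA. apply HN.
  - intros N. rewrite <- HB. apply H4.
Qed.

Lemma approx_scal_plus r b u A B A' B' : approx r b A B -> approx r b A' B' ->
  approx r b (fun N w => u * A N w + A' N w) (fun N => u * B N + B' N).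
Proof.
  intros [P1 [H1 [[D1 T1] [L1 E1]]]] [P2 [H2 [[D2 T2] [L2 E2]]]].
  exists (fun N w => u * P1 N w + P2 N w). split; [|split; [|split]].
  - intros N. entire_tac.
  - exists (Cmod u * D1 + D2)%R. intros w Hw.
    apply (tame_plus _ _ (fun N => u * P1 N w) (fun N => P2 N w)); [|now apply T2].
    apply (tame_scal u _ _ (fun N => P1 N w)); [lra|now apply T1].
  - intros w Hw Hb eps He. pose proof (Cmod_ge_0 u) as Hu.
    assert (He1 : (0 < eps / (2 * (Cmod u + 1)))%R) by (apply Rdiv_lt_0_compat; lra).
    destruct (L1 w Hw Hb _ He1) as [N1 HN1]. destruct (L2 w Hw Hb (eps / 2)%R ltac:(lra)) as [N2 HN2].
    exists (max N1 N2). intros N HN. specialize (HN1 N ltac:(lia)). specialize (HN2 N ltac:(lia)).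
    replace (_ - _) with (u * (A N w - P1 N w) + (A' N w - P2 N w)) by ring.
    eapply Rle_trans; [apply Cmod_triangle|]. rewrite Cmod_mult.
    assert (Cmod u * Cmod (A N w - P1 N w) <= eps / 2)%R; [|lra].
    apply Rle_trans with ((Cmod u + 1) * (eps / (2 * (Cmod u + 1))))%R; [|right; field; lra].
    apply Rmult_le_compat; [lra|apply Cmod_ge_0|lra|exact HN1].
  - intros N. now rewrite E1, E2.
Qed.

Definition far (M : R) (ss : list C) : Prop := List.Forall (fun s => (M <= fst s)%R) ss.

Definition Zabs_sum (l : list Z) : R := fold_right Rplus 0%R (map (fun k => Rabs (IZR k)) l).

Lemma Zabs_sum_nonneg l : (0 <= Zabs_sum l)%R.
Proof. unfold Zabs_sum. induction l as [|k l IH]; simpl; [lra|]. pose proof (Rabs_pos (IZR k)). lra. Qed.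

Lemma addl_far M l s : length l = length s -> far (M + Zabs_sum l) s -> far M (addl l s).
Proof.
  revert s. induction l as [|k l IH]; intros [|z s] HL H; try discriminate; [constructor|].
  inversion H as [|? ? H1 H2]; subst. pose proof (Zabs_sum_nonneg l) as H0.
  change (Zabs_sum (k :: l)) with (Rabs (IZR k) + Zabs_sum l)%R in *.
  constructor.
  - unfold Zadd_C, Z_to_C. simpl. pose proof (Rabs_pos (IZR k)). pose proof (Rle_abs (- IZR k)) as H5.
    rewrite Rabs_Ropp in H5. lra.
  - apply IH; [simpl in HL; lia|]. eapply List.Forall_impl; [|exact H2]. simpl. intros x Hx.
    pose proof (Rabs_pos (IZR k)). lra.
Qed.

(** The variable w is the offset of the exponent from -m: the centre w = 0 is the value sought, and
    Re w >= m + 2 means an exponent of real part at least 2. *)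
Lemma step (m : nat) (pre post : list Z) : exists T : comb,
  (forall lc, In lc T -> Forall2 Z.le (fst lc) (pre ++ post)) /\
  (forall p, (1 <= p)%nat -> zetaP p (pre ++ (- Z.of_nat m)%Z :: post) = cev (zetaP p) (RtoC (INR p)) T) /\
  (forall t r, (t <= 0)%R -> (0 <= r)%R -> exists M, forall spre spost,
     length spre = length pre -> length spost = length post -> far M spre -> far M spost ->
     approx r (INR m + 2) (fun N w => zetaU t N (addl (pre ++ (- Z.of_nat m)%Z :: post) (spre ++ w :: spost)))
       (fun N => cev (fun l => zetaU t N (addl l (spre ++ spost))) (RtoC t) T)).
Proof.
  destruct (faulhaber m) as [c [c' [Hc' [Hge [HK HK']]]]].
  exists (comb_right c' pre post ++ comb_left c (rev pre) post). split; [|split].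
  - intros lc H. apply in_app_iff in H. destruct H; [now apply (comb_right_le c')|now apply (comb_left_le c)].
  - intros p Hp. now apply faulhaber_zetaP.
  - intros t r Ht Hr. pose proof (pos_INR m) as Hm.
    (* On the disc the exponents w - m have modulus at most r + m, and the decay of the defect asks
       for K >= r + m + 2; the summand S m secures exactness at -m. *)
    destruct (INR_unbounded (r + INR m + 2)) as [K0 HK0]. set (K := (K0 + S m)%nat).
    assert (HKr : (r + INR m + 2 <= INR K)%R) by (unfold K; rewrite plus_INR; pose proof (pos_INR (S m)); lra).
    assert (HK1 : (1 <= K)%nat) by (unfold K; lia). assert (HKm : (S m <= K)%nat) by (unfold K; lia).
    set (rho := (r + INR m)%R). set (p := (rho + 1 + INR K + 1)%R).
    assert (Hp0 : (0 <= p)%R) by (unfold p, rho; pose proof (pos_INR K); lra).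
    exists (p + 2 + Zabs_sum (pre ++ post))%R. intros spre spost L1 L2 F1 F2.
    assert (Hsum : (Zabs_sum (pre ++ post) = Zabs_sum pre + Zabs_sum post)%R).
    { unfold Zabs_sum. rewrite map_app. induction (map _ pre) as [|x l IH]; simpl; [ring|]. rewrite IH. ring. }
    pose proof (Zabs_sum_nonneg pre) as Z1. pose proof (Zabs_sum_nonneg post) as Z2.
    assert (G1 : far (p + 2) (addl pre spre)).
    { apply addl_far; [auto|]. eapply List.Forall_impl; [|exact F1]. intros; simpl in *; lra. }
    assert (G2 : far (p + 2) (addl post spost)).
    { apply addl_far; [auto|]. eapply List.Forall_impl; [|exact F2]. intros; simpl in *; lra. }
    destruct (Wt_fast_all _ p G1) as [q1 [Hq1 W1]]. destruct (Wt_fast_all _ p G2) as [q2 [Hq2 W2]].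
    set (q := (q1 + q2)%R).
    assert (Hup : forall q' fs, (q' <= q)%R -> List.Forall (fast p q') fs -> List.Forall (fast p q) fs).
    { intros q' fs Hq' Hfs. eapply List.Forall_impl; [|exact Hfs]. intros f Hf x Hx.
      eapply Rle_trans; [now apply Hf|]. apply Rmult_le_compat_r; [left; apply inv_sq_pos|exact Hq']. }
    apply (Hup q1) in W1; [|unfold q; lra]. apply (Hup q2) in W2; [|unfold q; lra].
    set (fpre := map Wt (addl pre spre)) in *. set (fpost := map Wt (addl post spost)) in *.
    set (z := fun w => Zadd_C (- Z.of_nat m) w).
    assert (Hz : forall w, (Cmod w <= r)%R -> (Cmod (z w) <= rho)%R).
    { intros w Hw. unfold z, Zadd_C, Z_to_C, rho. eapply Rle_trans; [apply Cmod_triangle|].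
      rewrite Cmod_R, opp_IZR, <- INR_IZR_INZ, Rabs_Ropp, Rabs_pos_eq by assumption. lra. }
    exists (fun N w => Phi K t N fpre fpost (z w)). split; [|split; [|split]].
    + intros N. apply (entire_comp (Phi K t N fpre fpost) z); [apply entire_Phi|].
      unfold z, Zadd_C. entire_tac.
    + destruct (Phi_tame K rho t q fpre fpost) as [D HD]; try assumption; try (unfold rho, q; lra).
      exists D. intros w Hw. apply HD. now apply Hz.
    + intros w Hw Hb eps He.
      assert (Hsm : forall fs, List.Forall (fast p q) fs -> List.Forall (summable q) fs).
      { intros fs Hfs. eapply List.Forall_impl; [|exact Hfs]. intros f. now apply fast_summable. }
      destruct (nest_minus_Phi_small K t fpre fpost (z w) q) with (eps := eps) as [N0 HN0]; auto.
      * unfold z, Zadd_C, Z_to_C. simpl. rewrite opp_IZR, <- INR_IZR_INZ. lra.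
      * specialize (Hz w Hw). unfold rho in Hz. lra.
      * unfold q; lra.
      * exists N0. intros N HN. unfold zetaU. rewrite addl_app by auto. rewrite map_app. cbn [addl map].
        now apply HN0.
    + intros N. assert (Ez : z (RtoC 0) = - RtoC (INR m)).
      { unfold z, Zadd_C, Z_to_C. rewrite opp_IZR, <- INR_IZR_INZ, RtoC_opp. ring. }
      rewrite Ez. unfold Phi. replace (RtoC 1 - - RtoC (INR m)) with (RtoC (INR (S m))) by (rewrite S_INR,
        RtoC_plus; ring).
      assert (Hgood : forall x, In x (Xs t (S N)) -> good x) by (intros x; now apply Xs_good).
      assert (Hne : forall x, good x -> x <> 0%R) by (intros x [Hx|[Hx|Hx]]; lra).
      (* The vanishing defect is written as a multiple, so that linearity annihilates its nested
         sum. *)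
      rewrite (nest_ext_mid (em_defect K (RtoC (INR (S m)))) (fun _ => RtoC 0 * RtoC 0)).
      2:{ intros x Hx. replace (RtoC 0 * RtoC 0) with (RtoC 0) by ring.
          specialize (Hgood x Hx). destruct (Req_EM_T x 1) as [->|Hx1]; [apply em_defect_1|].
          rewrite em_defect_ne by assumption. apply em_rem_vanish; [exact HK1| |].
          - destruct Hgood as [Hg|[Hg|Hg]]; lra.
          - rewrite RtoC_INR_S. apply fall_nat_vanish. lia. }
      rewrite nest_scal.
      unfold bd, fpre, fpost. rewrite (boundary_terms_comb _ _ _ _ c c' pre post spre spost (RtoC t)); auto.
      * unfold zetaU. ring.
      * rewrite HK by (assumption || lra). now rewrite Hc', RtoC_minus.
      * rewrite HK by (assumption || lra). pose proof (Hge 1%R ltac:(lra)) as E. rewrite pow1, Hc' in E.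
        replace (RtoC 1 - RtoC 1) with (RtoC 0) in E by ring.
        transitivity (peval c (RtoC 1) - (peval c (RtoC 1) - peval c (RtoC 0))); [now rewrite E|ring].
Qed.

(** * Elimination of nonpositive exponents *)

Lemma far_mono M M' ss : (M' <= M)%R -> far M ss -> far M' ss.
Proof. intros H. apply List.Forall_impl. intros s Hs. lra. Qed.

Definition comb_scale (c : Qpoly) (T : comb) : comb := map (fun lc => (fst lc, pmul c (snd lc))) T.

Lemma cev_scale V x c T : cev V x (comb_scale c T) = peval c x * cev V x T.
Proof.
  unfold cev, comb_scale. rewrite csum_map, <- csum_scal. apply csum_ext. intros lc _. cbn [fst snd].
  rewrite peval_pmul. ring.
Qed.

Lemma cev_app V x T T' : cev V x (T ++ T') = cev V x T + cev V x T'.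
Proof. apply csum_app. Qed.

Lemma cev_cons V x lc T : cev V x (lc :: T) = peval (snd lc) x * V (fst lc) + cev V x T.
Proof. reflexivity. Qed.

Lemma cev_single V x k : cev V x [(k, [1%Q])] = V k.
Proof. rewrite cev_cons. cbn [fst snd]. rewrite peval_const, Q2C_1. unfold cev. rewrite csum_nil. ring. Qed.

Lemma Forall2_app_inv_cons (l : list Z) bpre x bpost : Forall2 Z.le l (bpre ++ x :: bpost) ->
  exists lpre y lpost, l = lpre ++ y :: lpost /\ Forall2 Z.le lpre bpre /\ (y <= x)%Z /\ Forall2 Z.le lpost bpost.
Proof.
  intros H. apply Forall2_app_inv_r in H. destruct H as [lpre [l2 [H1 [H2 ->]]]].
  inversion H2 as [|y ? lpost ? Hy H3]; subst. now exists lpre, y, lpost.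
Qed.

Lemma Forall2_Zle_trans l1 l2 l3 : Forall2 Z.le l1 l2 -> Forall2 Z.le l2 l3 -> Forall2 Z.le l1 l3.
Proof.
  intros H. revert l3. induction H as [|x y l1 l2 Hxy H IH]; intros l3 H2; inversion H2; subst; constructor; auto;
    lia.
Qed.

(** Domination by a common index places a nonpositive entry at the same position in every term, so
    all terms move along one variable w, though with different exponents y <= x. *)
Lemma elim_step bpre x bpost : (x <= 0)%Z -> forall T : comb,
  (forall lc, In lc T -> Forall2 Z.le (fst lc) (bpre ++ x :: bpost)) ->
  exists T' : comb,
  (forall lc, In lc T' -> Forall2 Z.le (fst lc) (bpre ++ bpost)) /\
  (forall p, (1 <= p)%nat -> cev (zetaP p) (RtoC (INR p)) T = cev (zetaP p) (RtoC (INR p)) T') /\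
  (exists b, forall t r, (t <= 0)%R -> (0 <= r)%R -> exists M, forall spre spost,
     length spre = length bpre -> length spost = length bpost -> far M spre -> far M spost ->
     approx r b (fun N w => cev (fun l => zetaU t N (addl l (spre ++ w :: spost))) (RtoC t) T)
       (fun N => cev (fun l => zetaU t N (addl l (spre ++ spost))) (RtoC t) T')).
Proof.
  intros Hx. induction T as [|[l c] T IH]; intros HT.
  - exists []. split; [easy|]. split; [reflexivity|]. exists 0%R. intros t r Ht Hr. exists 0%R. intros.
    apply approx_zero.
  - destruct IH as [T2 [S2 [Q2 [b2 A2]]]]; [intros; apply HT; now right|].
    destruct (Forall2_app_inv_cons _ _ _ _ (HT _ (or_introl eq_refl))) as [lpre [y [lpost [El [F1 [Hy F2]]]]]].
    cbn [fst] in El. destruct (step (Z.to_nat (- y)) lpre lpost) as [T1 [S1 [Q1 A1]]].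
    replace (- Z.of_nat (Z.to_nat (- y)))%Z with y in * by lia. rewrite <- El in Q1, A1.
    exists (comb_scale c T1 ++ T2). split; [|split].
    + intros lc Hlc. apply in_app_iff in Hlc. destruct Hlc as [Hlc|Hlc]; [|now apply S2].
      apply in_map_iff in Hlc. destruct Hlc as [lc1 [<- Hlc]]. cbn [fst]. apply (Forall2_Zle_trans _ (lpre ++ lpost)).
      * now apply S1.
      * now apply Forall2_app.
    + intros p Hp. rewrite cev_cons, cev_app, cev_scale, <- Q1, Q2 by exact Hp. reflexivity.
    + exists (Rmax (INR (Z.to_nat (- y)) + 2) b2). intros t r Ht Hr.
      destruct (A1 t r Ht Hr) as [M1 A1']. destruct (A2 t r Ht Hr) as [M2 A2'].
      exists (Rmax M1 M2). intros spre spost L1 L2 G1 G2.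
      apply Forall2_length in F1. apply Forall2_length in F2.
      pose proof (A1' spre spost ltac:(congruence) ltac:(congruence)
        (far_mono _ _ _ (Rmax_l M1 M2) G1) (far_mono _ _ _ (Rmax_l M1 M2) G2)) as P1.
      pose proof (A2' spre spost L1 L2
        (far_mono _ _ _ (Rmax_r M1 M2) G1) (far_mono _ _ _ (Rmax_r M1 M2) G2)) as P2.
      eapply approx_ext; [| |exact (approx_scal_plus _ _ (peval c (RtoC t)) _ _ _ _
        (approx_mono _ _ _ _ _ (Rmax_l _ b2) P1) (approx_mono _ _ _ _ _ (Rmax_r _ b2) P2))].
      * intros N w. rewrite cev_cons. reflexivity.
      * intros N. now rewrite cev_app, cev_scale.
Qed.

(** * Limits, and their transport to the centre of a disc *)

Definition converges (A : nat -> C) (L : C) : Prop :=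
  forall eps, (0 < eps)%R -> exists N0, forall N, (N0 <= N)%nat -> (Cmod (A N - L) <= eps)%R.

Lemma converges_unique A L L' : converges A L -> converges A L' -> L = L'.
Proof.
  intros H H'. assert (E : L - L' = RtoC 0).
  { apply Cmod_eq_0. destruct (Rle_lt_or_eq_dec 0 _ (Cmod_ge_0 (L - L'))) as [Hp|Hp]; [|now auto]. exfalso.
    destruct (H (Cmod (L - L') / 4)%R ltac:(lra)) as [N1 H1].
    destruct (H' (Cmod (L - L') / 4)%R ltac:(lra)) as [N2 H2].
    specialize (H1 (max N1 N2) ltac:(lia)). specialize (H2 (max N1 N2) ltac:(lia)).
    pose proof (Cmod_triangle (- (A (max N1 N2) - L)) (A (max N1 N2) - L')) as T. rewrite Cmod_opp in T.
    replace (- (A (max N1 N2) - L) + (A (max N1 N2) - L')) with (L - L') in T by ring. lra. }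
  replace L with ((L - L') + L') by ring. rewrite E. ring.
Qed.

Lemma converges_plus A L A' L' : converges A L -> converges A' L' -> converges (fun N => A N + A' N) (L + L').
Proof.
  intros H H' eps He. destruct (H (eps / 2)%R ltac:(lra)) as [N1 H1]. destruct (H' (eps / 2)%R ltac:(lra)) as [N2 H2].
  exists (max N1 N2). intros N HN. specialize (H1 N ltac:(lia)). specialize (H2 N ltac:(lia)).
  replace (_ - _) with ((A N - L) + (A' N - L')) by ring. eapply Rle_trans; [apply Cmod_triangle|]. lra.
Qed.

Lemma converges_scal u A L : converges A L -> converges (fun N => u * A N) (u * L).
Proof.
  intros H eps He. pose proof (Cmod_ge_0 u).
  assert (He1 : (0 < eps / (Cmod u + 1))%R) by (apply Rdiv_lt_0_compat; lra).
  destruct (H _ He1) as [N0 HN0]. exists N0. intros N HN. specialize (HN0 N HN).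
  replace (u * A N - u * L) with (u * (A N - L)) by ring. rewrite Cmod_mult.
  apply Rle_trans with ((Cmod u + 1) * (eps / (Cmod u + 1)))%R; [|right; field; lra].
  apply Rmult_le_compat; [lra|apply Cmod_ge_0|lra|exact HN0].
Qed.

Lemma converges_const L : converges (fun _ => L) L.
Proof. intros eps He. exists 0%nat. intros. replace (L - L) with (RtoC 0) by ring. rewrite Cmod_0. lra. Qed.

Lemma converges_cev (V : nat -> list Z -> C) W x T : (forall lc,
  In lc T -> converges (fun N => V N (fst lc)) (W (fst lc))) ->
  converges (fun N => cev (V N) x T) (cev W x T).
Proof.
  induction T as [|lc T IH]; intros H; [exact (converges_const (RtoC 0))|].
  rewrite cev_cons.
  apply (converges_plus (fun N => peval (snd lc) x * V N (fst lc)) _ (fun N => cev (V N) x T)).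
  - apply converges_scal, H. now left.
  - apply IH. intros; apply H; now right.
Qed.

(** Telescoping the increments from N to infinity gives a rate that depends on D only, hence is
    uniform along the arc. *)
Lemma tame_rate D A L : tame D A -> converges A L -> forall N, (Cmod (A (S N) - L) <= D * / INR (S N))%R.
Proof.
  intros [HD [_ H]] HL N.
  assert (B : forall k, (Cmod (A (S N) - A (S N + k)%nat) <= D * (/ INR (S N) - / INR (S N + k)))%R).
  { induction k as [|k IH].
    - rewrite Nat.add_0_r. replace (A (S N) - A (S N)) with (RtoC 0) by ring. rewrite Cmod_0. lra.
    - replace (S N + S k)%nat with (S (S (N + k))) by lia. replace (S N + k)%nat with (S (N + k)) in IH by lia.
      specialize (H (N + k)%nat). unfold tele in H.
      pose proof (Cmod_triangle (A (S N) - A (S (N + k))) (- (A (S (S (N + k))) - A (S (N + k))))) as T.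
      rewrite Cmod_opp in T.
      replace (A (S N) - A (S (N + k)) + - (A (S (S (N + k))) - A (S (N + k)))) with (A (S N) - A (S (S (N + k))))
        in T by ring.
      lra. }
  apply Rnot_lt_le. intros Hlt. set (e := (Cmod (A (S N) - L) - D * / INR (S N))%R) in *.
  assert (He : (0 < e / 2)%R) by (unfold e; lra). destruct (HL _ He) as [N0 HN0].
  specialize (HN0 (S N + N0)%nat ltac:(lia)).
  specialize (B N0).
  pose proof (Cmod_triangle (A (S N) - A (S N + N0)%nat) (A (S N + N0)%nat - L)) as T.
  replace (A (S N) - A (S N + N0)%nat + (A (S N + N0)%nat - L)) with (A (S N) - L) in T by ring.
  assert (0 < / INR (S N + N0))%R by (apply Rinv_0_lt_compat, lt_0_INR; lia).
  assert (0 <= D * / INR (S N + N0))%R by (apply Rmult_le_pos; lra). unfold e in *. lra.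
Qed.

(** H starts as a shift of the given continuation; each elimination freezes one of its variables at
    0 and replaces T accordingly. *)
Definition represents (t M : R) (n : nat) (H : list C -> C) (T : comb) : Prop :=
  forall s, length s = n -> far M s -> converges (fun N => cev (fun l => zetaU t N (addl l s)) (RtoC t) T) (H s).

Lemma upd_mid (pre : list C) x post w : upd (pre ++ x :: post) (length pre) w = pre ++ w :: post.
Proof. induction pre as [|y pre IH]; simpl; [reflexivity|]. now rewrite IH. Qed.

Lemma upd_insert j x : forall (s : list C) i w,
  firstn j (upd s i w) ++ x :: skipn j (upd s i w) =
  upd (firstn j s ++ x :: skipn j s) (if (i <? j)%nat then i else S i) w \/ (length s < j)%nat.
Proof.
  induction j as [|j IH]; intros s i w.
  - left. destruct i; reflexivity.
  - destruct s as [|y s].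
    + right. simpl. lia.
    + destruct i as [|i]; [left; reflexivity|]. simpl upd. simpl firstn. simpl skipn.
      change (S i <? S j)%nat with (i <? j)%nat.
      destruct (IH s i w) as [E|E]; [left|right; simpl; lia]. simpl. rewrite E. now destruct (i <? j)%nat.
Qed.

Lemma entire_in_mid n H pre post : entire_in n H -> n = S (length pre + length post) ->
  entire (fun w => H (pre ++ w :: post)).
Proof.
  intros HH -> z. destruct (HH (pre ++ RtoC 0 :: post)) with (j := length pre) (z := z) as [d Hd].
  - rewrite length_app. simpl. lia.
  - lia.
  - exists d. revert Hd. apply cder_ext. intros w. now rewrite upd_mid.
Qed.

Lemma entire_in_insert n H j x : (j <= n)%nat -> entire_in (S n) H ->
  entire_in n (fun s => H (firstn j s ++ x :: skipn j s)).
Proof.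
  intros Hj HH s Hs i Hi z.
  set (i' := if (i <? j)%nat then i else S i).
  destruct (HH (firstn j s ++ x :: skipn j s)) with (j := i') (z := z) as [d Hd].
  - rewrite length_app, length_firstn. simpl. rewrite length_skipn. lia.
  - unfold i'. destruct (i <? j)%nat; lia.
  - exists d. revert Hd. apply cder_ext. intros w. destruct (upd_insert j x s i w) as [E|E]; [now rewrite E|lia].
Qed.

(** [arc_uniqueness] applies to [Ph] minus h: it is uniformly small on the arc by [tame_rate] and
    bounded on the circle, hence small at the centre, where [Ph] equals B. *)
Lemma approx_limit r b (h : C -> C) A B : (0 < r)%R -> (b <= r / 3)%R -> entire h -> approx r b A B ->
  (forall w, (r / 3 <= fst w)%R -> converges (fun N => A N w) (h w)) -> converges B (h (RtoC 0)).
Proof.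
  intros Hr Hb Hh [Ph [H1 [[D HD] [H3 H4]]]] HA.
  assert (Hlim : forall w, (Cmod w <= r)%R -> (r / 3 <= fst w)%R -> converges (fun N => Ph N w) (h w)).
  { intros w Hw Hw3 eps He. destruct (H3 w Hw ltac:(lra) (eps / 2)%R ltac:(lra)) as [N1 HN1].
    destruct (HA w Hw3 (eps / 2)%R ltac:(lra)) as [N2 HN2]. exists (max N1 N2). intros N HN.
    specialize (HN1 N ltac:(lia)). specialize (HN2 N ltac:(lia)).
    replace (Ph N w - h w) with (- (A N w - Ph N w) + (A N w - h w)) by ring.
    eapply Rle_trans; [apply Cmod_triangle|]. rewrite Cmod_opp. lra. }
  destruct (entire_bounded_on_circle h r Hh) as [Mh HMh].
  assert (HD0 : (0 <= D)%R) by (apply (HD (RtoC 0)); rewrite Cmod_0; lra).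
  pose proof (arc_uniqueness (fun N w => Ph (S N) w - h w) r (D + Mh) Hr) as U.
  intros eps He. destruct U with (eps := eps) as [N0 HN0]; [| | |exact He|].
  - intros N. entire_tac.
  - intros N z Hz. eapply Rle_trans; [apply Cmod_triangle|]. rewrite Cmod_opp.
    apply Rplus_le_compat; [|now apply HMh].
    apply (HD z). rewrite (on_circle_Cmod r z Hr Hz). lra.
  - intros e Hep. destruct (INR_unbounded (D / e)) as [n0 Hn0]. exists n0. intros N HN z Hz Hz3.
    pose proof (on_circle_Cmod r z Hr Hz) as Hzr.
    eapply Rle_trans; [apply (tame_rate D (fun N => Ph N z)); [apply HD; lra|apply Hlim; lra]|].
    pose proof (INR_S_pos N) as HSN.
    assert (H5 : (D / e < INR (S N))%R) by (eapply Rlt_le_trans; [exact Hn0|apply le_INR; lia]).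
    apply (Rmult_lt_compat_r (e / INR (S N))) in H5; [|now apply Rdiv_lt_0_compat].
    replace (D / e * (e / INR (S N)))%R with (D * / INR (S N))%R in H5 by (field; lra).
    replace (INR (S N) * (e / INR (S N)))%R with e in H5 by (field; lra). lra.
  - exists (S N0). intros N HN. destruct N as [|N]; [lia|]. rewrite <- H4. apply HN0. lia.
Qed.

(** The same transport with zero sequences for A and B, recentred at z. *)
Lemma entire_vanish (f : C -> C) M : entire f -> (forall w, (M <= fst w)%R -> f w = RtoC 0) -> forall z, f z = RtoC 0.
Proof.
  intros Hf H z. set (g := fun w => f (z + w)).
  assert (Hg : entire g).
  { apply (entire_comp f (fun w => z + w) Hf). entire_tac. }
  (* Re w >= r/3 then forces Re (z + w) >= M. *)
  set (r := (3 * (Rabs M + Rabs (fst z) + 1))%R). pose proof (Rabs_pos M). pose proof (Rabs_pos (fst z)).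
  assert (E : converges (fun _ => RtoC 0) (g (RtoC 0))).
  { apply (approx_limit r (r / 3) g (fun _ _ => RtoC 0) (fun _ => RtoC 0)).
    - unfold r; lra.
    - lra.
    - exact Hg.
    - apply approx_zero.
    - intros w Hw. unfold g. rewrite H; [apply converges_const|]. simpl. unfold r in Hw.
      pose proof (Rle_abs M). pose proof (Rle_abs (- fst z)). rewrite Rabs_Ropp in *. lra. }
  pose proof (converges_unique _ _ _ E (converges_const (RtoC 0))) as E1. unfold g in E1.
  now replace (z + RtoC 0) with z in E1 by ring.
Qed.

(** One variable at a time: the first is moved by [entire_vanish] while the others stay far to the
    right, then the induction hypothesis moves the rest. *)
Lemma entire_in_vanish n : forall G M, entire_in n G ->
  (forall s, length s = n -> far M s -> G s = RtoC 0) -> forall s, length s = n -> G s = RtoC 0.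
Proof.
  induction n as [|n IH]; intros G M HG H s Hs.
  - destruct s; [|discriminate]. apply H; [reflexivity|constructor].
  - destruct s as [|z s]; [discriminate|].
    apply (IH (fun s => G (z :: s)) M).
    + intros s' Hs' j Hj w. apply (HG (z :: s') ltac:(simpl; lia) (S j) ltac:(lia) w).
    + intros s' Hs' Hfar. apply (entire_vanish (fun w => G (w :: s')) M).
      * apply (entire_in_mid (S n) G [] s' HG). simpl. lia.
      * intros w Hw. apply H; [simpl; lia|]. now constructor.
    + simpl in Hs. lia.
Qed.

Lemma elim_represents bpre x bpost T : (x <= 0)%Z ->
  (forall lc, In lc T -> Forall2 Z.le (fst lc) (bpre ++ x :: bpost)) ->
  exists T' : comb,
  (forall lc, In lc T' -> Forall2 Z.le (fst lc) (bpre ++ bpost)) /\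
  (forall p, (1 <= p)%nat -> cev (zetaP p) (RtoC (INR p)) T = cev (zetaP p) (RtoC (INR p)) T') /\
  (forall t M H, (t <= 0)%R -> entire_in (length (bpre ++ x :: bpost)) H ->
     represents t M (length (bpre ++ x :: bpost)) H T ->
     exists M', represents t M' (length (bpre ++ bpost))
       (fun s => H (firstn (length bpre) s ++ RtoC 0 :: skipn (length bpre) s)) T').
Proof.
  intros Hx HT. destruct (elim_step bpre x bpost Hx T HT) as [T' [S' [Q' [b A']]]].
  exists T'. split; [exact S'|]. split; [exact Q'|]. intros t M H Ht HH HR.
  (* r/3 exceeds both thresholds: b, where the approximation is valid, and M, where H is the limit
     of the sums. *)
  set (r := (3 * (Rabs b + Rabs M + 1))%R). pose proof (Rabs_pos M). pose proof (Rabs_pos b).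
  pose proof (Rle_abs M). pose proof (Rle_abs b).
  destruct (A' t r Ht ltac:(unfold r; lra)) as [M' AM]. exists (Rmax M M'). intros s Hs Hfar.
  rewrite length_app in Hs. set (spre := firstn (length bpre) s). set (spost := skipn (length bpre) s).
  assert (Es : s = spre ++ spost) by (symmetry; apply firstn_skipn).
  assert (L1 : length spre = length bpre) by (unfold spre; rewrite length_firstn; lia).
  assert (L2 : length spost = length bpost) by (unfold spost; rewrite length_skipn; lia).
  rewrite Es in Hfar. apply Forall_app in Hfar. destruct Hfar as [F1 F2].
  cut (converges (fun N => cev (fun l => zetaU t N (addl l (spre ++ spost))) (RtoC t) T') (H (spre ++ RtoC 0 ::
    spost)));
    [now rewrite <- Es|].
  apply (approx_limit r b (fun w => H (spre ++ w ::
    spost)) (fun N w => cev (fun l => zetaU t N (addl l (spre ++ w :: spost))) (RtoC t) T)).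
  - unfold r; lra.
  - unfold r; lra.
  - apply (entire_in_mid _ H spre spost HH). rewrite length_app. simpl. lia.
  - apply AM; try assumption; (eapply far_mono; [apply Rmax_r|eassumption]).
  - intros w Hw. apply HR.
    + rewrite !length_app. simpl. lia.
    + apply Forall_mid; [eapply far_mono; [apply Rmax_l|exact F1]| |eapply far_mono; [apply Rmax_l|exact F2]].
      unfold r in Hw. lra.
Qed.

Definition pos_part (b : list Z) : list Z := filter (fun x => Z.ltb 0 x) b.

(** The entries removed are the nonpositive ones of the common bound b. The resulting indices may
    contain new nonpositive entries, which are left to the induction on depth in [reduction]. *)
Lemma elim n : forall b T, length b = n -> (forall lc, In lc T -> Forall2 Z.le (fst lc) b) ->
  exists T' : comb,
  (forall lc, In lc T' -> Forall2 Z.le (fst lc) (pos_part b)) /\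
  (forall p, (1 <= p)%nat -> cev (zetaP p) (RtoC (INR p)) T = cev (zetaP p) (RtoC (INR p)) T') /\
  (forall t M H, (t <= 0)%R -> entire_in (length b) H -> represents t M (length b) H T ->
     exists M' H', entire_in (length (pos_part b)) H' /\ represents t M' (length (pos_part b)) H' T' /\
       H' (repeat (RtoC 0) (length (pos_part b))) = H (repeat (RtoC 0) (length b))).
Proof.
  induction n as [|n IH]; intros b T Hb HT.
  - destruct b; [|discriminate]. exists T. split; [exact HT|]. split; [reflexivity|].
    intros t M H Ht HH HR. exists M, H. auto.
  - destruct (forallb (fun x => Z.ltb 0 x) b) eqn:Eb.
    + assert (Ep : pos_part b = b).
      { unfold pos_part. clear -Eb. induction b as [|x b IHb]; [reflexivity|]. simpl in *.
        apply andb_prop in Eb. destruct Eb as [E1 E2]. now rewrite E1, IHb. }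
      rewrite Ep. exists T. split; [exact HT|]. split; [reflexivity|].
      intros t M H Ht HH HR. exists M, H. auto.
    + assert (Hex : exists bpre x bpost, b = bpre ++ x :: bpost /\ (x <= 0)%Z).
      { clear -Eb. induction b as [|x b IHb]; [discriminate|]. simpl in Eb. destruct (Z.ltb 0 x) eqn:Ex.
        - destruct IHb as [p [y [q [-> Hy]]]]; [exact Eb|]. exists (x :: p), y, q. auto.
        - exists [], x, b. split; [reflexivity|]. apply Z.ltb_ge in Ex. exact Ex. }
      destruct Hex as [bpre [x [bpost [-> Hx]]]].
      destruct (elim_represents bpre x bpost T Hx HT) as [T1 [S1 [Q1 R1]]].
      assert (L1 : length (bpre ++ bpost) = n) by (rewrite length_app in *; simpl in Hb; lia).
      destruct (IH (bpre ++ bpost) T1 L1 S1) as [T2 [S2 [Q2 R2]]].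
      assert (Ep : pos_part (bpre ++ x :: bpost) = pos_part (bpre ++ bpost)).
      { unfold pos_part. rewrite !filter_app. simpl.
        now replace (0 <? x)%Z with false by (symmetry; apply Z.ltb_ge; lia). }
      rewrite Ep. exists T2. split; [exact S2|]. split; [intros; rewrite Q1, Q2 by assumption; reflexivity|].
      intros t M H Ht HH HR. destruct (R1 t M H Ht HH HR) as [M1 HR1].
      assert (HH1 : entire_in (length (bpre ++ bpost)) (fun s => H (firstn (length bpre) s ++ RtoC 0 ::
        skipn (length bpre) s))).
      { apply entire_in_insert; [rewrite length_app; lia|]. rewrite length_app in *. simpl in HH.
        now rewrite <- plus_n_Sm in HH. }
      destruct (R2 t M1 _ Ht HH1 HR1) as [M2 [H2 [E2 [HR2 V2]]]]. exists M2, H2. split; [exact E2|].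
      split; [exact HR2|].
      rewrite V2. f_equal. rewrite !length_app, repeat_app. simpl length.
      rewrite <- (repeat_length (RtoC 0) (length bpre)) at 1 3.
      rewrite firstn_app, skipn_app, firstn_all, skipn_all, Nat.sub_diag. simpl. rewrite app_nil_r.
      rewrite repeat_app. reflexivity.
Qed.

(** * Continuations and their uniqueness *)

Lemma filterlim_converges (A : nat -> C) (L : C) : filterlim A eventually (locally L) -> converges A L.
Proof.
  intros H eps He.
  (* Balls of C as a uniform space are products, so each coordinate gets half of eps. *)
  assert (He2 : (0 < eps / 2)%R) by lra.
  destruct (proj1 (filterlim_locally (U := C_UniformSpace) A L) H (mkposreal _ He2)) as [N0 HN0].
  exists N0. intros N HN. destruct (HN0 N HN) as [H1 H2].
  unfold ball in H1, H2; simpl in H1, H2. unfold AbsRing_ball, abs, minus, plus, opp in H1, H2; simpl in H1, H2.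
  eapply Rle_trans; [apply Cmod_le_abs|]. simpl. unfold Rminus. lra.
Qed.

Definition continuation (t : R) (d : nat) (F : list C -> C) : Prop :=
  entire_in d F /\
  forall s, conv_region d s -> filterlim (fun N => zetaU_trunc s (RtoC t) N) eventually (locally (F s)).

(** A relation rather than a function: the continuation is a datum supplied by [zetaS]. *)
Definition zeta_value (t : R) (k : list Z) (v : C) : Prop :=
  exists F, continuation t (length k) F /\ F (map Z_to_C k) = v.

Lemma continuation_converges t d F s : (t <= 0)%R -> continuation t d F -> length s = d -> far 2 s ->
  converges (fun N => zetaU t N s) (F s).
Proof.
  intros Ht [_ HF] Hs Hfar eps He.
  assert (HC : conv_region d s).
  { split; [exact Hs|]. eapply List.Forall_impl; [|exact Hfar]. simpl. intros; lra. }
  destruct (filterlim_converges _ _ (HF s HC) eps He) as [N0 HN0]. exists N0. intros N HN.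
  rewrite <- zetaU_trunc_nest by exact Ht. now apply HN0.
Qed.

Lemma continuation_unique t d F F' : (t <= 0)%R -> continuation t d F -> continuation t d F' ->
  forall s, length s = d -> F s = F' s.
Proof.
  intros Ht HF HF' s Hs.
  assert (E : F s - F' s = RtoC 0).
  { apply (entire_in_vanish d (fun s => F s - F' s) 2); [| |exact Hs].
    - intros s' Hs' j Hj z. destruct (proj1 HF s' Hs' j Hj z) as [d1 H1].
      destruct (proj1 HF' s' Hs' j Hj z) as [d2 H2].
      exists (minus d1 d2). apply (is_derive_minus (K := C_AbsRing) (V := C_NormedModule)); assumption.
    - intros s' Hs' Hfar. pose proof (converges_unique _ _ _ (continuation_converges t d F s' Ht HF Hs' Hfar)
        (continuation_converges t d F' s' Ht HF' Hs' Hfar)) as E. rewrite E. ring. }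
  replace (F s) with ((F s - F' s) + F' s) by ring. rewrite E. ring.
Qed.

Lemma zeta_value_eq t k v F : (t <= 0)%R -> zeta_value t k v -> continuation t (length k) F -> v = F (map Z_to_C k).
Proof.
  intros Ht [F' [HF' <-]] HF. apply (continuation_unique t (length k)); auto. now rewrite length_map.
Qed.

Lemma addl_upd l s j w : length l = length s -> (j < length s)%nat ->
  addl l (upd s j w) = upd (addl l s) j (Zadd_C (nth j l 0%Z) w).
Proof.
  revert s j; induction l as [|k l IH]; intros [|z s] j HL Hj; try discriminate; [simpl in Hj; lia|].
  destruct j as [|j]; [reflexivity|]. simpl in *. f_equal. apply IH; lia.
Qed.

Lemma entire_in_addl d F l : length l = d -> entire_in d F -> entire_in d (fun s => F (addl l s)).
Proof.
  intros Hl HF s Hs j Hj z.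
  assert (HL : length (addl l s) = d) by (rewrite addl_length; congruence).
  destruct (HF (addl l s) HL j Hj (Zadd_C (nth j l 0%Z) z)) as [e He].
  exists (RtoC 1 * e). apply (cder_ext (fun w => F (upd (addl l s) j (Zadd_C (nth j l 0%Z) w)))).
  - intros w. rewrite addl_upd; [reflexivity|congruence|lia].
  - apply (cder_comp (fun w => F (upd (addl l s) j w)) (Zadd_C (nth j l 0%Z))); [exact He|].
    unfold Zadd_C. replace (RtoC 1) with (RtoC 0 + RtoC 1) by ring. apply cder_plus; [apply cder_const|apply cder_id].
Qed.

Lemma entire_in_cev d (G : list Z -> list C -> C) x T :
  (forall lc, In lc T -> entire_in d (G (fst lc))) -> entire_in d (fun s => cev (fun l => G l s) x T).
Proof.
  intros HG s Hs j Hj z. unfold cev.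
  induction T as [|lc T IH].
  - exists (RtoC 0). apply (cder_const (RtoC 0)).
  - destruct IH as [d2 H2]; [intros; apply HG; now right|].
    destruct (HG lc (or_introl eq_refl) s Hs j Hj z) as [d1 H1].
    exists (peval (snd lc) x * d1 + d2).
    apply (cder_ext (fun w => peval (snd lc) x * G (fst lc) (upd s j w) + csum (fun lc => peval (snd lc) x * G (fst
      lc) (upd s j w)) T)).
    + reflexivity.
    + apply cder_plus; [now apply cder_cmult|exact H2].
Qed.

Lemma far_uniform M (T : comb) : exists M', forall d s, (forall lc, In lc T -> length (fst lc) = d) -> length s = d ->
  far M' s -> forall lc, In lc T -> far M (addl (fst lc) s).
Proof.
  induction T as [|[l c] T [M1 IH]].
  - exists 0%R. intros d s _ _ _ lc [].
  - exists (Rmax (M + Zabs_sum l) M1). intros d s HT Hs Hfar lc [<-|Hlc].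
    + apply addl_far; [rewrite (HT (l, c)); [auto|now left]|]. eapply far_mono; [apply Rmax_l|exact Hfar].
    + apply (IH d); auto; [intros; apply HT; now right|]. eapply far_mono; [apply Rmax_r|exact Hfar].
Qed.

(** H and the combination of shifts of F are limits of the same sums far to the right; both are
    entire, so they still agree at the origin. *)
Lemma represents_value t M H T d F : (t <= 0)%R -> (forall lc, In lc T -> length (fst lc) = d) ->
  entire_in d H -> represents t M d H T -> continuation t d F ->
  H (repeat (RtoC 0) d) = cev (fun l => F (map Z_to_C l)) (RtoC t) T.
Proof.
  intros Ht HT HH HR HF.
  destruct (far_uniform 2 T) as [M' HM'].
  set (G := fun s => H s - cev (fun l => F (addl l s)) (RtoC t) T).
  assert (HG : G (repeat (RtoC 0) d) = RtoC 0).
  { apply (entire_in_vanish d G (Rmax M M')); [| |apply repeat_length].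
    - intros s Hs j Hj z. destruct (HH s Hs j Hj z) as [d1 H1].
      assert (E : entire_in d (fun s => cev (fun l => F (addl l s)) (RtoC t) T)).
      { apply (entire_in_cev d (fun l s => F (addl l s))). intros lc Hlc.
        apply entire_in_addl; [now apply HT|apply HF]. }
      destruct (E s Hs j Hj z) as [d2 H2].
      exists (minus d1 d2). apply (is_derive_minus (K := C_AbsRing) (V := C_NormedModule)); assumption.
    - intros s Hs Hfar. unfold G.
      assert (C1 : converges (fun N => cev (fun l => zetaU t N (addl l s)) (RtoC t) T) (H s)).
      { apply HR; [exact Hs|]. eapply far_mono; [apply Rmax_l|exact Hfar]. }
      assert (C2 : converges (fun N => cev (fun l => zetaU t N (addl l s)) (RtoC t) T) (cev (fun l => F (addl l s))
        (RtoC t) T)).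
      { apply (converges_cev (fun N l => zetaU t N (addl l s)) (fun l => F (addl l s))). intros lc Hlc.
        apply (continuation_converges t d); auto.
        - rewrite addl_length; rewrite HT; auto.
        - apply (HM' d); auto. eapply far_mono; [apply Rmax_r|exact Hfar]. }
      rewrite (converges_unique _ _ _ C1 C2). ring. }
  unfold G in HG.
  replace (H (repeat (RtoC 0) d)) with ((H (repeat (RtoC 0) d) - cev (fun l => F (addl l (repeat (RtoC 0) d))) (RtoC
    t) T)
    + cev (fun l => F (addl l (repeat (RtoC 0) d))) (RtoC t) T) by ring.
  rewrite HG, Cplus_0_l. apply csum_ext. intros lc Hlc. f_equal. rewrite <- (HT lc Hlc). now rewrite addl_0.
Qed.

(** * Reduction to positive indices *)

Definition reduces (k : list Z) (L : comb) : Prop :=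
  (forall p, (1 <= p)%nat -> zetaP p k = cev (zetaP p) (RtoC (INR p)) L) /\
  (forall t v val, (t <= 0)%R -> zeta_value t k v ->
     (forall lc, In lc L -> zeta_value t (fst lc) (val (fst lc))) -> v = cev val (RtoC t) L).

Definition admissible (d : nat) (w : Z) (l : list Z) : Prop :=
  positive_index l /\ (depth l <= d)%nat /\ (weight l <= w)%Z.

(** A positive entry is bounded by its counterpart in b, and a nonpositive one counts as 0. This
    carries the bounds on depth and weight through the recursion. *)
Lemma pos_part_le l b : Forall2 Z.le l b -> List.Forall (fun x => 0 < x)%Z b ->
  (npos l <= length b)%nat /\ (spos l <= weight b)%Z.
Proof.
  unfold npos, spos, weight. induction 1 as [|x y l b Hxy H IH]; intros Hb; [simpl; lia|].
  inversion Hb as [|? ? Hy Hb']; subst. destruct (IH Hb') as [I1 I2]. simpl.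
  destruct (Z.ltb 0 x) eqn:E; simpl; [lia|]. apply Z.ltb_ge in E. lia.
Qed.

Lemma pos_part_pos b : List.Forall (fun x => 0 < x)%Z (pos_part b).
Proof. apply List.Forall_forall. intros x Hx. apply filter_In in Hx. now apply Z.ltb_lt. Qed.

Lemma combine_reductions d w (T : comb) :
  (forall lc, In lc T -> exists L, (forall l, In l L -> admissible d w (fst l)) /\ reduces (fst lc) L) ->
  exists L : comb, (forall l, In l L -> admissible d w (fst l)) /\
  (forall p, (1 <= p)%nat -> cev (zetaP p) (RtoC (INR p)) T = cev (zetaP p) (RtoC (INR p)) L) /\
  (forall t u val, (t <= 0)%R -> (forall lc, In lc T -> zeta_value t (fst lc) (u (fst lc))) ->
     (forall lc, In lc L -> zeta_value t (fst lc) (val (fst lc))) -> cev u (RtoC t) T = cev val (RtoC t) L).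
Proof.
  induction T as [|[l c] T IH]; intros HT.
  - exists []. split; [easy|]. split; reflexivity.
  - destruct IH as [L2 [A2 [Q2 S2]]]; [intros; apply HT; now right|].
    destruct (HT (l, c) (or_introl eq_refl)) as [L1 [A1 [Q1 S1]]]. cbn [fst] in Q1, S1.
    exists (comb_scale c L1 ++ L2). split; [|split].
    + intros lc Hlc. apply in_app_iff in Hlc. destruct Hlc as [Hlc|Hlc]; [|now apply A2].
      apply in_map_iff in Hlc. destruct Hlc as [lc1 [<- Hlc]]. exact (A1 lc1 Hlc).
    + intros p Hp. rewrite cev_cons, cev_app, cev_scale, <- Q1, Q2 by exact Hp. reflexivity.
    + intros t u val Ht Hu Hval. rewrite cev_cons, cev_app, cev_scale. cbn [fst snd].
      rewrite (S2 t u val), (S1 t (u l) val); auto.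
      * apply (Hu (l, c)). now left.
      * intros lc Hlc. apply (Hval (fst lc, pmul c (snd lc))). apply in_app_iff. left. apply in_map_iff.
        now exists lc.
      * intros lc Hlc. apply Hu. now right.
      * intros lc Hlc. apply Hval. apply in_app_iff. now right.
Qed.

(** An index with a nonpositive entry becomes a combination of indices of smaller depth dominated by
    its positive part, to which the induction hypothesis applies. *)
Lemma reduction n : forall k, (length k <= n)%nat ->
  exists L : comb, (forall l, In l L -> admissible (npos k) (spos k) (fst l)) /\ reduces k L.
Proof.
  induction n as [|n IH]; intros k Hk.
  - destruct k; [|simpl in Hk; lia]. exists [([], [1%Q])]. split; [|split].
    + intros l [<-|[]]. split; [constructor|]. cbn. lia.
    + intros p Hp. now rewrite cev_single.
    + intros t v val Ht Hv Hval. rewrite cev_single.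
      destruct (Hval ([], [1%Q]) (or_introl eq_refl)) as [F [HF E]]. cbn [fst] in HF, E.
      now rewrite (zeta_value_eq t [] v F Ht Hv HF), E.
  - destruct (forallb (fun x => Z.ltb 0 x) k) eqn:Ek.
    + assert (Hpos : List.Forall (fun x => 0 < x)%Z k).
      { apply List.Forall_forall. intros x Hx. apply Z.ltb_lt. exact (proj1 (forallb_forall _ k) Ek x Hx). }
      assert (Ep : pos_part k = k).
      { unfold pos_part. clear -Ek. induction k as [|x b IHb]; [reflexivity|]. simpl in *.
        apply andb_prop in Ek. destruct Ek as [E1 E2]. now rewrite E1, IHb. }
      exists [(k, [1%Q])]. split; [|split].
      * intros l [<-|[]]. split; [exact Hpos|]. unfold npos, spos, depth, weight. fold (pos_part k). rewrite Ep.
        cbn [fst]. lia.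
      * intros p Hp. now rewrite cev_single.
      * intros t v val Ht Hv Hval. rewrite cev_single.
        destruct (Hval (k, [1%Q]) (or_introl eq_refl)) as [F [HF E]]. cbn [fst] in HF, E.
        now rewrite (zeta_value_eq t k v F Ht Hv HF), E.
    + assert (Hlt : (length (pos_part k) < length k)%nat).
      { unfold pos_part. clear -Ek. induction k as [|x b IHb]; [discriminate|]. simpl in *.
        destruct (Z.ltb 0 x); simpl; [apply IHb in Ek; lia|]. pose proof (filter_length_le (fun x => Z.ltb 0 x) b).
        lia. }
      set (d := length (pos_part k)) in *.
      assert (Hrefl : Forall2 Z.le k k) by (clear; induction k; constructor; auto; lia).
      destruct (elim (length k) k [(k, [1%Q])] eq_refl) as [T' [S' [Q' A']]].
      { intros lc [<-|[]]. exact Hrefl. }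
      assert (Hlen : forall lc, In lc T' -> length (fst lc) = d).
      { intros lc Hlc. apply S' in Hlc. now apply Forall2_length in Hlc. }
      destruct (combine_reductions (npos k) (spos k) T') as [L [AL [QL SL]]].
      { intros lc Hlc. destruct (IH (fst lc)) as [L1 [A1 R1]]; [rewrite (Hlen lc Hlc); lia|].
        exists L1. split; [|exact R1]. intros l Hl. destruct (A1 l Hl) as [P1 [P2 P3]].
        destruct (pos_part_le _ _ (S' lc Hlc) (pos_part_pos k)) as [B1 B2].
        unfold admissible, npos, spos in *. unfold pos_part, weight in B1, B2. split; [exact P1|].
        unfold weight in *. lia. }
      (* The first entry has coefficient 0; it provides the continuation in depth d. *)
      exists ((repeat 1%Z d, []) :: L). split; [|split].
      * intros l [<-|Hl]; [|now apply AL]. cbn [fst]. split; [|split].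
        -- apply List.Forall_forall. intros x Hx. apply repeat_spec in Hx. lia.
        -- unfold depth. rewrite repeat_length. unfold npos. fold (pos_part k). fold d. lia.
        -- unfold spos. fold (pos_part k). pose proof (pos_part_pos k) as HP. unfold d, weight. clear -HP.
           induction HP as [|x l Hx HP IHP]; cbn [repeat length fold_right]; lia.
      * intros p Hp. rewrite cev_cons, <- QL, <- Q' by exact Hp.
        rewrite cev_single. unfold peval; simpl. ring.
      * intros t v val Ht Hv Hval. rewrite cev_cons. cbn [fst snd].
        destruct (Hval (repeat 1%Z d, []) (or_introl eq_refl)) as [F [HF _]]. cbn [fst] in HF.
        rewrite repeat_length in HF.
        destruct Hv as [Fk [HFk Ev]].
        destruct (far_uniform 2 [(k, [1%Q])]) as [M HM].
        (* Shifting the variables by k puts the value wanted at the origin. *)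
        destruct (A' t M (fun s => Fk (addl k s)) Ht) as [M' [H' [E' [R' V']]]].
        -- apply entire_in_addl; [reflexivity|apply HFk].
        -- intros s Hs Hfar. replace (Fk (addl k s)) with (cev (fun l => Fk (addl l s)) (RtoC t) [(k, [1%Q])])
             by (now rewrite cev_single).
           apply (converges_cev (fun N l => zetaU t N (addl l s)) (fun l => Fk (addl l s))). intros lc [<-|[]].
           cbn [fst].
           apply (continuation_converges t (length k)); auto; [now rewrite addl_length|].
           apply (HM (length k) s) with (lc := (k, [1%Q])); auto; [intros lc [<-|[]]; reflexivity|now left].
        -- rewrite addl_0 in V'. rewrite <- Ev, <- V'. fold d.
           rewrite (represents_value t M' H' T' d F Ht Hlen E' R' HF).
           rewrite (SL t (fun l => F (map Z_to_C l)) val Ht); [unfold peval; simpl; ring| |].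
           ++ intros lc Hlc. exists F. rewrite (Hlen lc Hlc). now split.
           ++ intros lc Hlc. apply Hval. now right.
Qed.

(** * Values of zeta_p and Taylor coefficients *)

Lemma Q2C_Qeq p q : (p == q)%Q -> Q2C p = Q2C q.
Proof. intros H. unfold Q2C. f_equal. now apply Qeq_eqR. Qed.

Lemma Q2C_inj p q : Q2C p = Q2C q -> (p == q)%Q.
Proof. intros H. apply eqR_Qeq. now apply RtoC_inj. Qed.

Lemma Q2C_Qpower_nat q n : Q2C (Qpower q (Z.of_nat n)) = Cpow (Q2C q) n.
Proof.
  induction n as [|n IH]; [exact Q2C_1|].
  rewrite (Q2C_Qeq _ (q * Qpower q (Z.of_nat n))%Q), Q2C_mult, IH; [reflexivity|].
  rewrite Nat2Z.inj_succ. destruct n as [|n].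
  - simpl. ring.
  - rewrite <- Z.add_1_l. rewrite Qpower_plus'; [simpl; ring|lia].
Qed.

Lemma Q2C_Qpower_Wt n a : Q2C (Qpower (inject_Z (Z.of_nat (S n))) (- a)) = Wt (Z_to_C a) (INR (S n)).
Proof.
  assert (Hx : INR (S n) <> 0%R) by now apply not_0_INR.
  assert (HC : RtoC (INR (S n)) <> RtoC 0) by (intros E; apply RtoC_inj in E; auto).
  destruct (Z.le_gt_cases a 0) as [Ha|Ha].
  - replace (- a)%Z with (Z.of_nat (Z.to_nat (- a))) by lia. rewrite Q2C_Qpower_nat, Q2C_inject_nat, <- RtoC_pow.
    rewrite <- Wt_opp_nat by assumption. do 2 f_equal. lia.
  - replace a with (Z.of_nat (Z.to_nat a)) by lia. set (m := Z.to_nat a).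
    rewrite (Q2C_Qeq _ _ (Qpower_opp _ _)).
    assert (E : Q2C (Qpower (inject_Z (Z.of_nat (S n))) (Z.of_nat m)) = RtoC (INR (S n) ^ m))
      by (now rewrite Q2C_Qpower_nat, Q2C_inject_nat, <- RtoC_pow).
    assert (Hm : RtoC (INR (S n) ^ m) <> RtoC 0) by (intros E0; apply RtoC_inj in E0; revert E0;
      now apply pow_nonzero).
    set (u := Qpower (inject_Z (Z.of_nat (S n))) (Z.of_nat m)) in *.
    assert (Hu : ~ (u == 0)%Q) by (intros H; apply Q2C_Qeq in H; rewrite Q2C_0, E in H; auto).
    assert (E1 : Q2C (/ u) * RtoC (INR (S n) ^ m) = RtoC 1).
    { rewrite <- E, <- Q2C_mult, <- Q2C_1. apply Q2C_Qeq. field. exact Hu. }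
    assert (E2 : Wt (Z_to_C (Z.of_nat m)) (INR (S n)) * RtoC (INR (S n) ^ m) = RtoC 1).
    { rewrite <- pw_nat by assumption. unfold Wt. rewrite <- pw_plus. unfold Z_to_C. rewrite <- INR_IZR_INZ.
      replace (- RtoC (INR m) + RtoC (INR m)) with (RtoC 0) by ring. apply pw_0. }
    transitivity (Q2C (/ u) * RtoC (INR (S n) ^ m) / RtoC (INR (S n) ^ m)); [now field|].
    rewrite E1, <- E2. now field.
Qed.

Lemma Q2C_qaux rk N : Q2C (qaux rk N) = nest (map Wt (map Z_to_C (rev rk))) (Xpos N).
Proof.
  revert N. induction rk as [|a rk IH]; intros N; [exact Q2C_1|].
  simpl rev. rewrite !map_app. simpl qaux. unfold Qsum_lt, Xpos.
  match goal with |- Q2C (fold_right _ _ (map ?F ?l)) = _ => change (Q2C (qsum F l) = nest (map Wt (map Z_to_C (rev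
    rk)) ++ [Wt (Z_to_C a)]) (map INR l)) end.
  rewrite Q2C_qsum. induction (N - 1)%nat as [|n IHn].
  - cbn [seq map]. now rewrite nest_app_nil.
  - rewrite csum_seq_S, seq_S, map_app. cbn [map]. rewrite nest_snoc, <- IHn.
    rewrite Q2C_mult, IH. change (1 + n)%nat with (S n). rewrite Q2C_Qpower_Wt.
    unfold Xpos. replace (S n - 1)%nat with n by lia. ring.
Qed.

Lemma Q2C_zeta_p k p : Q2C (zeta_p k p) = zetaP p k.
Proof. unfold zeta_p, zetaP. now rewrite Q2C_qaux, rev_involutive. Qed.

(** * Power series determined by their sums at small negative t *)

Definition pser (a : nat -> C) (t : C) (N : nat) : C := csum (fun n => a n * Cpow t n) (seq 0 (S N)).

Lemma is_series_pser (a : nat -> C) t v :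
  is_series (K := C_AbsRing) (V := C_NormedModule) (fun n => Cmult (a n) (Cpow t n)) v -> converges (pser a t) v.
Proof.
  intros H. apply filterlim_converges.
  apply (filterlim_ext (sum_n (G := C_NormedModule) (fun n => Cmult (a n) (Cpow t n)))); [|exact H].
  intros N. unfold pser. induction N as [|N IH].
  - rewrite sum_O. symmetry. apply (Cplus_0_r (a 0%nat * Cpow t 0)).
  - rewrite sum_Sn, IH, (csum_seq_S _ 0 (S N)). reflexivity.
Qed.

Lemma pser_shift a t N : pser a t (S N) = a 0%nat + t * pser (fun n => a (S n)) t N.
Proof.
  unfold pser. change (seq 0 (S (S N))) with (0%nat :: seq 1 (S N)).
  rewrite csum_cons, <- seq_shift, csum_map, <- csum_scal.
  simpl Cpow at 1. rewrite Cmult_1_r. f_equal. apply csum_ext. intros n _. simpl. ring.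
Qed.

Lemma converges_S A L : converges (fun N => A (S N)) L -> converges A L.
Proof.
  intros H eps He. destruct (H eps He) as [N0 HN0]. exists (S N0). intros [|N] HN; [lia|]. apply HN0. lia.
Qed.

Lemma converges_S_inv A L : converges A L -> converges (fun N => A (S N)) L.
Proof. intros H eps He. destruct (H eps He) as [N0 HN0]. exists N0. intros N HN. apply HN0. lia. Qed.

Lemma converges_ext A B L : (forall N, A N = B N) -> converges A L -> converges B L.
Proof.
  intros E H eps He. destruct (H eps He) as [N0 HN0]. exists N0. intros N HN. rewrite <- E. now apply HN0.
Qed.

Lemma pser_plus a b t N : pser (fun n => a n + b n) t N = pser a t N + pser b t N.
Proof. unfold pser. rewrite <- csum_plus. apply csum_ext. intros. ring. Qed.

Lemma pser_scal u a t N : pser (fun n => u * a n) t N = u * pser a t N.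
Proof. unfold pser. rewrite <- csum_scal. apply csum_ext. intros. ring. Qed.

Lemma poly_mul_coef_cons q c a n :
  poly_mul_coef (q :: c) a n = Q2C q * a n + match n with O => RtoC 0 | S n' => poly_mul_coef c a n' end.
Proof.
  unfold poly_mul_coef. change (Csum_list (map ?f ?l)) with (csum f l).
  change (seq 0 (S n)) with (0%nat :: seq 1 n). rewrite csum_cons, Nat.sub_0_r. cbn [nth]. f_equal.
  destruct n as [|n]; [reflexivity|]. rewrite <- seq_shift, csum_map. apply csum_ext. intros i _. reflexivity.
Qed.

Lemma poly_mul_coef_nil a n : poly_mul_coef [] a n = RtoC 0.
Proof.
  unfold poly_mul_coef. change (Csum_list (map ?f ?l)) with (csum f l).
  apply csum_zero. intros j _. replace (nth j [] 0%Q) with 0%Q by (now destruct j). fold (Q2C 0). rewrite Q2C_0. ring.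
Qed.

Lemma pser_poly_mul c a t v : converges (pser a t) v -> converges (pser (poly_mul_coef c a) t) (peval c t * v).
Proof.
  intros H. induction c as [|q c IH].
  - apply (converges_ext (fun _ => RtoC 0)).
    + intros N. symmetry. apply csum_zero. intros n _. rewrite poly_mul_coef_nil. ring.
    + replace (peval [] t * v) with (RtoC 0) by (unfold peval; simpl; ring). apply converges_const.
  - rewrite peval_cons. replace ((Q2C q + t * peval c t) * v) with (Q2C q * v + t * (peval c t * v)) by ring.
    set (b := fun n => match n with O => RtoC 0 | S n' => poly_mul_coef c a n' end).
    apply (converges_ext (fun N => Q2C q * pser a t N + pser b t N)).
    + intros N. rewrite <- pser_scal, <- pser_plus. unfold pser. apply csum_ext. intros n _.
      now rewrite poly_mul_coef_cons.
    + apply (converges_plus (fun N => Q2C q * pser a t N)); [now apply converges_scal|].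
      apply converges_S. apply (converges_ext (fun N => t * pser (poly_mul_coef c a) t N)).
      * intros N. rewrite pser_shift. symmetry. apply Cplus_0_l.
      * now apply converges_scal.
Qed.

Lemma converges_bounded A L : converges A L -> exists B, forall N, (Cmod (A N) <= B)%R.
Proof.
  intros H. destruct (H 1%R Rlt_0_1) as [N0 HN0].
  assert (HB : forall n, exists B, forall N, (N < n)%nat -> (Cmod (A N) <= B)%R).
  { induction n as [|n [B IH]]; [exists 0%R; intros; lia|]. exists (Rmax B (Cmod (A n))). intros N HN.
    destruct (Nat.eq_dec N n) as [->|Hn]; [apply Rmax_r|]. eapply Rle_trans; [apply IH; lia|apply Rmax_l]. }
  destruct (HB N0) as [B HB0]. exists (Rmax B (Cmod L + 1)). intros N.
  destruct (Nat.lt_ge_cases N N0) as [Hlt|Hge].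
  - eapply Rle_trans; [now apply HB0|apply Rmax_l].
  - eapply Rle_trans; [|apply Rmax_r]. replace (A N) with ((A N - L) + L) by ring.
    eapply Rle_trans; [apply Cmod_triangle|]. specialize (HN0 N Hge). lra.
Qed.

Lemma pser_tail_bound (b : nat -> C) (u q B : R) : (0 <= B)%R -> (0 <= q <= 1 / 2)%R -> u <> 0%R ->
  (forall n, (Cmod (b n * Cpow (RtoC u) n) <= B)%R) -> forall N,
  (Cmod (pser b (RtoC (q * u)) N - b 0%nat) <= 2 * B * q)%R.
Proof.
  intros HB Hq Hu Hb N.
  (* Strengthened for the induction: the next term is at most B q^(N+1), while the bound grows by 2
     B q^(N+1) (1 - q), which suffices since q <= 1/2. *)
  assert (H : (Cmod (pser b (RtoC (q * u)) N - b 0%nat) <= 2 * B * q - 2 * B * q * q ^ N)%R).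
  { induction N as [|N IH].
    - unfold pser. cbn [seq]. rewrite csum_cons, csum_nil. simpl Cpow.
      replace (b 0%nat * RtoC 1 + RtoC 0 - b 0%nat) with (RtoC 0) by ring. rewrite Cmod_0. simpl. lra.
    - unfold pser. rewrite (csum_seq_S _ 0 (S N)). change (0 + S N)%nat with (S N). fold (pser b (RtoC (q * u)) N).
      replace (pser b (RtoC (q * u)) N + b (S N) * Cpow (RtoC (q * u)) (S N) - b 0%nat) with
        ((pser b (RtoC (q * u)) N - b 0%nat) + RtoC (q ^ S N) * (b (S N) * Cpow (RtoC u) (S N))).
      2:{ rewrite <- !RtoC_pow, Rpow_mult_distr, (RtoC_mult (q ^ S N)). ring. }
      eapply Rle_trans; [apply Cmod_triangle|]. rewrite Cmod_mult, Cmod_R, Rabs_pos_eq by (apply pow_le; lra).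
      pose proof (Hb (S N)) as H1. assert (Hqp : (0 <= q ^ S N)%R) by (apply pow_le; lra).
      assert (H2 : (q ^ S N * Cmod (b (S N) * Cpow (RtoC u) (S N)) <= q ^ S N * B)%R) by (now apply
        Rmult_le_compat_l).
      assert (H3 : (0 <= B * q ^ S N)%R) by (now apply Rmult_le_pos).
      assert (H4 : (B * q ^ S N * q <= B * q ^ S N * (1 / 2))%R) by (apply Rmult_le_compat_l; lra).
      simpl pow in *. lra. }
  eapply Rle_trans; [exact H|]. assert (0 <= 2 * B * q * q ^ N)%R; [|lra].
  apply Rmult_le_pos; [|apply pow_le; lra]. apply Rmult_le_pos; lra.
Qed.

(** Convergence at one point u bounds the terms there; at q u with q small the series is then close
    to its constant term, while its sum is 0. *)
Lemma pser_zero_first (b : nat -> C) rho : (0 < rho)%R ->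
  (forall t : R, (- rho < t < 0)%R -> converges (pser b (RtoC t)) (RtoC 0)) -> b 0%nat = RtoC 0.
Proof.
  intros Hr H. set (u := (- (rho / 2))%R).
  destruct (converges_bounded _ _ (H u ltac:(unfold u; lra))) as [B HB].
  assert (HB0 : (0 <= B)%R) by (eapply Rle_trans; [apply Cmod_ge_0|apply (HB 0%nat)]).
  assert (Hb : forall n, (Cmod (b n * Cpow (RtoC u) n) <= 2 * B)%R).
  { intros [|n].
    - pose proof (HB 0%nat) as H0. unfold pser in H0. cbn [seq] in H0. rewrite csum_cons, csum_nil, Cplus_0_r in H0.
      lra.
    - pose proof (HB (S n)) as H1. pose proof (HB n) as H0. unfold pser in H1. rewrite (csum_seq_S _ 0 (S n)) in H1.
      change (0 + S n)%nat with (S n) in H1. fold (pser b (RtoC u) n) in H1.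
      set (x := b (S n) * Cpow (RtoC u) (S n)) in *.
      pose proof (Cmod_triangle (pser b (RtoC u) n + x) (- pser b (RtoC u) n)) as T. rewrite Cmod_opp in T.
      replace (pser b (RtoC u) n + x + - pser b (RtoC u) n) with x in T by ring. lra. }
  apply Cmod_eq_0. apply Rle_antisym; [|apply Cmod_ge_0]. apply le_epsilon. intros eps He.
  set (q := Rmin (1 / 2) (eps / (8 * (B + 1)))).
  assert (Hq1 : (q <= 1 / 2)%R) by apply Rmin_l. assert (Hq2 : (q <= eps / (8 * (B + 1)))%R) by apply Rmin_r.
  assert (Hq0 : (0 < q)%R) by (apply Rmin_pos; [lra|apply Rdiv_lt_0_compat; lra]).
  assert (Hqu : (- rho < q * u < 0)%R) by (unfold u; split; nra).
  destruct (H (q * u)%R Hqu (eps / 2)%R ltac:(lra)) as [N HN]. specialize (HN N (Nat.le_refl N)).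
  pose proof (pser_tail_bound b u q (2 * B) ltac:(lra) ltac:(lra) ltac:(unfold u; lra) Hb N) as T.
  pose proof (Cmod_triangle (pser b (RtoC (q * u)) N - RtoC 0) (- (pser b (RtoC (q * u)) N - b 0%nat))) as T2.
  rewrite Cmod_opp in T2.
  replace (pser b (RtoC (q * u)) N - RtoC 0 + - (pser b (RtoC (q * u)) N - b 0%nat)) with (b 0%nat) in T2 by ring.
  assert (2 * (2 * B) * q <= eps / 2)%R; [|lra].
  apply Rle_trans with (4 * (B + 1) * (eps / (8 * (B + 1))))%R; [|right; field; lra].
  replace (2 * (2 * B) * q)%R with (4 * B * q)%R by ring. apply Rmult_le_compat; lra.
Qed.

Lemma pser_zero n : forall (b : nat -> C) rho, (0 < rho)%R ->
  (forall t : R, (- rho < t < 0)%R -> converges (pser b (RtoC t)) (RtoC 0)) -> b n = RtoC 0.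
Proof.
  induction n as [|n IH]; intros b rho Hr H; [now apply (pser_zero_first b rho)|].
  apply (IH (fun n => b (S n)) rho Hr). intros t Ht.
  assert (Ht0 : RtoC t <> RtoC 0) by (intros E; apply RtoC_inj in E; lra).
  pose proof (pser_zero_first b rho Hr H) as E0.
  apply (converges_ext (fun N => / RtoC t * pser b (RtoC t) (S N))).
  - intros N. rewrite pser_shift, E0. now field.
  - replace (RtoC 0) with (/ RtoC t * RtoC 0) by ring. apply (converges_scal _ (fun N => pser b (RtoC t) (S N))).
    apply converges_S_inv. now apply H.
Qed.

Lemma zetaS_value k a : zetaS k a -> exists rho, (0 < rho)%R /\ forall t : R, (- rho < t < 0)%R ->
  exists v, zeta_value t k v /\ converges (pser a (RtoC t)) v.
Proof.
  intros [rho [F [Hrho H]]]. exists rho. split; [lra|]. intros t Ht. exists (F (RtoC t) (map Z_to_C k)).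
  assert (Hm : (Cmod (RtoC t) < rho)%R) by (rewrite Cmod_R, Rabs_left by lra; lra).
  destruct (H (RtoC t) Hm) as [H1 [H2 H3]]. split.
  - exists (F (RtoC t)). split; [split; assumption|reflexivity].
  - now apply is_series_pser.
Qed.

Lemma zetaS_values (al : list Z -> nat -> C) (L : comb) : (forall lc, In lc L -> zetaS (fst lc) (al (fst lc))) ->
  exists rho, (0 < rho)%R /\ forall t : R, (- rho < t < 0)%R ->
  forall lc, In lc L -> exists v, zeta_value t (fst lc) v /\ converges (pser (al (fst lc)) (RtoC t)) v.
Proof.
  induction L as [|lc L IH]; intros H.
  - exists 1%R. split; [lra|]. intros t _ lc [].
  - destruct IH as [r1 [Hr1 H1]]; [intros; apply H; now right|].
    destruct (zetaS_value _ _ (H lc (or_introl eq_refl))) as [r2 [Hr2 H2]].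
    pose proof (Rmin_l r1 r2). pose proof (Rmin_r r1 r2).
    exists (Rmin r1 r2). split; [now apply Rmin_pos|]. intros t Ht lc' [<-|Hlc]; [apply H2; lra|].
    apply H1; [lra|exact Hlc].
Qed.

(** A total choice of the limit: [reduces] needs the values as one function of the index, whereas
    the hypotheses provide them one by one. *)
Definition Clim (A : nat -> C) : C := (real (Lim_seq (fun N => fst (A N))), real (Lim_seq (fun N => snd (A N)))).

Lemma Clim_converges A L : converges A L -> Clim A = L.
Proof.
  intros H.
  assert (Hc : forall g : C -> R, (forall z w,
    (Rabs (g z - g w) <= Cmod (z - w))%R) -> Lim_seq (fun N => g (A N)) = g L).
  { intros g Hg. apply is_lim_seq_unique, is_lim_seq_spec. intros eps.
    destruct (H (eps / 2)%R ltac:(pose proof (cond_pos eps); lra)) as [N0 HN0]. exists N0. intros N HN.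
    eapply Rle_lt_trans; [apply Hg|]. specialize (HN0 N HN). pose proof (cond_pos eps). lra. }
  unfold Clim. rewrite (Hc fst), (Hc snd).
  - now destruct L.
  - intros z w. apply (abs_im_le_Cmod (z - w)).
  - intros z w. apply (re_le_Cmod (z - w)).
Qed.

Lemma coefficients_equal k L ak al : reduces k L -> zetaS k ak ->
  (forall lc, In lc L -> zetaS (fst lc) (al (fst lc))) -> forall n,
  ak n = csum (fun lc => poly_mul_coef (snd lc) (al (fst lc)) n) L.
Proof.
  intros [_ HL] Hk Hal n.
  destruct (zetaS_value k ak Hk) as [r1 [Hr1 H1]]. destruct (zetaS_values al L Hal) as [r2 [Hr2 H2]].
  set (S := fun n => csum (fun lc => poly_mul_coef (snd lc) (al (fst lc)) n) L).
  pose proof (Rmin_l r1 r2). pose proof (Rmin_r r1 r2).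
  assert (E : ak n + (- RtoC 1) * S n = RtoC 0).
  { apply (pser_zero n (fun n => ak n + (- RtoC 1) * S n) (Rmin r1 r2)); [now apply Rmin_pos|]. intros t Ht.
    destruct (H1 t ltac:(lra)) as [v [Hv Hcv]].
    set (val := fun l => Clim (pser (al l) (RtoC t))).
    assert (Hval : forall lc, In lc L -> zeta_value t (fst lc) (val (fst lc)) /\ converges (pser (al (fst lc)) (RtoC
      t)) (val (fst lc))).
    { intros lc Hlc. destruct (H2 t ltac:(lra) lc Hlc) as [w [Hw Hcw]]. unfold val.
      now rewrite (Clim_converges _ _ Hcw). }
    assert (Ev : v = cev val (RtoC t) L) by (apply HL; [lra|exact Hv|intros; now apply Hval]).
    apply (converges_ext (fun N => pser ak (RtoC t) N + (- RtoC 1) * pser S (RtoC t) N)).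
    { intros N. now rewrite <- pser_scal, <- pser_plus. }
    replace (RtoC 0) with (v + (- RtoC 1) * v) by ring.
    apply converges_plus; [exact Hcv|]. apply converges_scal. rewrite Ev. unfold S. clear -Hval.
    induction L as [|lc L IH].
    - apply (converges_ext (fun _ => RtoC 0)); [|apply (converges_const (RtoC 0))].
      intros N. symmetry. apply csum_zero. intros m _. rewrite csum_nil. ring.
    - rewrite cev_cons. apply (converges_ext (fun N => pser (poly_mul_coef (snd lc) (al (fst lc))) (RtoC t) N +
        pser (fun n => csum (fun lc => poly_mul_coef (snd lc) (al (fst lc)) n) L) (RtoC t) N)).
      + intros N. rewrite <- pser_plus. unfold pser. apply csum_ext. intros m _. now rewrite csum_cons.
      + apply (converges_plus (pser (poly_mul_coef (snd lc) (al (fst lc))) (RtoC t))).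
        * apply pser_poly_mul, Hval. now left.
        * apply IH. intros; apply Hval; now right. }
  replace (ak n) with ((ak n + (- RtoC 1) * S n) + S n) by ring. rewrite E. unfold S. ring.
Qed.

Lemma Q2C_fold_zeta (L : comb) p :
  Q2C (fold_right Qplus 0%Q (map (fun lc => Qmult (Qpoly_eval (snd lc) (inject_Z (Z.of_nat p))) (zeta_p (fst lc) p))
    L)) =
  cev (zetaP p) (RtoC (INR p)) L.
Proof.
  change (Q2C (qsum (fun lc => Qmult (Qpoly_eval (snd lc) (inject_Z (Z.of_nat p))) (zeta_p (fst lc) p)) L) = cev
    (zetaP p) (RtoC (INR p)) L).
  rewrite Q2C_qsum. apply csum_ext. intros lc _. now rewrite Q2C_mult, Q2C_Qpoly_eval, Q2C_inject_nat, Q2C_zeta_p.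
Qed.

Theorem theorem1p2 (k : list Z) :
  exists L : list (list Z * Qpoly),
    (forall l c, In (l, c) L ->
       positive_index l /\ (depth l <= npos k)%nat /\ (weight l <= spos k)%Z) /\
    Ahat_eq (zeta_p k)
      (fun p => fold_right Qplus 0%Q
         (map (fun lc => Qmult (Qpoly_eval (snd lc) (inject_Z (Z.of_nat p)))
                               (zeta_p (fst lc) p)) L)) /\
    (forall (ak : nat -> C) (al : list Z -> nat -> C),
       zetaS k ak ->
       (forall l c, In (l, c) L -> zetaS l (al l)) ->
       forall n : nat,
         eq_mod_pi (ak n)
           (Csum_list (map (fun lc => poly_mul_coef (snd lc) (al (fst lc)) n) L))).
Proof.
  destruct (reduction (length k) k (Nat.le_refl _)) as [L [HA HR]]. exists L. split; [|split].
  - intros l c H. exact (HA (l, c) H).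
  (* The two rationals are equal for every p > 0, so the threshold is 0 for each power of p. *)
  - intros n. exists 0%nat. intros p _ Hp.
    match goal with |- (_ | Qnum (Qred ?d))%Z => assert (E : (d == 0)%Q) end.
    { assert (E0 : (zeta_p k p == fold_right Qplus 0%Q
         (map (fun lc => Qmult (Qpoly_eval (snd lc) (inject_Z (Z.of_nat p))) (zeta_p (fst lc) p)) L))%Q).
      { apply Q2C_inj. rewrite Q2C_fold_zeta, Q2C_zeta_p. apply (proj1 HR). lia. }
      rewrite E0. unfold Qminus. apply Qplus_opp_r. }
    rewrite (Qred_complete _ _ E). apply Z.divide_0_r.
  (* The coefficients coincide in C, so the cofactor of i pi is 0. *)
  - intros ak al Hk Hal n. exists (RtoC (Q2R 0)). split; [apply ZPI_rat|].
    rewrite (coefficients_equal k L ak al HR Hk) by (intros [l c] Hlc; now apply (Hal l c)).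
    change (Csum_list (map ?f ?l)) with (csum f l). fold (Q2C 0). rewrite Q2C_0. unfold Cminus. rewrite Cplus_opp_r.
    ring.
Qed.
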